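(* For $p\in(1/2,1]$ and a positive integer $M$, let $(X_n)_{n\ge 0}$ denote the excited random walk starting at $(0,\omega^{M,p})$, and let its speed be the almost sure limit $\lim_{n\to\infty} X_n/n$. (i) For every $p\in(1/2,1)$ there exists $M_0=M_0(p)$ sufficiently large such that for every integer $M>M_0$ the speed of the excited random walk starting at $(0,\omega^{M,p})$ is strictly positive. (ii) If $p$ and $M$ satisfy $M(2p-1)\in(1,2)$, then the excited random walk starting at $(0,\omega^{M,p})$ is transient but has speed $0$.
   Context: $\mathbb{N}=\{1,2,\dots\}$. An environment is $\omega=(\omega(x,n))_{x\in\mathbb{Z},\,n\in\mathbb{N}}$ with $\omega(x,n)\in[1/2,1]$. The excited random walk (ERW) on $\mathbb{Z}$ started at $(x_0,\omega)$ is the process with $X_0=x_0$ which, whenever it is at a site $x$ for the $n$-th time (time $0$ included), jumps next to $x+1$ with probability $\omega(x,n)$ and to $x-1$ with probability $1-\omega(x,n)$, given the past. Formally, it is the Markov process $(X_n,\omega_n)$ with $(X_0,\omega_0)=(x_0,\omega)$ that moves from $(X_n,\omega_n)$ to $(X_n+1,\theta_{X_n}\omega_n)$ with probability $\omega_n(X_n,1)$ and to $(X_n-1,\theta_{X_n}\omega_n)$ with probability $1-\omega_n(X_n,1)$, where $\theta_z\omega(x,n)=\omega(x,n)$ for $x\ne z$ and $\theta_z\omega(z,n)=\omega(z,n+1)$. For $p>1/2$ and $M\in\mathbb{N}$, $\omega^{M,p}$ is the homogeneous environment with $M$ cookies of intensity $p$ per site: $\omega^{M,p}(x,n)=p$ for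 $n\le M$ and $\omega^{M,p}(x,n)=1/2$ for $n>M$, for every $x\in\mathbb{Z}$. It is known (Zerner) that for this environment the limit $\lim_{n\to\infty}X_n/n$ exists almost surely and is a deterministic constant, called the speed. Transient means that almost surely each site is visited only finitely often. *)

(* Defs.v *)
From HB Require Import structures.
From mathcomp Require Import all_boot all_order all_algebra.
From mathcomp Require Import all_classical all_reals all_analysis.
From mathcomp Require Import lra.

Set Implicit Arguments.
Unset Strict Implicit.
Unset Printing Implicit Defensive.

Import Order.TTheory GRing.Theory Num.Theory.
Import numFieldNormedType.Exports.

Local Open Scope classical_set_scope.
Local Open Scope ring_scope.

(* [w x n] is the probability of jumping to the right at the [n]-th visit to
   [x]. Visits are numbered from 1; the value [w x 0] is never used. *)
Definition env (R : realType) := int -> nat -> R.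

Definition is_environment (R : realType) (w : env R) : Prop :=
  forall (x : int) (n : nat), (0 < n)%N -> 1 / 2 <= w x n <= 1.

Definition theta (R : realType) (z : int) (w : env R) : env R :=
  fun x n => if x == z then w x n.+1 else w x n.

(* The environment [w_n] seen at time [n] by a walk following the path [x]
   from the initial environment [w]: w_0 = w, w_(n+1) = theta_(x_n) w_n. *)
Fixpoint env_at (R : realType) (w : env R) (x : nat -> int) (n : nat) : env R :=
  if n is m.+1 then theta (x m) (env_at w x m) else w.

Definition past (T : Type) (X : nat -> T -> int) (x : nat -> int) (n : nat) :
    set T :=
  [set t | forall k : nat, (k <= n)%N -> X k t = x k].

(* [X] is an excited random walk started at [(x0, w)], for some realization on
   a probability space. Since [(x0, w)] is deterministic, [w_n] is a function of
   [X_0, ..., X_(n-1)], so the past of the Markov process [(X_n, w_n)] up to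
   time [n] is generated by the countably many atoms [past X x n]; conditional
   probabilities given the past are written in product form, which is
   trivial on null atoms. *)
Record is_erw d (T : measurableType d) (R : realType) (P : probability T R)
    (x0 : int) (w : env R) (X : nat -> T -> int) : Prop := IsErw {
  erw_env : is_environment w;
  erw_measurable : forall (n : nat) (z : int), measurable (X n @^-1` [set z]);
  erw_start : P (X 0%N @^-1` [set x0]) = 1%E;
  erw_right : forall (x : nat -> int) (n : nat),
    P (past X x n `&` X n.+1 @^-1` [set x n + 1]) =
    ((env_at w x n (x n) 1%N)%:E * P (past X x n))%E;
  erw_left : forall (x : nat -> int) (n : nat),
    P (past X x n `&` X n.+1 @^-1` [set x n - 1]) =
    ((1 - env_at w x n (x n) 1%N)%:E * P (past X x n))%E
}.

Definition cookie_env (R : realType) (M : nat) (p : R) : env R :=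
  fun _ n => if (n <= M)%N then p else 1 / 2.

Lemma cookie_env_is_environment (R : realType) (M : nat) (p : R) :
  1 / 2 < p <= 1 -> is_environment (cookie_env M p).
Proof.
by move=> /andP[p0 p1] x n _; rewrite /cookie_env; case: ifP => _; lra.
Qed.

Definition has_speed d (T : measurableType d) (R : realType)
    (P : probability T R) (X : nat -> T -> int) (v : R) : Prop :=
  {ae P, forall t, (X n t)%:~R / n%:R @[n --> \oo] --> v}.

Definition transient d (T : measurableType d) (R : realType)
    (P : probability T R) (X : nat -> T -> int) : Prop :=
  {ae P, forall t, forall x : int, finite_set [set n | X n t = x]}.

(* Main.v *)
Require Import Defs.
From mathcomp Require Import all_boot all_order all_algebra.
From mathcomp Require Import all_classical all_reals all_analysis.
From mathcomp Require Import ring lra zify.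

Set Implicit Arguments.
Unset Strict Implicit.
Unset Printing Implicit Defensive.

Import Order.TTheory GRing.Theory Num.Theory.
Import numFieldNormedType.Exports.

Local Open Scope ring_scope.

(** Write [q = 2p - 1] and let [T_n] be the first time the walk is at [n].  On the
    way to [n] a nearest-neighbour path makes [n] more jumps to the right than to
    the left, so [T_n] is [n] plus twice the number [L_n] of jumps to the left
    ([hit_time]), and up to the finitely many visits to negative sites only the
    left jumps from [0, ..., n-1] count.  These are described by a Markov chain: if
    [m] left jumps have been made from [k+1] before [T_n], then the walk has jumped
    right from [k] exactly [m+1] times, so the left jumps from [k] are the failures
    before the [(m+1)]-st success in a sequence of trials with success
    probability [p] for the first [M] of them and [1/2] afterwards.  This is a
    critical branching process with immigration: from [m] large its mean
    displacement is [1 - Mq] and its variance about [2m], so that it should be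
    positive recurrent when [Mq > 1], with a stationary law of finite mean only
    when [Mq > 2].

    The proof makes this quantitative at finite horizon.  Runs of failures are
    capped at [N]; then every expectation is a finite sum of real numbers given
    by a structural recursion ([geo], [negbin], [chain_op]), and since the cap acts
    monotonically a bound obtained for large [N] is as good as the limit.
    The chain starts from [0], the least state, so the mean of a nondecreasing
    function grows with time; hence an upper bound [f + g] for the one-step mean
    of such an [f] forces the mean of [g] to be nonnegative at all times
    ([drift_ge0]).  This takes the place of a stationary law and of ergodic theorems.

    For [Mq > 1], a test function of order [m log m] shows that the chain is tight
    uniformly in time ([chain_tight]).  Every positive level is reached
    ([walkE_hit]), so each site is left to the left finitely often, and the walk is
    transient ([path_transient]).

    For [1 < Mq < 2], a bounded test function of order [m^2 log (A/m)] has drift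
    at least [kappa - min(m, L)], where [kappa] is as large as desired
    ([weak_drift]): the chain behaves as if its mean were infinite.  Exponentiating
    such a drift inequality bounds the probability that [L_n] is below
    [(kappa - eta) n] ([lower_tail]), so [T_n / n] tends to infinity and the speed
    is zero.

    For [M] large the drift is strongly negative, the first and second moments of
    the chain are bounded, and the mean at time [J] is within a constant over [J]
    of its limit [mu] ([iterK_id_cauchy]).  The sum of [J] iterates of a truncated
    identity is then a test function of drift at least [mu - eta - min(m, J+1)], and
    [lower_tail] bounds [L_n / n] from below by [mu] ([low_tail_mean]).  The
    mean of [L_n] is at most [n mu] ([mean_total]); as [L_n] seldom lies much below
    its mean it seldom lies much above ([up_tail]).  Thus [T_n / n] tends
    to [1 + 2 mu], and the speed is [1 / (1 + 2 mu)].

    In the last two cases the probabilities are summable along the levels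
    [(k+1)^12], whose successive ratios tend to [1], so that the Borel-Cantelli
    lemma and interpolation between levels give the limit of [X_n / n]. *)

(** * Geometric and negative binomial expectations *)

(** Here [c] is the number of cookies left at the site. *)
Definition right_bias (R : realFieldType) (p : R) (c : nat) : R :=
  if c is _.+1 then p else 1 / 2.

Definition nondecr (R : realFieldType) (f : nat -> R) := forall d : nat, f d <= f d.+1.

(** The expectation of [f] at the number of failures before the first success,
    when [c] cookies are left and a run of failures is cut off at [N]. *)
Fixpoint geo (R : realFieldType) (p : R) (N c : nat) (f : nat -> R) : R :=
  if N is N'.+1 then
    right_bias p c * f 0%N + (1 - right_bias p c) * geo p N' c.-1 (fun d => f d.+1)
  else f 0%N.

(** The expectation of [f] at the number of failures before the [s]-th success.
    A run of [d] failures and the success that ends it use [d.+1] cookies; the cap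
    [N] applies to each run separately. *)
Fixpoint negbin (R : realFieldType) (p : R) (N c s : nat) (f : nat -> R) : R :=
  if s is s'.+1 then
    geo p N c (fun d => negbin p N (c - d.+1) s' (fun e => f (d + e)%N))
  else f 0%N.

Section Kernel.
Variables (R : realFieldType) (p : R).
Hypothesis hp : 1 / 2 <= p <= 1.
Implicit Types (f g : nat -> R) (N c s d m : nat).

Local Notation w := (right_bias p).
Local Notation geo := (geo p).
Local Notation U := (negbin p).

Lemma right_bias_ge c : 1 / 2 <= w c.
Proof. by case: c => //=; case/andP: hp. Qed.
Lemma right_bias_le c : w c <= 1.
Proof. by case: c => /= [|_]; [lra|case/andP: hp]. Qed.

Lemma nondecr_le f : nondecr f -> forall a b : nat, (a <= b)%N -> f a <= f b.
Proof.
by move=> mf a b /subnKC <-; elim: (b - a)%N => [|k IH]; rewrite ?addn0 // addnS (le_trans IH).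
Qed.

Lemma nondecr_shift f d : nondecr f -> nondecr (fun e => f (d + e)%N).
Proof. by move=> mf e; rewrite addnS. Qed.

Lemma geo_lin N c a b f g :
  geo N c (fun d => a * f d + b * g d) = a * geo N c f + b * geo N c g.
Proof. elim: N c f g => [|N IH] c f g //=; rewrite IH; ring. Qed.

Lemma geoZ N c a f : geo N c (fun d => a * f d) = a * geo N c f.
Proof. elim: N c f => [|N IH] c f //=; rewrite IH; ring. Qed.

Lemma geo_le N c f g : (forall d, f d <= g d) -> geo N c f <= geo N c g.
Proof.
elim: N c f g => [|N IH] c f g fg //=.
apply: lerD; apply: ler_wpM2l => //; last exact: IH.
- by have := right_bias_ge c; lra.
- by have := right_bias_le c; lra.
Qed.

Lemma geo_ext N c f g : (forall d, f d = g d) -> geo N c f = geo N c g.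
Proof. by move=> fg; apply/le_anti/andP; split; apply: geo_le => d; rewrite fg. Qed.

Lemma geo_cst N c (a : R) : geo N c (fun=> a) = a.
Proof. by elim: N c => [|N IH] c //=; rewrite IH; ring. Qed.

Lemma geo_ge_at0 N c f : nondecr f -> f 0%N <= geo N c f.
Proof.
move=> mf; rewrite -{1}(geo_cst N c (f 0%N)); apply: geo_le => d.
exact: nondecr_le.
Qed.

Lemma geo_cap N c f : nondecr f -> geo N c f <= geo N.+1 c f.
Proof.
elim: N c f => [|N IH] c f mf; first exact: (@geo_ge_at0 1).
rewrite [X in X <= _]/= [X in _ <= X]/=; apply: lerD => //.
apply: ler_wpM2l; first by have := right_bias_le c; lra.
by apply: IH => d; exact: mf.
Qed.

(** Replacing the last cookie by a fair trial moves weight from the success,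
    where [f] is smallest, to the failures. *)
Lemma geo_cookies N c f : nondecr f -> geo N c.+1 f <= geo N c f.
Proof.
elim: N c f => [|N IH] c f mf //=.
have mf' : nondecr (fun d => f d.+1) by move=> d; exact: mf.
have h1 : geo N c (fun d => f d.+1) <= geo N c.-1 (fun d => f d.+1).
  by case: c => [|c] //=; exact: IH.
have h2 := geo_ge_at0 N c mf'; have h3 := mf 0%N.
have h4 : w c <= p by case: c {h1 h2} => //=; case/andP: hp.
have h5 : p <= 1 by case/andP: hp.
nra.
Qed.

Lemma geo_mono N N' c c' f : (N <= N')%N -> (c' <= c)%N -> nondecr f ->
  geo N c f <= geo N' c' f.
Proof.
move=> /subnKC <- /subnKC <- mf; apply: (@le_trans _ _ (geo N c' f)).
  elim: (c - c')%N => [|k IH]; rewrite ?addn0 // addnS.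
  exact: le_trans (geo_cookies _ _ mf) IH.
elim: (N' - N)%N => [|k IH]; rewrite ?addn0 // addnS.
exact: le_trans IH (geo_cap _ _ mf).
Qed.

Lemma negbin_lin N c s a b f g :
  U N c s (fun d => a * f d + b * g d) = a * U N c s f + b * U N c s g.
Proof.
elim: s c f g => [|s IH] c f g //=; rewrite -geo_lin.
by apply: geo_ext => d; rewrite IH.
Qed.

Lemma negbin_le N c s f g : (forall d, f d <= g d) -> U N c s f <= U N c s g.
Proof.
elim: s c f g => [|s IH] c f g fg //=.
by apply: geo_le => d; apply: IH.
Qed.

Lemma negbin_ext N c s f g : (forall d, f d = g d) -> U N c s f = U N c s g.
Proof. by move=> fg; apply/le_anti/andP; split; apply: negbin_le => d; rewrite fg. Qed.

Lemma negbin_cst N c s (a : R) : U N c s (fun=> a) = a.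
Proof.
elim: s c => [|s IH] c //=; rewrite -[RHS](geo_cst N c); apply: geo_ext => d.
exact: IH.
Qed.

Lemma negbinZ N c s a f : U N c s (fun d => a * f d) = a * U N c s f.
Proof.
have := negbin_lin N c s a 0 f f; rewrite mul0r addr0 => <-.
by apply: negbin_ext => d; rewrite mul0r addr0.
Qed.

Lemma negbinD N c s f g : U N c s (fun d => f d + g d) = U N c s f + U N c s g.
Proof.
have := negbin_lin N c s 1 1 f g; rewrite !mul1r => <-.
by apply: negbin_ext => d; rewrite !mul1r.
Qed.

Lemma negbinB N c s f g : U N c s (fun d => f d - g d) = U N c s f - U N c s g.
Proof.
have := negbin_lin N c s 1 (-1) f g; rewrite mul1r mulN1r => <-.
by apply: negbin_ext => d; rewrite mul1r mulN1r.
Qed.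

Lemma negbin_sum N c s (I : Type) (r : seq I) (F : I -> nat -> R) :
  U N c s (fun d => \sum_(i <- r) F i d) = \sum_(i <- r) U N c s (F i).
Proof.
elim: r => [|i r IH].
  rewrite big_nil -[RHS](negbin_cst N c s); apply: negbin_ext => d; exact: big_nil.
by rewrite big_cons -IH -negbinD; apply: negbin_ext => d; rewrite big_cons.
Qed.

(** Longer runs and fewer cookies increase the number of failures
    stochastically.  Monotonicity in the cap is what replaces the limit of an
    infinite cap: an upper bound valid for large [N] descends to every smaller cap. *)
Lemma negbin_mono N N' c c' s f : (N <= N')%N -> (c' <= c)%N -> nondecr f ->
  U N c s f <= U N' c' s f.
Proof.
elim: s N N' c c' f => [|s IH] N N' c c' f hN hc mf //=.
apply: (@le_trans _ _ (geo N c (fun d => U N' (c' - d.+1) s (fun e => f (d + e)%N)))).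
  apply: geo_le => d; apply: IH => //; first exact: leq_sub2r.
  exact: nondecr_shift.
apply: geo_mono => // d.
apply: (@le_trans _ _ (U N' (c' - d.+1) s (fun e => f (d.+1 + e)%N))).
  by apply: negbin_le => e; rewrite addSn; exact: mf.
apply: IH => //; first exact: leq_sub2l.
exact: nondecr_shift.
Qed.

Lemma negbinS N c s f :
  U N c s.+1 f = geo N c (fun d => U N (c - d.+1) s (fun e => f (d + e)%N)).
Proof. by []. Qed.

(** The recursion splits off the first run; here the last one is split off.
    When the first [s] runs contain [d] failures they have used [s + d] cookies. *)
Lemma negbin_last N c s f :
  U N c s.+1 f = U N c s (fun d => geo N (c - (s + d)) (fun e => f (d + e)%N)).
Proof.
elim: s c f => [|s IH] c f.
  by rewrite /= subn0; apply: geo_ext => d /=; rewrite addn0.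
rewrite negbinS [RHS]negbinS; apply: geo_ext => d.
rewrite IH; apply: negbin_ext => e.
have -> : (c - d.+1 - (s + e) = c - (s.+1 + (d + e)))%N by lia.
by apply: geo_ext => k; rewrite addnA.
Qed.

(** One more required success adds one run.  All moment estimates below follow
    from this formula by induction on [s]. *)
Lemma negbin_incr N c s f : U N c s.+1 f - U N c s f =
  U N c s (fun d => geo N (c - (s + d)) (fun e => f (d + e)%N - f d)).
Proof.
rewrite negbin_last -negbinB; apply: negbin_ext => d.
have := geo_lin N (c - (s + d)) 1 (-1) (fun e => f (d + e)%N) (fun=> f d).
rewrite geo_cst mul1r mulN1r => <-; apply: geo_ext => e; ring.
Qed.

Lemma negbin_s_mono N c s f : nondecr f -> U N c s f <= U N c s.+1 f.
Proof.
move=> mf; rewrite negbin_last; apply: negbin_le => d.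
by have := geo_ge_at0 N (c - (s + d)) (nondecr_shift d mf); rewrite addn0.
Qed.

Lemma negbin_step N c s f : U N.+1 c s.+1 f =
  w c * U N.+1 c.-1 s f +
  (1 - w c) * geo N c.-1 (fun d => U N.+1 (c.-1 - d.+1) s (fun e => f (d + e).+1)).
Proof.
rewrite negbinS [LHS]/=; congr (_ * _ + _ * _).
  by rewrite subn1.
by apply: geo_ext => d; have -> : (c - d.+2 = c.-1 - d.+1)%N by lia.
Qed.

Lemma nondecr_first_block N c s f : nondecr f ->
  nondecr (fun d => U N (c - d.+1) s (fun e => f (d + e)%N)).
Proof.
move=> mf d.
apply: (@le_trans _ _ (U N (c - d.+1) s (fun e => f (d.+1 + e)%N))).
  by apply: negbin_le => e; rewrite addSn; exact: mf.
apply: negbin_mono => //; first exact: leq_sub2l.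
exact: nondecr_shift.
Qed.

(** After a failure the run in progress has one trial less than the later runs;
    lowering the cap by one in all of them gives an inequality with the same operator
    on both sides.  Because of it the values attached below to the walk are
    superharmonic when the cap decreases by one at each step. *)
Lemma negbin_step_mono N c s f : nondecr f ->
  w c * U N c.-1 s f + (1 - w c) * U N c.-1 s.+1 (fun d => f d.+1) <= U N.+1 c s.+1 f.
Proof.
move=> mf; rewrite negbin_step.
have h1 : U N c.-1 s f <= U N.+1 c.-1 s f by exact: negbin_mono.
have h2 : U N c.-1 s.+1 (fun d => f d.+1) <=
   geo N c.-1 (fun d => U N.+1 (c.-1 - d.+1) s (fun e => f (d + e).+1)).
  rewrite negbinS; apply: geo_le => d; apply: negbin_mono => // e.
  by rewrite addnS; exact: mf.
have := right_bias_ge c; have := right_bias_le c.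
nra.
Qed.

(** Here the run in progress after a failure is given the full cap back,
    which can only increase the number of failures. *)
Lemma negbin_step_mono_cap N c s f : nondecr f ->
  U N.+1 c s.+1 f <= w c * U N.+1 c.-1 s f + (1 - w c) * U N.+1 c.-1 s.+1 (fun d => f d.+1).
Proof.
move=> mf; rewrite negbin_step.
have h2 : geo N c.-1 (fun d => U N.+1 (c.-1 - d.+1) s (fun e => f (d + e).+1)) <=
   U N.+1 c.-1 s.+1 (fun d => f d.+1).
  rewrite negbinS; apply: geo_cap.
  by apply: (@nondecr_first_block N.+1 c.-1 s (fun d => f d.+1)) => d; exact: mf.
have := right_bias_le c.
nra.
Qed.

Lemma negbinN N c s f : U N c s (fun d => - f d) = - U N c s f.
Proof.
rewrite -mulN1r -negbinZ; apply: negbin_ext => d; ring.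
Qed.

Lemma negbin_step_anti N c s f : (forall d, f d.+1 <= f d) ->
  w c * U N.+1 c.-1 s f + (1 - w c) * U N.+1 c.-1 s.+1 (fun d => f d.+1) <= U N.+1 c s.+1 f.
Proof.
move=> mf.
have /(negbin_step_mono_cap N c s) : nondecr (fun d => - f d) by move=> d; rewrite lerN2.
rewrite !negbinN; lra.
Qed.

End Kernel.

(** * The Markov chain of left jumps *)

(** From [m] left jumps at a site to those of the site on its left: the latter is
    left to the right once more than [m], for the first passage. *)
Definition chain_op (R : realFieldType) (p : R) (M N : nat) (f : nat -> R) : nat -> R :=
  fun m => negbin p N M m.+1 f.

Section Chain.
Variables (R : realFieldType) (p : R).
Hypothesis hp : 1 / 2 <= p <= 1.
Variable M : nat.
Implicit Types (f g : nat -> R) (N c s d m : nat).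

Local Notation K := (chain_op p M).

(** The chain is stochastically monotone. *)
Lemma nondecr_chain N f : nondecr f -> nondecr (K N f).
Proof. by move=> mf m; exact: negbin_s_mono. Qed.

Lemma nondecr_iterK N j f : nondecr f -> nondecr (iter j (K N) f).
Proof. by move=> mf; elim: j => //= j IH; exact: nondecr_chain. Qed.

Lemma iterK_le N j f g : (forall m, f m <= g m) -> forall m, iter j (K N) f m <= iter j (K N) g m.
Proof.
by move=> fg; elim: j => //= j IH m; apply: negbin_le.
Qed.

Lemma iterK_lin N j a b f g m :
  iter j (K N) (fun d => a * f d + b * g d) m =
  a * iter j (K N) f m + b * iter j (K N) g m.
Proof.
elim: j m => [//|j IH] m; rewrite !iterS /chain_op -(negbin_lin hp); apply: (negbin_ext hp) => d.
exact: IH.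
Qed.

Lemma iterKZ N j a f m :
  iter j (K N) (fun d => a * f d) m = a * iter j (K N) f m.
Proof.
elim: j m => [//|j IH] m; rewrite !iterS /chain_op -(negbinZ hp); apply: (negbin_ext hp) => d.
exact: IH.
Qed.

Lemma iterKB N j f g m :
  iter j (K N) (fun d => f d - g d) m = iter j (K N) f m - iter j (K N) g m.
Proof.
have := iterK_lin N j 1 (-1) f g m; rewrite !mul1r !mulN1r => <-.
by elim: j m => [|j IH] m /=; [ring|apply: (negbin_ext hp) => d; exact: IH].
Qed.

Lemma iterK_cst N j (a : R) m : iter j (K N) (fun=> a) m = a.
Proof.
elim: j m => [//|j IH] m /=; rewrite -[RHS](negbin_cst hp N M m.+1 a); apply: (negbin_ext hp) => d.
exact: IH.
Qed.

(** The chain starts from its least state, so by monotonicity its law at time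
    [j.+1] dominates the law at time [j]. *)
Lemma iterK_incr N j f : nondecr f -> iter j (K N) f 0%N <= iter j.+1 (K N) f 0%N.
Proof.
move=> mf; rewrite iterS /chain_op -{1}(negbin_cst hp N M 1 (iter j (K N) f 0%N)).
apply: (negbin_le hp) => d.
by apply: (nondecr_le (nondecr_iterK N j mf)).
Qed.

(** The increments [K f - f] have nonnegative mean, because the mean of [f]
    increases with time.  In applications [g] is a constant minus a quantity of
    interest, whose mean is thereby bounded at all times. *)
Lemma drift_ge0 N j f g : nondecr f -> (forall m, K N f m <= f m + g m) ->
  0 <= iter j (K N) g 0%N.
Proof.
move=> mf fg.
apply: (@le_trans _ _ (iter j (K N) (fun m => K N f m - f m) 0%N)).
  by rewrite iterKB subr_ge0 -iterSr; exact: iterK_incr.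
by apply: iterK_le => m; rewrite lerBlDl.
Qed.

Lemma nondecr_id : nondecr (fun d => d%:R : R).
Proof. by move=> d; rewrite ler_nat. Qed.

Lemma geo_id_succ N c :
  geo p N c (fun d => d.+1%:R) = 1 + geo p N c (fun d => d%:R) :> R.
Proof.
have := geo_lin p N c 1 1 (fun=> 1) (fun d => d%:R); rewrite geo_cst !mul1r => <-.
by apply: (geo_ext hp) => d; rewrite !mul1r -natr1 addrC.
Qed.

Lemma negbin_id_succ N c s :
  negbin p N c s (fun d => d.+1%:R) = 1 + negbin p N c s (fun d => d%:R) :> R.
Proof.
have := negbin_lin hp N c s 1 1 (fun=> 1) (fun d => d%:R); rewrite (negbin_cst hp) !mul1r => <-.
by apply: (negbin_ext hp) => d; rewrite !mul1r -natr1 addrC.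
Qed.

Lemma geo_id_le N c : geo p N c (fun d => d%:R) <= 1.
Proof.
elim: N c => [|N IH] c //=.
by rewrite geo_id_succ; have := IH c.-1; have := right_bias_ge hp c; have := right_bias_le hp c; nra.
Qed.

(** The bound [2 (1 - p)] is the mean when exactly one cookie is left, and more
    cookies only help. *)
Lemma geo_id_cookie N c : geo p N c.+1 (fun d => d%:R) <= 2 * (1 - p).
Proof.
case: N => [|N] /=; first by have /andP[_] := hp; lra.
by rewrite geo_id_succ; have := geo_id_le N c; have /andP[_] := hp; nra.
Qed.

Lemma geo_sq_le N c : geo p N c (fun d => d%:R ^+ 2) <= 3.
Proof.
elim: N c => [|N IH] c //=; first by rewrite expr0n /=; lra.
have -> : geo p N c.-1 (fun d => d.+1%:R ^+ 2) =
  1 * geo p N c.-1 (fun d => d%:R ^+ 2) + 1 * geo p N c.-1 (fun d => 2 * d%:R + 1 * 1) :> R.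
  by rewrite -geo_lin; apply: (geo_ext hp) => d; rewrite -natr1; ring.
rewrite geo_lin geo_cst expr0n /=.
by have := IH c.-1; have := geo_id_le N c.-1; have := right_bias_ge hp c;
  have := right_bias_le hp c; nra.
Qed.

Lemma geo_cube_le N c : geo p N c (fun d => d%:R ^+ 3) <= 13.
Proof.
elim: N c => [|N IH] c //=; first by rewrite expr0n /=; lra.
have -> : geo p N c.-1 (fun d => d.+1%:R ^+ 3) =
  1 * geo p N c.-1 (fun d => 1 * d%:R ^+ 3 + 3 * d%:R ^+ 2)
  + 1 * geo p N c.-1 (fun d => 3 * d%:R + 1 * 1) :> R.
  by rewrite -geo_lin; apply: (geo_ext hp) => d; rewrite -natr1; ring.
rewrite !geo_lin geo_cst expr0n /=.
have := IH c.-1; have := geo_sq_le N c.-1; have := geo_id_le N c.-1; have := right_bias_ge hp c.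
by have := right_bias_le hp c; nra.
Qed.

Lemma nondecr_sq : nondecr (fun d => d%:R ^+ 2 : R).
Proof. by move=> d; rewrite -!natrX ler_nat leq_exp2r. Qed.

Lemma nondecr_cube : nondecr (fun d => d%:R ^+ 3 : R).
Proof. by move=> d; rewrite -!natrX ler_nat leq_exp2r. Qed.

(** In optional stopping terms, failures minus successes has mean displacement
    [- (2 p - 1)] per cookie, and at least [minn s c] cookies are used before
    the [s]-th success. *)
Lemma negbin_id_le N c s :
  negbin p N c s (fun d => d%:R) <= s%:R - (2 * p - 1) * (minn s c)%:R.
Proof.
elim: c N s => [|c IH] N s.
  rewrite minn0 mulr0 subr0; elim: s => [//=|s IHs].
  suff : negbin p N 0 s.+1 (fun d => d%:R) - negbin p N 0 s (fun d => d%:R) <= 1.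
    by move: IHs; rewrite -natr1; lra.
  rewrite (negbin_incr hp) -[leRHS](negbin_cst hp N 0 s); apply: (negbin_le hp) => d.
  apply: le_trans (geo_id_le N (0 - (s + d))); apply: (geo_le hp) => e.
  by rewrite natrD; lra.
case: s => [|s]; first by rewrite min0n /=; lra.
apply: le_trans (negbin_mono hp _ (leqnSn N) (leqnn _) nondecr_id) _.
apply: le_trans (negbin_step_mono_cap hp _ _ _ nondecr_id) _.
rewrite -[right_bias p c.+1]/p -[c.+1.-1]/c.
have h1 := IH N.+1 s; have h2 := IH N.+1 s.+1.
rewrite negbin_id_succ.
have h3 : ((minn s c)%:R : R) <= (minn s.+1 c)%:R by rewrite ler_nat; lia.
rewrite minnSS -natr1 -[(minn s c).+1%:R]natr1.
rewrite -natr1 in h2.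
set a := negbin _ _ _ _ _ in h1 *; set b := negbin _ _ _ _ _ in h2 *.
have /andP[hp1 hp2] := hp.
have p0 : 0 <= p by lra.
have p1 : 0 <= 1 - p by lra.
have k1 := ler_wpM2l p0 h1; have k2 := ler_wpM2l p1 h2.
have k3 : 0 <= (1 - p) * ((2 * p - 1) * ((minn s.+1 c)%:R - (minn s c)%:R)).
  by rewrite mulr_ge0 ?mulr_ge0//; lra.
lra.
Qed.

End Chain.

(** * Many cookies: moments of the chain and rate of convergence of its mean *)

Section Strong.
Variables (R : realFieldType) (p : R).
Hypothesis hp : 1 / 2 <= p <= 1.
Variables (M s1 : nat).
Hypothesis hs1 : 4 <= (2 * p - 1) * s1%:R.
Hypothesis hM : (4 * s1 <= M)%N.
Implicit Types (f g : nat -> R) (N c s d m : nat).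

Local Notation K := (chain_op p M).
Local Notation U := (negbin p).
Local Notation id1 := (fun d : nat => d%:R : R).
Local Notation sq := (fun d : nat => d%:R ^+ 2 : R).
Local Notation cube := (fun d : nat => d%:R ^+ 3 : R).

Lemma q_gt0 : 0 < 2 * p - 1.
Proof.
have h := ler0n R s1; have := hs1; rewrite real_ltNge ?realE ?lexx//=; last first.
  by have /andP[] := hp; case: leP => //; lra.
by move=> h1; apply/negP => h2; nra.
Qed.

Lemma negbin_id_le0 N s : U N M s id1 <= s%:R.
Proof.
have := negbin_id_le hp N M s; have := mulr_ge0 (ltW q_gt0) (ler0n R (minn s M)); lra.
Qed.

(** This is a drift of at most [-3] above [s1], as the chain at [m] needs
    [m.+1] successes. *)
Lemma negbin_id_le4 N s : (s1 <= s)%N -> U N M s id1 <= s%:R - 4.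
Proof.
move=> hs; have := negbin_id_le hp N M s.
have : ((2 * p - 1) * s1%:R <= (2 * p - 1) * (minn s M)%:R).
  apply: ler_wpM2l; first exact: ltW q_gt0.
  by rewrite ler_nat; lia.
by have := hs1; lra.
Qed.

(** Beyond [s1] one more run adds at most [2 (s - 4) + 3] to the mean square, which
    sums to [s^2 - 6 s]. *)
Lemma negbin_sq_le N s : U N M s sq <= s%:R ^+ 2 - 6 * s%:R + 8 * s1%:R.
Proof.
suff : U N M s sq <= s%:R ^+ 2 - 6 * s%:R + 8 * (minn s s1)%:R.
  by have : (minn s s1)%:R <= s1%:R :> R; [rewrite ler_nat; lia|lra].
elim: s => [|s IH]; first by rewrite min0n /= expr0n /=; lra.
have h : U N M s.+1 sq - U N M s sq <= 2 * U N M s id1 + 3.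
  rewrite (negbin_incr hp) -[3](negbin_cst hp N M s) -(negbinZ hp) -(negbinD hp).
  apply: (negbin_le hp) => d.
  set c := (M - _)%N.
  have -> : geo p N c (fun e => (d + e)%:R ^+ 2 - d%:R ^+ 2) =
     (2 * d%:R) * geo p N c id1 + 1 * geo p N c sq.
    by rewrite -geo_lin; apply: (geo_ext hp) => e; rewrite natrD; ring.
  have := geo_id_le hp N c; have := geo_sq_le hp N c; have := ler0n R d; nra.
case: (leqP s1 s) => hs.
  have -> : minn s.+1 s1 = minn s s1 by lia.
  by have := negbin_id_le4 N hs; rewrite -natr1; lra.
have -> : minn s.+1 s1 = (minn s s1).+1 by lia.
by have := negbin_id_le0 N s; rewrite -!natr1; lra.
Qed.

Lemma negbin_cube_le N s : U N M s cube <=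
  s%:R ^+ 3 - 6 * s%:R ^+ 2 + (24 * s1%:R + 18) * s%:R.
Proof.
elim: s => [|s IH]; first by rewrite /= !expr0n /=; lra.
have h : U N M s.+1 cube - U N M s cube <= 3 * U N M s sq + (9 * U N M s id1 + 13).
  rewrite (negbin_incr hp) -[13](negbin_cst hp N M s) -!(negbinZ hp) -!(negbinD hp).
  apply: (negbin_le hp) => d.
  set c := (M - _)%N.
  have -> : geo p N c (fun e => (d + e)%:R ^+ 3 - d%:R ^+ 3) =
     1 * geo p N c (fun e => (3 * d%:R ^+ 2) * e%:R + (3 * d%:R) * e%:R ^+ 2)
     + 1 * geo p N c cube.
    by rewrite -geo_lin; apply: (geo_ext hp) => e; rewrite natrD; ring.
  rewrite geo_lin.
  have h1 := geo_id_le hp N c; have h2 := geo_sq_le hp N c; have h3 := ler0n R d.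
  have h4 := geo_cube_le hp N c.
  have h5 : d%:R ^+ 2 * geo p N c id1 <= d%:R ^+ 2 * 1 by apply: ler_wpM2l => //; exact: sqr_ge0.
  have h6 : d%:R * geo p N c sq <= d%:R * 3 by apply: ler_wpM2l.
  lra.
have := negbin_id_le0 N s; have := negbin_sq_le N s; rewrite -natr1; lra.
Qed.

(** Apply [drift_ge0] to the square, whose one-step mean is at most
    [m^2 - 4 m + 8 s1]. *)
Lemma iterK_id_le N j : iter j (K N) id1 0%N <= 2 * s1%:R.
Proof.
have : 0 <= iter j (K N) (fun m => 8 * s1%:R - 4 * m%:R) 0%N.
  apply: (@drift_ge0 _ _ hp M N j sq); first exact: nondecr_sq.
  move=> m; rewrite /chain_op; apply: le_trans (negbin_sq_le N m.+1) _.
  by rewrite -natr1; lra.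
have -> : iter j (K N) (fun m => 8 * s1%:R - 4 * m%:R) 0%N =
   iter j (K N) (fun m => 8 * s1%:R * 1 + (-4) * m%:R) 0%N.
  by apply/le_anti/andP; split; apply: (iterK_le hp) => m; lra.
rewrite (iterK_lin hp) (iterK_cst hp); lra.
Qed.

(** Apply [drift_ge0] to the cube, whose one-step mean is at most [m^3 - 3 m^2]
    plus a linear term, already controlled by [iterK_id_le]. *)
Lemma iterK_sq_le N j :
  3 * iter j (K N) sq 0%N <= (24 * s1%:R + 13) * (2 * s1%:R + 1).
Proof.
have : 0 <= iter j (K N) (fun m => 1 * ((24 * s1%:R + 13) * m%:R + (24 * s1%:R + 13) * 1) + (-3) * m%:R ^+ 2) 0%N.
  apply: (@drift_ge0 _ _ hp M N j cube); first exact: nondecr_cube.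
  move=> m; rewrite /chain_op; apply: le_trans (negbin_cube_le N m.+1) _.
  by rewrite -natr1; have := ler0n R m; lra.
rewrite !(iterK_lin hp) (iterK_cst hp).
have := iterK_id_le N j; have := ler0n R s1; nra.
Qed.

(** An upper solution of the Poisson equation [ell - K ell = id + constant], in the
    sense of [ell_contract].  Its growth [m^2 / 4] suits a drift of [-4]; the linear
    term takes care of the states below [s1], where only the cookies push down. *)
Definition ell (m : nat) : R := m%:R * (m%:R + 1) / 4 + 4 / (2 * p - 1) * m%:R.

Lemma ell_incr m : ell m.+1 - ell m = m.+1%:R / 2 + 4 / (2 * p - 1).
Proof. by rewrite /ell -natr1; lra. Qed.

(** One more individual adds one run, of mean [y].  For [s >= s1] the drift
    of [-4] makes the quadratic term of [ell] gain enough.  For smaller [s] the successes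
    need at most a quarter of the cookies and the failures no more on average, so that
    the run starts on a cookie with probability at least [1 / 2]; its mean is then at
    most [1 - q / 2], and the linear term gains. *)
Lemma ell_contract N : nondecr (fun m => ell m - m%:R - K N ell m).
Proof.
move=> m; rewrite /chain_op.
suff : U N M m.+2 ell - U N M m.+1 ell <= m.+1%:R / 2 + 4 / (2 * p - 1) - 1.
  by have := ell_incr m; rewrite -!natr1; lra.
set s := m.+1.
have hr : 0 < (2 * p - 1)^-1 by rewrite invr_gt0 q_gt0.
have hq : (2 * p - 1) * (2 * p - 1)^-1 = 1 by rewrite divff// gt_eqF// q_gt0.
set r := (2 * p - 1)^-1 in hr hq *.
pose y d := geo p N (M - (s + d)) id1.
have h : U N M s.+1 ell - U N M s ell <=
    1 / 2 * U N M s (fun d => d%:R * y d) + (1 + 4 * r * U N M s y).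
  rewrite (negbin_incr hp) -[X in _ + (X + _)](negbin_cst hp N M s) -!(negbinZ hp) -!(negbinD hp).
  apply: (negbin_le hp) => d; rewrite /y.
  set c := (M - _)%N.
  have -> : geo p N c (fun e => ell (d + e) - ell d) =
     (d%:R / 2 + 1 / 4 + 4 * r) * geo p N c id1 + 1 / 4 * geo p N c sq.
    by rewrite -geo_lin; apply: (geo_ext hp) => e; rewrite /ell natrD -/r; lra.
  have h1 := geo_id_le hp N c; have h2 := geo_sq_le hp N c; lra.
have hy1 d : y d <= 1 by exact: geo_id_le.
have hdy : U N M s (fun d => d%:R * y d) <= U N M s id1.
  by apply: (negbin_le hp) => d; rewrite -[leRHS]mulr1; apply: ler_wpM2l.
case: (leqP s1 s) => hs.
  have hU : U N M s y <= 1 by rewrite -[leRHS](negbin_cst hp N M s); exact: (negbin_le hp).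
  by have := negbin_id_le4 N hs; nra.
have hM0 : 0 < M%:R :> R by rewrite ltr0n; lia.
(* A run that finds no cookie has mean at most [1]; the excess over [2 - 2 p] is
   charged, as in the Markov inequality, to [s + d] having reached [M]. *)
have hy2 d : y d <= (2 - 2 * p) * 1 + (2 * p - 1) / M%:R * (s%:R * 1 + 1 * d%:R).
  have q0 := q_gt0.
  case: (ltnP (s + d) M) => hd.
    have -> : y d = geo p N (M - (s + d)).-1.+1 id1 by rewrite /y prednK// subn_gt0.
    apply: le_trans (geo_id_cookie hp _ _) _.
    have : 0 <= (2 * p - 1) / M%:R * (s%:R * 1 + 1 * d%:R).
      by rewrite mulr_ge0 ?divr_ge0 ?(ltW q0)//; have := ler0n R d; have := ler0n R s; lra.
    lra.
  apply: le_trans (hy1 d) _.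
  have : (2 * p - 1) / M%:R * (s%:R * 1 + 1 * d%:R) >= (2 * p - 1) / M%:R * M%:R.
    apply: ler_wpM2l; first by rewrite divr_ge0 ?(ltW q0).
    by rewrite mulr1 mul1r -natrD ler_nat.
  rewrite divfK ?gt_eqF//; lra.
have hU : U N M s y <= (2 - 2 * p) * 1 + (2 * p - 1) / M%:R * (s%:R * 1 + 1 * U N M s id1).
  apply: le_trans (negbin_le hp _ _ _ hy2) _.
  by rewrite !(negbin_lin hp) !(negbin_cst hp).
have hsM : 2 * s%:R / M%:R <= 1 / 2 :> R.
  rewrite ler_pdivrMr// -[_ * M%:R]mulrC.
  have : 4 * s1%:R <= M%:R :> R by rewrite -natrM ler_nat.
  have : s%:R <= s1%:R :> R by rewrite ler_nat ltnW.
  lra.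
have hU2 : U N M s y <= 2 - 2 * p + (2 * p - 1) / 2.
  apply: le_trans hU _.
  have : (2 * p - 1) / M%:R * (s%:R * 1 + 1 * U N M s id1) <= (2 * p - 1) * (2 * s%:R / M%:R).
    rewrite -!mulrA; apply: ler_wpM2l; first exact: ltW q_gt0.
    rewrite [leRHS]mulrA [leRHS]mulrC; apply: ler_wpM2l; first by rewrite invr_ge0 ltW.
    by have := negbin_id_le0 N s; lra.
  have : (2 * p - 1) * (2 * s%:R / M%:R) <= (2 * p - 1) * (1 / 2).
    by apply: ler_wpM2l => //; exact: ltW q_gt0.
  lra.
have := negbin_id_le0 N s.
have : r * U N M s y <= r * (1 - (2 * p - 1) / 2).
  apply: ler_wpM2l; first exact: ltW.
  by lra.
nra.
Qed.

Lemma nondecr_ell : nondecr ell.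
Proof.
move=> m; rewrite -subr_ge0 ell_incr; have := q_gt0 => q0.
by rewrite addr_ge0// divr_ge0// ltW.
Qed.

Lemma iterK_ell N j : iter j (K N) ell 0%N <=
  (24 * s1%:R + 13) * (2 * s1%:R + 1) + s1%:R + 8 * s1%:R / (2 * p - 1).
Proof.
have r0 : 0 < (2 * p - 1)^-1 by rewrite invr_gt0 q_gt0.
have e : iter j (K N) ell 0%N =
   iter j (K N) (fun d => 1 / 4 * d%:R ^+ 2 + (1 / 4 + 4 / (2 * p - 1)) * d%:R) 0%N.
  by apply/le_anti/andP; split; apply: (iterK_le hp) => d; rewrite /ell; lra.
rewrite e (iterK_lin hp).
have h1 := iterK_id_le N j; have h2 := iterK_sq_le N j.
have h3 := ler0n R s1.
have : (1 / 4 + 4 / (2 * p - 1)) * iter j (K N) id1 0%N <= (1 / 4 + 4 / (2 * p - 1)) * (2 * s1%:R).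
  by apply: ler_wpM2l => //; lra.
have : 0 <= (24 * s1%:R + 13) * (2 * s1%:R + 1) :> R by apply: mulr_ge0; lra.
lra.
Qed.

(** One more individual in the initial state has in the mean at most one more
    descendant, so its influence on the mean decreases with time. *)
Lemma iterK_id_decr N m : forall i j : nat, (i <= j)%N ->
  iter j (K N) id1 m - iter j (K N) id1 0%N <= iter i (K N) id1 m - iter i (K N) id1 0%N.
Proof.
move=> i j /subnKC <-; elim: (j - i)%N => [|k IH]; rewrite ?addn0 // addnS.
apply: le_trans IH; set n := (i + k)%N.
have mf : nondecr (fun d => d%:R - K N id1 d).
  move=> d; rewrite /chain_op.
  suff : U N M d.+2 id1 - U N M d.+1 id1 <= 1 by rewrite -natr1; lra.
  rewrite (negbin_incr hp) -[leRHS](negbin_cst hp N M d.+1); apply: (negbin_le hp) => e.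
  apply: le_trans (geo_id_le hp N (M - (d.+1 + e))); apply: (geo_le hp) => k'.
  by rewrite natrD; lra.
have := nondecr_le (nondecr_iterK hp M N n mf) (leq0n m).
rewrite !(iterKB hp) -!iterSr; lra.
Qed.

(** Summed over time, the influence of the initial state [m] on the mean is at most
    [ell m], by telescoping [ell_contract] along the chain. *)
Lemma iterK_id_sum N J m :
  \sum_(j < J) (iter j (K N) id1 m - iter j (K N) id1 0%N) +
  (iter J (K N) ell m - iter J (K N) ell 0%N) <= ell m.
Proof.
elim: J => [|J IH].
  by rewrite big_ord0 /= {2}/ell; lra.
apply: le_trans IH; rewrite big_ord_recr /= -/(iter J.+1 (K N) ell m) -/(iter J.+1 (K N) ell 0%N).
have := nondecr_le (nondecr_iterK hp M N J (ell_contract N)) (leq0n m).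
rewrite !(iterKB hp) -!iterSr; lra.
Qed.

(** A decreasing sequence of [J.+1] terms with sum at most [ell m] ends
    below [ell m / J.+1]. *)
Lemma iterK_id_rate N J m :
  J.+1%:R * (iter J (K N) id1 m - iter J (K N) id1 0%N) <= ell m.
Proof.
apply: le_trans (iterK_id_sum N J.+1 m).
have h := nondecr_le (nondecr_iterK hp M N J.+1 nondecr_ell) (leq0n m).
apply: (@le_trans _ _ (\sum_(j < J.+1) (iter j (K N) id1 m - iter j (K N) id1 0%N))); last by lra.
apply: (@le_trans _ _ (\sum_(j < J.+1) (iter J (K N) id1 m - iter J (K N) id1 0%N))).
  by rewrite sumr_const card_ord mulr_natl.
by apply: ler_sum => j _; apply: iterK_id_decr; rewrite -ltnS.
Qed.

Definition rate_cst : R := (24 * s1%:R + 13) * (2 * s1%:R + 1) + s1%:R + 8 * s1%:R / (2 * p - 1).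

(** Start the chain at time [i] with its own law instead of [0] and average
    [iterK_id_rate]; the mean of [ell] under that law is bounded. *)
Lemma iterK_id_cauchy N i J :
  J.+1%:R * (iter (i + J) (K N) id1 0%N - iter J (K N) id1 0%N) <= rate_cst.
Proof.
apply: le_trans (iterK_ell N i).
rewrite iterD.
have -> : J.+1%:R * (iter i (K N) (iter J (K N) id1) 0%N - iter J (K N) id1 0%N) =
  iter i (K N) (fun m => J.+1%:R * iter J (K N) id1 m + (- J.+1%:R * iter J (K N) id1 0%N) * 1) 0%N.
  by rewrite (iterK_lin hp) (iterK_cst hp); lra.
apply: (iterK_le hp) => m; have := iterK_id_rate N J m; lra.
Qed.

End Strong.

(** * Elementary inequalities *)

Section Elem.
Variable R : realFieldType.
Implicit Types (x y z : R) (m n : nat).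

Lemma bernoulli_ge y n : 0 <= y <= 1 -> 1 - n%:R * y <= (1 - y) ^+ n.
Proof.
move=> hy; elim: n => [|n IH]; first by rewrite expr0 mul0r subr0.
rewrite exprS -natr1; have h := ler0n R n.
have : (1 - y) * (1 - n%:R * y) <= (1 - y) * (1 - y) ^+ n by apply: ler_wpM2l => //; lra.
have : 0 <= n%:R * y * y by rewrite !mulr_ge0//; lra.
lra.
Qed.

Lemma bernoulli_le y n : 0 <= y <= 1 -> (1 - y) ^+ n <= 1 - n%:R * y + (n%:R * y) ^+ 2.
Proof.
move=> hy; elim: n => [|n IH]; first by rewrite expr0 mul0r subr0 expr0n /=; lra.
rewrite exprS -natr1; have h := ler0n R n.
have : (1 - y) * (1 - y) ^+ n <= (1 - y) * (1 - n%:R * y + (n%:R * y) ^+ 2).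
  by apply: ler_wpM2l => //; lra.
have : 0 <= n%:R * y ^+ 2 by rewrite mulr_ge0// sqr_ge0.
have : 0 <= y * (n%:R * y) ^+ 2 by rewrite mulr_ge0 ?sqr_ge0//; lra.
have := sqr_ge0 y.
lra.
Qed.

(** Equivalently [(1 - y) ^+ n <= 1 / (1 + n y)], a bound valid for all sizes of
    [n y]. *)
Lemma bernoulli_le_div y n : 0 < y <= 1 -> 1 - (1 - y) ^+ n >= n%:R * y / (1 + n%:R * y).
Proof.
move=> hy; elim: n => [|n IH]; first by rewrite expr0 !mul0r subrr.
have h := ler0n R n; have hp : 0 < 1 + n%:R * y by nra.
have hp' : 0 < 1 + n.+1%:R * y by rewrite -natr1; nra.
rewrite exprS; move: IH; rewrite !ler_pdivrMr//; set z := (1 - y) ^+ n => IH.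
have z0 : 0 <= z by rewrite exprn_ge0//; lra.
rewrite -natr1.
have e : (1 - (1 - y) * z) * (1 + (n%:R + 1) * y) =
 (1 + (n%:R + 1) * y) - (1 - y) * (z * (1 + n%:R * y) + z * y) by ring.
have : z * (1 + n%:R * y) <= 1 by lra.
have : z <= 1 by rewrite exprn_ile1//; lra.
rewrite e; nra.
Qed.

Lemma binom_le y n : 0 <= y <= 1 -> (1 + y) ^+ n <= 1 + n%:R * y + 4 ^+ n * y ^+ 2.
Proof.
move=> hy; elim: n => [|n IH]; first by rewrite !expr0 mul0r; have := sqr_ge0 y; lra.
rewrite exprS.
have : (1 + y) * (1 + y) ^+ n <= (1 + y) * (1 + n%:R * y + 4 ^+ n * y ^+ 2).
  by apply: ler_wpM2l => //; lra.
have h : n%:R <= 4 ^+ n :> R.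
  by rewrite -natrX ler_nat; apply: ltnW; apply: ltn_expl.
have : n%:R * y ^+ 2 <= 4 ^+ n * y ^+ 2 by apply: ler_wpM2r => //; exact: sqr_ge0.
have : (4 ^+ n * y ^+ 2) * y <= 4 ^+ n * y ^+ 2.
  rewrite -[leRHS]mulr1; apply: ler_wpM2l; last by lra.
  by rewrite mulr_ge0 ?sqr_ge0 ?exprn_ge0.
rewrite [4 ^+ n.+1]exprS -[n.+1%:R]natr1.
have : 0 <= 4 ^+ n * y ^+ 2 by rewrite mulr_ge0 ?sqr_ge0 ?exprn_ge0.
lra.
Qed.

Lemma telescope_inv n : \sum_(i < n) (1 / (i.+1%:R * i.+2%:R)) <= 1 :> R.
Proof.
have -> : \sum_(i < n) (1 / (i.+1%:R * i.+2%:R)) = 1 - 1 / n.+1%:R :> R.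
  elim: n => [|n IH]; first by rewrite big_ord0; lra.
  rewrite big_ord_recr /= IH -[n.+2%:R]natr1 -[n.+1%:R]natr1.
  have := ler0n R n; set t := n%:R => ht; field.
  by rewrite !gt_eqF//; lra.
by rewrite gerBl divr_ge0.
Qed.

Lemma inv_sq_le i : (i.+1%:R ^+ 2)^-1 <= 2 * (1 / (i.+1%:R * i.+2%:R)) :> R.
Proof.
have h0 : 0 < i.+1%:R :> R by rewrite ltr0n.
rewrite mulrA mulr1 ler_pdivlMr ?mulr_gt0// mulrC ler_pdivrMr ?exprn_gt0//.
rewrite -[i.+2%:R]natr1; have : 1 <= i.+1%:R :> R by rewrite ler1n.
move: h0; set t := i.+1%:R; nra.
Qed.

Lemma sum_inv_sq A : \sum_(i < A) (i.+1%:R ^+ 2)^-1 <= 2 :> R.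
Proof.
apply: le_trans (_ : \sum_(i < A) (2 * (1 / (i.+1%:R * i.+2%:R))) <= _).
  by apply: ler_sum => i _; exact: inv_sq_le.
by rewrite -mulr_sumr; have := telescope_inv A; lra.
Qed.

Lemma expr_sub_le x y n : 0 <= x <= y -> y <= 1 -> y ^+ n - x ^+ n <= n%:R * (y - x).
Proof.
move=> hx hy; elim: n => [|n IH]; first by rewrite !expr0; lra.
rewrite !exprS -natr1.
have h1 : x ^+ n <= 1 by rewrite exprn_ile1//; lra.
have h0 : 0 <= x ^+ n by rewrite exprn_ge0//; lra.
have h2 : x ^+ n <= y ^+ n by rewrite lerXn2r ?nnegrE//; lra.
nra.
Qed.

(** Unlike [expr_sub_le], this bound does not grow with the exponent, at the price of
    staying away from [1]. *)
Lemma expr_sub_unif x y n : 0 <= x <= y -> y < 1 -> y ^+ n - x ^+ n <= (y - x) / (1 - y).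
Proof.
move=> hx hy; have hy1 : 0 < 1 - y by lra.
rewrite ler_pdivlMr//.
elim: n => [|n IH]; first by rewrite !expr0; lra.
rewrite !exprS.
have h1 : x ^+ n <= 1 by rewrite exprn_ile1//; lra.
have h0 : 0 <= x ^+ n by rewrite exprn_ge0//; lra.
have h2 : x ^+ n <= y ^+ n by rewrite lerXn2r ?nnegrE//; lra.
have : y * ((y ^+ n - x ^+ n) * (1 - y)) <= y * (y - x) by apply: ler_wpM2l => //; lra.
have : (y - x) * x ^+ n * (1 - y) <= (y - x) * 1 * (1 - y).
  by apply: ler_wpM2r; [lra|apply: ler_wpM2l; lra].
lra.
Qed.

Definition ratio (i : nat) : R := i%:R / i.+1%:R.
(** For large [i] this is about [exp (- m / i)], so sums over [i] build
    functions of [m] of logarithmic type.  These powers are the eigenfunctions of the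
    fair chain up to a shift of [i]: the law of one fair run is geometric, and its
    generating function is the linear-fractional map sending [ratio i] to [ratio i.+1]. *)
Definition rpow (i m : nat) : R := ratio i ^+ m.

Lemma ratio_compl i : ratio i = 1 - 1 / i.+1%:R.
Proof.
rewrite /ratio -natr1; have := ler0n R i; set t := i%:R => ht; field.
by rewrite gt_eqF//; lra.
Qed.

Lemma inv_bound i : 0 < (1 / i.+1%:R : R) <= 1.
Proof.
rewrite divr_gt0//= ler_pdivrMr// mul1r; by rewrite ler1n.
Qed.

Lemma ratio_ge0 i : 0 <= ratio i.
Proof. by rewrite divr_ge0. Qed.
Lemma ratio_lt1 i : ratio i < 1.
Proof. by rewrite ratio_compl; have /andP[] := inv_bound i; set z := 1 / _; lra. Qed.

Lemma ratio_diff i : ratio i.+1 - ratio i = 1 / (i.+1%:R * i.+2%:R).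
Proof.
rewrite /ratio -[i.+2%:R]natr1 -[i.+1%:R]natr1; have := ler0n R i; set t := i%:R => ht; field.
by rewrite !gt_eqF//; lra.
Qed.

Lemma ratio_le i j : (i <= j)%N -> ratio i <= ratio j.
Proof.
move=> /subnKC <-; elim: (j - i)%N => [|k IH]; rewrite ?addn0 // addnS.
apply: le_trans IH _; by rewrite -subr_ge0 ratio_diff divr_ge0// mulr_ge0.
Qed.

Lemma rpow_ge0 i m : 0 <= rpow i m.
Proof. by rewrite exprn_ge0// ratio_ge0. Qed.
Lemma rpow_le1 i m : rpow i m <= 1.
Proof. by rewrite exprn_ile1// ?ratio_ge0// ltW// ratio_lt1. Qed.
Lemma rpow_le i j m : (i <= j)%N -> rpow i m <= rpow j m.
Proof. by move=> h; rewrite lerXn2r ?nnegrE ?ratio_ge0// ratio_le. Qed.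
Lemma rpow_anti i m : rpow i m.+1 <= rpow i m.
Proof. by rewrite /rpow exprS; apply: ler_piMl; [exact: rpow_ge0|exact: ltW (ratio_lt1 i)]. Qed.
End Elem.

(** * Generating functions of the negative binomial laws *)

Section Expo.
Variables (R : archiRealFieldType) (p : R).
Hypothesis hp : 1 / 2 <= p <= 1.
Variable M : nat.
Implicit Types (f g : nat -> R) (N c s d m : nat).
Local Notation K := (chain_op p M).
Local Notation U := (negbin p).
Local Notation q := (2 * p - 1).
Local Notation delta := (M%:R * (2 * p - 1)).

Lemma negbin_anti N N' c c' s f : (N <= N')%N -> (c' <= c)%N -> (forall d, f d.+1 <= f d) ->
  U N' c' s f <= U N c s f.
Proof.
move=> hN hc mf.
have /(negbin_mono hp s hN hc) : nondecr (fun d => - f d) by move=> d; rewrite lerN2.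
by rewrite !(negbinN hp) lerN2.
Qed.

(** The generating function at [sigma] of one fair run, capped at [N]. *)
Definition geo_pow (sigma : R) N := geo p N 0 (fun d => sigma ^+ d).

Lemma geo_pow0 sigma : geo_pow sigma 0 = 1. Proof. by rewrite /geo_pow /= expr0. Qed.

Lemma geo_exp_shift sigma N c : geo p N c (fun d => sigma ^+ d.+1) =
  sigma * geo p N c (fun d => sigma ^+ d).
Proof.
by rewrite -geoZ; apply: (geo_ext hp) => d; rewrite exprS.
Qed.

Lemma negbin_exp_shift sigma N c s k : U N c s (fun d => sigma ^+ (k + d)) =
  sigma ^+ k * U N c s (fun d => sigma ^+ d).
Proof. by rewrite -(negbinZ hp); apply: (negbin_ext hp) => d; rewrite exprD. Qed.

Lemma geo_powS sigma N : geo_pow sigma N.+1 = 1 / 2 + 1 / 2 * sigma * geo_pow sigma N.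
Proof. by rewrite /geo_pow /= geo_exp_shift expr0; lra. Qed.

Lemma negbin_exp0 sigma N s : U N 0 s (fun d => sigma ^+ d) = geo_pow sigma N ^+ s.
Proof.
elim: s => [|s IH]; first by rewrite expr0 /= expr0.
rewrite negbinS exprS {1}/geo_pow mulrC -geoZ; apply: (geo_ext hp) => d.
by rewrite sub0n negbin_exp_shift IH mulrC.
Qed.

Section Sigma.
Variables (sigma x : R).
Hypothesis hs : 0 <= sigma < 1.
Hypothesis hx : 0 <= x <= 1.
Hypothesis xE : x = 1 / 2 + 1 / 2 * sigma * x.

Lemma geo_pow_ge N : x <= geo_pow sigma N.
Proof.
elim: N => [|N IH]; first by rewrite geo_pow0; case/andP: hx.
rewrite geo_powS {1}xE; apply: lerD => //; apply: ler_wpM2l => //.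
by have /andP[s0 _] := hs; lra.
Qed.

Lemma geo_pow_le N : geo_pow sigma N <= x + (1 / 2) ^+ N.
Proof.
have hs_ := hs; have hx_ := hx.
elim: N => [|N IH]; rewrite ?geo_pow0 ?geo_powS ?expr0; first lra.
rewrite {1}xE exprS.
have : sigma * geo_pow sigma N <= sigma * (x + (1 / 2) ^+ N) by apply: ler_wpM2l => //; lra.
have : 0 <= (1 / 2 : R) ^+ N by rewrite exprn_ge0//; lra.
move: ((1 / 2 : R) ^+ N) => z; nra.
Qed.

Lemma sigma_anti d : sigma ^+ d.+1 <= sigma ^+ d.
Proof.
have hs_ := hs.
by rewrite exprS; apply: ler_piMl; [rewrite exprn_ge0//; lra|lra].
Qed.

(** First-step analysis, by induction on the number of cookies: once they are spent,
    each remaining run contributes a factor at least [x]. *)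
Lemma negbin_exp_ge N c s : (c <= s)%N ->
  x ^+ (s - c) * (p + (1 - p) * sigma * x) ^+ c <= U N.+1 c s (fun d => sigma ^+ d).
Proof.
have /andP[p1 p2] := hp; have hs_ := hs; have hx_ := hx.
elim: c s => [|c IH] s hc.
  rewrite negbin_exp0 subn0 expr0 mulr1 lerXn2r ?nnegrE ?geo_pow_ge//; first lra.
  by have := geo_pow_ge N.+1; lra.
case: s hc => [//|s] hc.
apply: le_trans (negbin_step_anti hp _ _ _ sigma_anti).
have -> : U N.+1 c.+1.-1 s.+1 (fun d => sigma ^+ d.+1) = sigma * U N.+1 c s.+1 (fun d => sigma ^+ d).
  by have := negbin_exp_shift sigma N.+1 c s.+1 1; rewrite expr1 => <-.
rewrite -[right_bias p c.+1]/p -[c.+1.-1]/c subSS.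
have h1 := IH s hc; have h2 := IH s.+1 (leqW hc).
rewrite subSn// exprS in h2.
rewrite exprS; set y := _ ^+ c in h1 h2 *; set z := x ^+ _ in h1 h2 *.
have : p * (z * y) <= p * U N.+1 c s (fun d => sigma ^+ d) by apply: ler_wpM2l => //; lra.
have : (1 - p) * sigma * (x * z * y) <= (1 - p) * sigma * U N.+1 c s.+1 (fun d => sigma ^+ d).
  by apply: ler_wpM2l => //; rewrite mulr_ge0//; lra.
lra.
Qed.

(** The same first-step analysis, where each cookie trial may lose one unit
    of the cap. *)
Lemma negbin_exp_le N c s : (c <= s)%N ->
  U (N + c) c s (fun d => sigma ^+ d) <=
  geo_pow sigma N ^+ (s - c) * (p + (1 - p) * sigma * geo_pow sigma N) ^+ c.
Proof.
have /andP[p1 p2] := hp; have hs_ := hs; have hx_ := hx.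
elim: c s => [|c IH] s hc.
  by rewrite addn0 negbin_exp0 subn0 expr0 mulr1.
case: s hc => [//|s] hc; rewrite addnS (negbin_step hp).
rewrite -[right_bias p c.+1]/p -[c.+1.-1]/c subSS.
have h1 := IH s hc; have h2 := IH s.+1 (leqW hc).
have h3 : U (N + c).+1 c s (fun d => sigma ^+ d) <= U (N + c) c s (fun d => sigma ^+ d).
  by apply: negbin_anti => //; exact: sigma_anti.
have h4 : geo p (N + c) c (fun d => U (N + c).+1 (c - d.+1) s (fun e => sigma ^+ (d + e).+1))
   <= sigma * U (N + c) c s.+1 (fun d => sigma ^+ d).
  have := negbin_exp_shift sigma (N + c) c s.+1 1; rewrite expr1 => <-.
  rewrite negbinS; apply: (geo_le hp) => d; apply: negbin_anti => // e.
  by rewrite addnS; exact: sigma_anti.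
rewrite subSn// exprS in h2.
rewrite exprS; set X := geo_pow sigma N in h1 h2 *; set y := _ ^+ c in h1 h2 *; set z := X ^+ _ in h1 h2 *.
have : p * U (N + c).+1 c s (fun d => sigma ^+ d) <= p * (z * y).
  by apply: ler_wpM2l; [lra|exact: le_trans h1].
have : (1 - p) * (sigma * U (N + c) c s.+1 (fun d => sigma ^+ d)) <= (1 - p) * (sigma * (X * z * y)).
  by apply: ler_wpM2l; [lra|apply: ler_wpM2l => //; lra].
have : (1 - p) * geo p (N + c) c (fun d => U (N + c).+1 (c - d.+1) s (fun e => sigma ^+ (d + e).+1))
   <= (1 - p) * (sigma * U (N + c) c s.+1 (fun d => sigma ^+ d)).
  by apply: ler_wpM2l => //; lra.
lra.
Qed.

(** The error caused by the cap is uniform in [s], by [expr_sub_unif]; this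
    matters because [s] is the state of the chain, over which no bound is available. *)
Lemma negbin_exp_limit (e : R) : x < 1 -> 0 < e -> exists N0, forall N c s, (N0 <= N)%N -> c = M ->
  (c <= s)%N -> U N c s (fun d => sigma ^+ d) <=
    x ^+ (s - c) * (p + (1 - p) * sigma * x) ^+ c + e.
Proof.
have /andP[p1 p2] := hp; have hs_ := hs; have hx_ := hx.
(* [B] bounds the sensitivity of the limit to [x]: [2 / (1 - x)] for the runs without
   cookies, uniformly in [s], and [M] for the trials with a cookie. *)
move=> x1 e0; pose B := 2 / (1 - x) + M%:R.
have x10 : 0 < 1 - x by lra.
have B0 : 0 < B by rewrite ltr_pwDl ?divr_gt0.
pose e' := Num.min (e / B) ((1 - x) / 2).
have e'0 : 0 < e' by rewrite lt_min !divr_gt0.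
have [N0 hN0] : exists N0, (1 / 2 : R) ^+ N0 <= e'.
  exists (Num.truncn (e'^-1)).+1.
  set n := (Num.truncn _).+1.
  have h : e'^-1 < n%:R by apply: truncnS_gt.
  have h2 : n%:R <= 2 ^+ n :> R by rewrite -natrX ler_nat; apply: ltnW; apply: ltn_expl.
  rewrite div1r exprVn -[leRHS]invrK lef_pV2 ?posrE ?invr_gt0 ?exprn_gt0//.
  by apply: le_trans h2; apply: ltW.
exists (N0 + M)%N => N c s hN -> hs'.
apply: le_trans (_ : U (N0 + M) M s (fun d => sigma ^+ d) <= _).
  by apply: negbin_anti => // d; exact: sigma_anti.
apply: le_trans (negbin_exp_le _ hs') _.
set X := geo_pow sigma N0.
have X1 : x <= X by exact: geo_pow_ge.
have X2 : X - x <= e' by have := geo_pow_le N0; rewrite -/X; lra.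
have X3 : e' <= (1 - x) / 2 by rewrite ge_min lexx orbT.
have X4 : e' * B <= e by rewrite -ler_pdivlMr// ge_min lexx.
have hX : X < 1 by lra.
set Y := p + _; set y := p + _.
have hy : 0 <= y <= Y.
  by rewrite /y /Y; apply/andP; split; [rewrite addr_ge0 ?mulr_ge0//; lra|apply: lerD => //; apply: ler_wpM2l => //; rewrite mulr_ge0//; lra].
have hpp : (1 - p) * sigma <= 1 - p by rewrite -[leRHS]mulr1; apply: ler_wpM2l; lra.
have hpp0 : 0 <= (1 - p) * sigma by rewrite mulr_ge0//; lra.
have hY : Y <= 1 by rewrite /Y; nra.
have hYy : Y - y <= X - x by rewrite /Y /y; nra.
have k1 := @expr_sub_unif R x X (s - M) _ hX.
have {}k1 : X ^+ (s - M) - x ^+ (s - M) <= (X - x) / (1 - X) by apply: k1; lra.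
have k2 := expr_sub_le M hy hY.
have k3 : (X - x) / (1 - X) <= e' * (2 / (1 - x)).
  rewrite ler_pdivrMr; last lra.
  apply: (le_trans X2); rewrite -[leLHS]mulr1 -mulrA; apply: ler_wpM2l; first exact: ltW.
  by rewrite mulrAC ler_pdivlMr//; lra.
have k4 : M%:R * (Y - y) <= M%:R * e' by apply: ler_wpM2l => //; lra.
have a1 : 0 <= Y ^+ M <= 1 by rewrite exprn_ge0 ?exprn_ile1//; lra.
have a2 : 0 <= x ^+ (s - M) <= 1 by rewrite exprn_ge0 ?exprn_ile1//; lra.
have a3 : x ^+ (s - M) <= X ^+ (s - M) by rewrite lerXn2r ?nnegrE//; lra.
have a4 : y ^+ M <= Y ^+ M by rewrite lerXn2r ?nnegrE//; lra.
rewrite /B mulrDr in X4.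
move: (X ^+ (s - M)) (x ^+ (s - M)) (Y ^+ M) (y ^+ M) k1 k2 a1 a2 a3 a4 => b1 b2 b3 b4 k1 k2 a1 a2 a3 a4.
have : b1 * b3 - b2 * b4 <= (b1 - b2) + (b3 - b4) by nra.
lra.
Qed.

End Sigma.
End Expo.

(** * Tightness of the chain when M(2p-1) exceeds 1 *)

Section Powers.
Variables (R : archiRealFieldType) (p : R).
Hypothesis hp : 1 / 2 <= p <= 1.
Variable M : nat.
Implicit Types (f g : nat -> R) (N c s d m : nat).
Local Notation K := (chain_op p M).
Local Notation U := (negbin p).
Local Notation q := (2 * p - 1).
Local Notation delta := (M%:R * (2 * p - 1)).
Local Notation ratio := (@ratio R).
Local Notation rpow := (@rpow R).

(** The value of the linear-fractional generating function of a fair run at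
    [ratio i] is [ratio i.+1]. *)
Lemma ratio_fix i : ratio i.+1 = 1 / 2 + 1 / 2 * ratio i * ratio i.+1.
Proof.
rewrite /ratio -[i.+2%:R]natr1 -[i.+1%:R]natr1; have := ler0n R i; set t := i%:R => ht; field.
by rewrite !gt_eqF//; lra.
Qed.

(** The factor contributed by a trial with a cookie, compared with a fair trial
    which would contribute [ratio i.+1]. *)
Lemma ratio_cookie i : p + (1 - p) * ratio i * ratio i.+1 = ratio i.+1 * (1 + q / i.+1%:R).
Proof.
rewrite /ratio -[i.+2%:R]natr1 -[i.+1%:R]natr1; have := ler0n R i; set t := i%:R => ht; field.
by rewrite !gt_eqF//; lra.
Qed.

(** Of the [m.+1] successes required, [M] trials are paid with cookies. *)
Lemma rpow_value i m : (M <= m.+1)%N ->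
  ratio i.+1 ^+ (m.+1 - M) * (p + (1 - p) * ratio i * ratio i.+1) ^+ M =
  rpow i.+1 m * (ratio i.+1 * (1 + q / i.+1%:R) ^+ M).
Proof.
move=> h; rewrite ratio_cookie /rpow.
move: (ratio i.+1) => x; rewrite exprMn; set z := (1 + _) ^+ M.
by rewrite [LHS]mulrA -exprD subnK// exprSr mulrA.
Qed.

Lemma ratio_bounds i : 0 <= ratio i < 1.
Proof. by rewrite ratio_ge0 ratio_lt1. Qed.
Lemma ratio_bounds_le i : 0 <= ratio i <= 1.
Proof. by rewrite ratio_ge0 ltW// ratio_lt1. Qed.

Lemma q_bounds : 0 <= q <= 1.
Proof. by have /andP[h1 h2] := hp; apply/andP; split; lra. Qed.

Lemma inv_succ_gt0 i : 0 < i.+1%:R^-1 :> R. Proof. by rewrite invr_gt0. Qed.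
Lemma inv_succ_le1 i : i.+1%:R^-1 <= 1 :> R. Proof. by rewrite invf_le1// ler1n. Qed.

Lemma bernoulli_pos (z : R) n : 0 <= z -> 1 + n%:R * z <= (1 + z) ^+ n.
Proof.
move=> hz; elim: n => [|n IH]; first by rewrite expr0 mul0r addr0.
rewrite exprS -natr1; have h := ler0n R n.
have : (1 + z) * (1 + n%:R * z) <= (1 + z) * (1 + z) ^+ n by apply: ler_wpM2l => //; lra.
have : 0 <= n%:R * z * z by rewrite !mulr_ge0.
lra.
Qed.

(** The multiplier is [1 + (delta - 1) / i.+2], the first order part of
    [ratio i.+1 * (1 + q / i.+1) ^ M]: the sign of [delta - 1] decides the direction of
    the drift. *)
Lemma K_rpow_ge N i m : (M <= m.+1)%N ->
  rpow i.+1 m * ((i.+1%:R + delta) / i.+2%:R) <= K N.+1 (rpow i) m.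
Proof.
move=> h; rewrite /chain_op.
apply: le_trans (negbin_exp_ge hp (ratio_bounds i) (ratio_bounds_le i.+1) (ratio_fix i) N h).
rewrite rpow_value//; apply: ler_wpM2l; first exact: rpow_ge0.
have /andP[q0 q1] := q_bounds; have i0 := inv_succ_gt0 i.
have := @bernoulli_pos (q / i.+1%:R) M (mulr_ge0 q0 (ltW i0)).
have -> : (i.+1%:R + delta) / i.+2%:R = ratio i.+1 * (1 + M%:R * (q / i.+1%:R)).
  rewrite /ratio -[i.+2%:R]natr1 -[i.+1%:R]natr1; have := ler0n R i; set t := i%:R => ht; field.
  by rewrite !gt_eqF//; lra.
by move=> hb; apply: ler_wpM2l => //; exact: ratio_ge0.
Qed.

Lemma K_rpow_le i (e : R) : 0 < e -> exists N0, forall N, (N0 <= N)%N -> forall m, (M <= m.+1)%N ->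
  K N (rpow i) m <= rpow i.+1 m * ((i.+1%:R + delta + 4 ^+ M / i.+1%:R) / i.+2%:R) + e.
Proof.
move=> e0.
have [N0 hN0] := negbin_exp_limit hp M (ratio_bounds i) (ratio_bounds_le i.+1) (ratio_fix i) (ratio_lt1 R i.+1) e0.
exists N0 => N hN m hm; rewrite /chain_op.
apply: le_trans (hN0 N M m.+1 hN erefl hm) _.
rewrite rpow_value// lerD2r; apply: ler_wpM2l; first exact: rpow_ge0.
have /andP[q0 q1] := q_bounds; have i0 := inv_succ_gt0 i; have i1 := inv_succ_le1 i.
have hz : 0 <= q / i.+1%:R <= 1.
  rewrite mulr_ge0 ?(ltW i0)//=; apply: le_trans i1; rewrite -[leRHS]mul1r.
  by apply: ler_wpM2r => //; exact: ltW.
have hb := binom_le M hz.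
have hC : 0 <= 4 ^+ M :> R by rewrite exprn_ge0.
apply: le_trans (ler_wpM2l (ratio_ge0 R i.+1) hb) _.
have -> : (i.+1%:R + delta + 4 ^+ M / i.+1%:R) / i.+2%:R =
   ratio i.+1 * (1 + M%:R * (q / i.+1%:R) + 4 ^+ M * (i.+1%:R^-1) ^+ 2).
  rewrite /ratio -[i.+2%:R]natr1 -[i.+1%:R]natr1; have := ler0n R i; set t := i%:R => ht; field.
  by rewrite !gt_eqF//; lra.
apply: ler_wpM2l; first exact: ratio_ge0.
rewrite lerD2l; apply: ler_wpM2l => //; rewrite lerXn2r ?nnegrE ?(ltW i0)//.
  by case/andP: hz.
by rewrite -[leRHS]mul1r; apply: ler_wpM2r => //; exact: ltW.
Qed.

Lemma K_rpow_le_all A (e : R) : 0 < e -> exists N0, forall N, (N0 <= N)%N ->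
  forall i m, (i < A)%N -> (M <= m.+1)%N ->
  K N (rpow i) m <= rpow i.+1 m * ((i.+1%:R + delta + 4 ^+ M / i.+1%:R) / i.+2%:R) + e.
Proof.
move=> e0; elim: A => [|A [N0 IH]]; first by exists 0%N.
have [N1 h1] := K_rpow_le A e0.
exists (N0 + N1)%N => N hN i m; rewrite ltnS leq_eqVlt => /orP[/eqP ->|hi] hm.
  by apply: h1 => //; apply: leq_trans hN; rewrite leq_addl.
by apply: IH => //; apply: leq_trans hN; rewrite leq_addr.
Qed.

Section Tight.
Hypothesis hd : 1 < delta.

(** Since [rpow i m - 1 + m / i.+1] is about [m / i] when [i < m] and about
    [m^2 / i^2] otherwise, this sum is of order [m log m] as long as [m < A]. *)
Definition mlog (A m : nat) : R := \sum_(i < A) (rpow i m - 1 + m%:R / i.+1%:R).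
(** Of order [log m] as long as [m < A]. *)
Definition logsum (A m : nat) : R := \sum_(i < A) ((1 - rpow i.+1 m) / i.+2%:R).

Lemma rpow_bern i m : 1 - m%:R / i.+1%:R <= rpow i m.
Proof.
rewrite /rpow ratio_compl; have /andP[h1 h2] := inv_bound R i.
by have := @bernoulli_ge R (1 / i.+1%:R) m; rewrite (ltW h1) h2 mul1r; apply.
Qed.

Lemma rpow_bern2 i m : rpow i m <= 1 - m%:R / i.+1%:R + m%:R ^+ 2 / i.+1%:R ^+ 2.
Proof.
rewrite /rpow ratio_compl; have /andP[h1 h2] := inv_bound R i.
have := @bernoulli_le R (1 / i.+1%:R) m; rewrite (ltW h1) h2 mul1r exprMn exprVn => h; exact: h.
Qed.

Lemma rpow_incr i m : rpow i m - rpow i m.+1 = rpow i m / i.+1%:R.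
Proof.
have e : i.+1%:R^-1 = 1 - ratio i by rewrite ratio_compl div1r; ring.
by rewrite /rpow exprS e; ring.
Qed.

Lemma mlog_mono A : nondecr (mlog A).
Proof.
move=> m; apply: ler_sum => i _; have := rpow_incr i m; have := rpow_le1 R i m; have := rpow_ge0 R i m.
rewrite -[m.+1%:R]natr1 mulrDl mul1r; have := inv_succ_gt0 i; have := inv_succ_le1 i; move: (i.+1%:R^-1) => z.
move: (rpow i m) (rpow i m.+1) (m%:R * z) => a b c; nra.
Qed.

Lemma mlog_ge0 A m : 0 <= mlog A m.
Proof. by apply: sumr_ge0 => i _; have := rpow_bern i m; move: (i.+1%:R^-1) => z; lra. Qed.

Lemma mlog_le A m : mlog A m <= 2 * m%:R ^+ 2.
Proof.
apply: le_trans (_ : \sum_(i < A) (m%:R ^+ 2 * (i.+1%:R ^+ 2)^-1) <= _).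
  by apply: ler_sum => i _; have := rpow_bern2 i m; move: (i.+1%:R^-1) ((i.+1%:R ^+ 2)^-1) => z z'; lra.
by rewrite -mulr_sumr mulrC; apply: ler_wpM2r; [exact: sqr_ge0|exact: sum_inv_sq].
Qed.

Lemma logsum_le A m : logsum A m <= m%:R.
Proof.
apply: le_trans (_ : \sum_(i < A) (m%:R * (1 / (i.+1%:R * i.+2%:R))) <= _).
  apply: ler_sum => i _; rewrite mul1r invfM.
  have h := rpow_bern i.+1 m; have h1 := inv_succ_gt0 i; have h2 := inv_succ_gt0 i.+1.
  have h3 : i.+2%:R^-1 <= i.+1%:R^-1 :> R by rewrite lef_pV2 ?posrE// ler_nat.
  rewrite mulrA; apply: ler_wpM2r; first exact: ltW.
  apply: (@le_trans _ _ (m%:R / i.+2%:R)).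
    by move: h; move: (i.+2%:R^-1) => z; lra.
  by apply: ler_wpM2l.
by rewrite -mulr_sumr -[leRHS]mulr1; apply: ler_wpM2l => //; exact: telescope_inv.
Qed.

Lemma K_sum N (A : nat) (F : nat -> nat -> R) m :
  K N (fun d => \sum_(i < A) F i d) m = \sum_(i < A) K N (F i) m.
Proof. by rewrite /chain_op (negbin_sum hp). Qed.

Lemma telescope_rpow A m : \sum_(i < A) (rpow i.+1 m - rpow i m) = rpow A m - rpow 0 m.
Proof.
elim: A => [|A IH]; first by rewrite big_ord0 subrr.
by rewrite big_ord_recr /= IH; lra.
Qed.

Definition tight_cst : R := 4 ^+ M + 3 + 2 * M%:R ^+ 2 + delta * M%:R.

(** Each term is mapped to its successor up to a factor
    [1 + (delta - 1) / i.+2]: the differences telescope, the second order errors are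
    summable, and in the linear part the drift [1 - delta] of the identity combines
    with the factor into [- (delta - 1) * logsum]. *)
(** The states below [M] are compared with [M.-1] by monotonicity. *)
Lemma mlog_drift_big A : exists N0, forall N, (N0 <= N)%N -> forall m, (M <= m.+1)%N ->
  K N (mlog A) m <= mlog A m + (4 ^+ M + 2) - (delta - 1) * logsum A m.
Proof.
have e0 : 0 < 1 / A.+1%:R :> R by rewrite divr_gt0.
have [N0 hN0] := K_rpow_le_all A e0.
exists N0 => N hN m hm.
have Kid : K N (fun d => d%:R) m <= m%:R + 1 - delta.
  by have := negbin_id_le hp N M m.+1; rewrite (minn_idPr hm) -[m.+1%:R]natr1 mulrC.
have -> : K N (mlog A) m = \sum_(i < A) (K N (rpow i) m - 1 + K N (fun d => d%:R) m / i.+1%:R).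
  rewrite /mlog (K_sum N A (fun i d => rpow i d - 1 + d%:R / i.+1%:R)); apply: eq_bigr => i _.
  rewrite /chain_op (negbinD hp) (negbinB hp) (negbin_cst hp); congr (_ + _).
  by rewrite mulrC -(negbinZ hp); apply: (negbin_ext hp) => d; rewrite mulrC.
pose T (i : nat) := (rpow i m - 1 + m%:R / i.+1%:R) + (rpow i.+1 m - rpow i m)
   + 4 ^+ M * (1 / (i.+1%:R * i.+2%:R)) + 1 / A.+1%:R - (delta - 1) * ((1 - rpow i.+1 m) / i.+2%:R).
apply: (@le_trans _ _ (\sum_(i < A) T i)).
  apply: ler_sum => i _; rewrite /T.
  have h1 := hN0 N hN i m (ltn_ord i) hm.
  have i0 := inv_succ_gt0 i.
  have h2 : K N (fun d => d%:R) m / i.+1%:R <= (m%:R + 1 - delta) / i.+1%:R.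
    by apply: ler_wpM2r => //; exact: ltW.
  have e1 : (i.+1%:R + delta + 4 ^+ M / i.+1%:R) / i.+2%:R =
     1 + (delta - 1) / i.+2%:R + 4 ^+ M * (1 / (i.+1%:R * i.+2%:R)).
    rewrite -[i.+2%:R]natr1 -[i.+1%:R]natr1; have := ler0n R i; set t := i%:R => ht; field.
    by rewrite !gt_eqF//; lra.
  rewrite e1 in h1.
  have u1 := rpow_le1 R i.+1 m; have u0 := rpow_ge0 R i.+1 m.
  have h3 : i.+2%:R^-1 <= i.+1%:R^-1 :> R by rewrite lef_pV2 ?posrE// ler_nat.
  have h4 : 0 <= 4 ^+ M * (1 / (i.+1%:R * i.+2%:R)) :> R.
    by rewrite mulr_ge0 ?exprn_ge0// divr_ge0// mulr_ge0.
  have h5 : rpow i.+1 m * (4 ^+ M * (1 / (i.+1%:R * i.+2%:R))) <= 4 ^+ M * (1 / (i.+1%:R * i.+2%:R)).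
    exact: ler_piMl.
  have h6 : (delta - 1) * i.+2%:R^-1 <= (delta - 1) * i.+1%:R^-1.
    by apply: ler_wpM2l => //; have := hd; lra.
  set z := 4 ^+ M * _ in h1 h4 h5 *; set e := 1 / A.+1%:R in h1 *.
  move: (i.+1%:R^-1) (i.+2%:R^-1) i0 h2 h3 h6 h1 => a b; lra.
have -> : \sum_(i < A) T i = mlog A m + (rpow A m - rpow 0 m) +
   4 ^+ M * (\sum_(i < A) (1 / (i.+1%:R * i.+2%:R))) + A%:R / A.+1%:R - (delta - 1) * logsum A m.
  rewrite /T sumrB 3!big_split /= telescope_rpow -mulr_sumr sumr_const card_ord -[_ *+ A]mulr_natl -/(mlog A m).
  by rewrite /logsum [(delta - 1) * \sum_(_ < _) _]mulr_sumr [1 / A.+1%:R]div1r.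
have h1 : 4 ^+ M * (\sum_(i < A) (1 / (i.+1%:R * i.+2%:R))) <= 4 ^+ M :> R.
  by rewrite -[leRHS]mulr1; apply: ler_wpM2l; [rewrite exprn_ge0|exact: telescope_inv].
have h2 : A%:R / A.+1%:R <= 1 :> R by rewrite ler_pdivrMr// mul1r ler_nat.
have := rpow_le1 R A m; have := rpow_ge0 R 0 m.
by move: (_ * \sum_(i < A) _) (A%:R / _) (4 ^+ M) h1 h2 => S z C; lra.
Qed.

Lemma mlog_drift A : exists N0, forall N, (N0 <= N)%N -> forall m,
  K N (mlog A) m <= mlog A m + (tight_cst - (delta - 1) * logsum A m).
Proof.
have [N0 hN0] := mlog_drift_big A.
exists N0 => N hN m; rewrite /tight_cst.
have d1 := hd.
have hM1 : 0 <= 2 * M%:R ^+ 2 + delta * M%:R.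
  have := sqr_ge0 (M%:R : R); have : 0 <= delta * M%:R by apply: mulr_ge0 => //; lra.
  lra.
case: (leqP M m.+1) => hm.
  by have := hN0 N hN m hm; lra.
have hM : (M <= M.-1.+1)%N by case: M.
have h1 := hN0 N hN M.-1 hM.
have h2 : K N (mlog A) m <= K N (mlog A) M.-1.
  apply: (nondecr_le (nondecr_chain hp M N (mlog_mono A))); lia.
have h3 := mlog_ge0 A m; have h4 := logsum_le A m.
have h5 : mlog A M.-1 <= 2 * M%:R ^+ 2.
  apply: le_trans (mlog_le A _) _; apply: ler_wpM2l => //.
  by rewrite -!natrX ler_nat leq_exp2r// leq_pred.
have h6 : 0 <= logsum A M.-1.
  by apply: sumr_ge0 => i _; rewrite divr_ge0// subr_ge0 rpow_le1.
have h7 : m%:R <= M%:R :> R by rewrite ler_nat ltnW// ltnW.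
have h8 : (delta - 1) * logsum A m <= delta * M%:R.
  apply: (@le_trans _ _ ((delta - 1) * M%:R)).
    by apply: ler_wpM2l; lra.
  by apply: ler_wpM2r => //; lra.
have h9 : 0 <= (delta - 1) * logsum A M.-1 by rewrite mulr_ge0//; lra.
have : 0 <= logsum A m.
  by apply: sumr_ge0 => i _; rewrite divr_ge0// subr_ge0 rpow_le1.
lra.
Qed.

Lemma iterK_capmono N N' j f m : (N <= N')%N -> nondecr f -> iter j (K N) f m <= iter j (K N') f m.
Proof.
move=> hN mf; elim: j m => [//|j IH] m; rewrite !iterS.
apply: le_trans (_ : K N (iter j (K N') f) m <= _).
  by apply: (negbin_le hp).
by apply: (negbin_mono hp) => //; exact: nondecr_iterK.
Qed.

Lemma logsum_mono A : nondecr (logsum A).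
Proof.
move=> m; apply: ler_sum => i _; apply: ler_wpM2r; first by rewrite invr_ge0.
by have := rpow_anti R i.+1 m; lra.
Qed.

(** [drift_ge0] for [mlog], first with a cap large enough for [mlog_drift], then for
    every cap because [logsum] is nondecreasing. *)
Lemma iterK_logsum A N j : (delta - 1) * iter j (K N) (logsum A) 0%N <= tight_cst.
Proof.
have [N0 hN0] := mlog_drift A.
have h1 : iter j (K N) (logsum A) 0%N <= iter j (K (N0 + N)) (logsum A) 0%N.
  by apply: iterK_capmono; [rewrite leq_addl|exact: logsum_mono].
have h2 : 0 <= iter j (K (N0 + N)) (fun m => tight_cst - (delta - 1) * logsum A m) 0%N.
  apply: (@drift_ge0 _ _ hp M (N0 + N) j (mlog A)); first exact: mlog_mono.
  by apply: hN0; rewrite leq_addr.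
have e : iter j (K (N0 + N)) (fun m => tight_cst - (delta - 1) * logsum A m) 0%N =
  tight_cst - (delta - 1) * iter j (K (N0 + N)) (logsum A) 0%N.
  by rewrite (iterKB hp) (iterK_cst hp) (iterKZ hp).
rewrite e in h2.
have : (delta - 1) * iter j (K N) (logsum A) 0%N <= (delta - 1) * iter j (K (N0 + N)) (logsum A) 0%N.
  by apply: ler_wpM2l => //; have := hd; lra.
lra.
Qed.

End Tight.

Definition harm (A : nat) : R := \sum_(i < A) i.+2%:R^-1.

(** From [1 - (1 - y)^m >= m y / (1 + m y)], which stays sharp when [m] is
    large compared with [i]. *)
Lemma rpow_lower i m b : (b <= m)%N -> b%:R / (i.+1%:R + b%:R) <= 1 - rpow i m.
Proof.
move=> hb; rewrite /rpow ratio_compl; have hi := inv_bound R i.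
apply: le_trans (bernoulli_le_div m hi).
have h0 : 0 < i.+1%:R :> R by rewrite ltr0n.
have -> : m%:R * (1 / i.+1%:R) / (1 + m%:R * (1 / i.+1%:R)) = m%:R / (i.+1%:R + m%:R) :> R.
  have := ler0n R m; move: h0; set t := i.+1%:R; set z := m%:R => h0 h1; field.
  by rewrite !gt_eqF//; lra.
have b0 := ler0n R b; have m0 := ler0n R m; have bm : b%:R <= m%:R :> R by rewrite ler_nat.
rewrite ler_pdivrMr; last lra.
rewrite mulrAC ler_pdivlMr; last lra.
move: h0 b0 m0 bm; set t := i.+1%:R; nra.
Qed.

Lemma logsum_ge k m : (0 < m)%N -> (k <= m)%N -> harm k / 3 <= logsum k m.
Proof.
move=> m0 hk; rewrite /harm mulr_suml; apply: ler_sum => i _.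
rewrite mulrC; apply: ler_wpM2r; first by rewrite invr_ge0.
apply: le_trans (@rpow_lower i.+1 m m (leqnn m)).
rewrite ler_pdivlMr; last by rewrite ltr_pwDl// ltr0n.
have : i.+2%:R <= m%:R + 1 :> R by rewrite natr1 ler_nat; have := ltn_ord i; lia.
have : 1 <= m%:R :> R by rewrite ler1n.
lra.
Qed.

Lemma harm_mono a b : (a <= b)%N -> harm a <= harm b.
Proof.
move=> /subnKC <-; elim: (b - a)%N => [|k IH]; rewrite ?addn0 // addnS.
by apply: le_trans IH _; rewrite /harm [leRHS]big_ord_recr /= lerDl invr_ge0.
Qed.

Lemma harm_dvg (B : R) : exists A, B <= harm A.
Proof.
(* The terms of index [A] to [2 A + 1] add up to at least [1 / 2]. *)
have dbl A : harm A + 1 / 2 <= harm (A + A.+2).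
  have hA : forall k, harm A + k%:R / (A + k).+1%:R <= harm (A + k).
    elim=> [|k IH]; first by rewrite mul0r addn0 addr0.
    have hS n : harm n.+1 = harm n + n.+2%:R^-1 by rewrite /harm big_ord_recr.
    rewrite addnS hS.
    have h1 : (A + k).+2%:R^-1 <= (A + k).+1%:R^-1 :> R by rewrite lef_pV2 ?posrE// ler_nat.
    have := ler_wpM2l (ler0n R k) h1; rewrite -[k.+1%:R]natr1 mulrDl mul1r.
    by move: IH; move: ((A + k).+1%:R^-1) ((A + k).+2%:R^-1) => z z'; lra.
  apply: le_trans (hA A.+2); rewrite lerD2l ler_pdivlMr//.
  have : (A + A.+2).+1%:R <= 2 * A.+2%:R :> R by rewrite -natrM ler_nat; lia.
  move: ((A + A.+2).+1%:R) (A.+2%:R) => a b; lra.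
have : forall n : nat, exists A, n%:R / 2 <= harm A.
  elim=> [|n [A IH]]; first by exists 0%N; rewrite mul0r /harm big_ord0.
  exists (A + A.+2)%N; apply: le_trans (dbl A); rewrite -natr1; lra.
move=> /(_ (Num.truncn (2 * B)).+1) [A hA]; exists A; apply: le_trans hA.
have := truncnS_gt (2 * B); lra.
Qed.

(** The mean of [logsum A] is bounded uniformly in [A], while [logsum A] is at least
    a third of the harmonic sum on the states above [A]; the harmonic series
    diverges. *)
Lemma chain_tight (e : R) : 1 < delta -> 0 < e -> exists k, forall N j,
  iter j (K N) (fun m => (k <= m)%N%:R) 0%N <= e.
Proof.
move=> d1 e0.
have [A hA] := harm_dvg (3 * tight_cst / ((delta - 1) * e)).
exists A.+1 => N j.
have C0 : 0 < tight_cst.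
  rewrite /tight_cst; have : 0 <= 4 ^+ M :> R by rewrite exprn_ge0.
  have := sqr_ge0 (M%:R : R); have : 0 <= delta * M%:R by apply: mulr_ge0 => //; lra.
  lra.
have h0 : 0 < harm A by apply: lt_le_trans hA; rewrite divr_gt0 ?mulr_gt0//; lra.
have h1 := @iterK_logsum d1 A N j.
have h2 : harm A / 3 * iter j (K N) (fun m => (A.+1 <= m)%N%:R) 0%N <= iter j (K N) (logsum A) 0%N.
  rewrite -(iterKZ hp); apply: (iterK_le hp) => m; case: (leqP A.+1 m) => hm.
    by rewrite mulr1; apply: logsum_ge; [exact: leq_trans hm|exact: ltnW].
  by rewrite mulr0; apply: sumr_ge0 => i _; rewrite divr_ge0 ?subr_ge0 ?rpow_le1.
have h3 : 3 * tight_cst <= harm A * ((delta - 1) * e).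
  by rewrite -ler_pdivrMr// mulr_gt0//; lra.
move: h1 h2; set x := iter _ _ (fun m => _%:R) _; set y := iter _ _ _ _ => h1 h2.
have k1 : (delta - 1) * (harm A / 3 * x) <= (delta - 1) * y by apply: ler_wpM2l => //; lra.
have k2 : (delta - 1) * harm A * x <= (delta - 1) * harm A * e by lra.
by rewrite ler_pM2l in k2 => //; rewrite mulr_gt0//; lra.
Qed.

End Powers.

(** * Infinite mean of the chain when M(2p-1) lies between 1 and 2 *)

Section Weak.
Variables (R : archiRealFieldType) (p : R).
Hypothesis hp : 1 / 2 <= p <= 1.
Variable M : nat.
Hypothesis hp1 : p < 1.
Implicit Types (f g : nat -> R) (N c s d m : nat).
Local Notation K := (chain_op p M).
Local Notation U := (negbin p).
Local Notation q := (2 * p - 1).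
Local Notation delta := (M%:R * (2 * p - 1)).
Local Notation ratio := (@ratio R).
Local Notation rpow := (@rpow R).
Hypothesis hd : 1 < delta < 2.

(** With [a = i.+1] the sum of [a (exp (- m / a) - 1)] alone is of order [- m B]; the
    last term cancels this main part and leaves a function of order
    [m^2 log (B / m)] for [m < B], bounded by [B.+1 ^ 2]. *)
Definition sqlog (B m : nat) : R :=
  \sum_(i < B.+1) (i.+1%:R * (rpow i m - 1)) + B.+1%:R ^+ 2 * (1 - rpow B m).

(** The increment is a sum of nonnegative terms, about [m log (B / m)]. *)
Lemma sqlog_incr B m : sqlog B m.+1 - sqlog B m = \sum_(i < B.+1) (rpow B m - rpow i m).
Proof.
rewrite /sqlog sumrB sumr_const card_ord.
have e i : i.+1%:R * (rpow i m.+1 - 1) = i.+1%:R * (rpow i m - 1) - rpow i m.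
  have h := rpow_incr R i m.
  have h0 : i.+1%:R != 0 :> R by rewrite pnatr_eq0.
  have -> : rpow i m.+1 = rpow i m - rpow i m / i.+1%:R by rewrite -h; ring.
  rewrite mulrBr mulrBr [i.+1%:R * (_ / _)]mulrC divfK//; ring.
rewrite (eq_bigr (fun i : 'I_B.+1 => i.+1%:R * (rpow i m - 1) - rpow i m)); last by move=> i _; exact: e.
rewrite sumrB; set S := \sum_(i < _) _; set S' := \sum_(i < _) _.
have -> : B.+1%:R ^+ 2 * (1 - rpow B m.+1) = B.+1%:R ^+ 2 * (1 - rpow B m) + B.+1%:R * rpow B m.
  have := e B; set t := B.+1%:R; set a := rpow B m; set b := rpow B m.+1 => h.
  have -> : t ^+ 2 * (1 - b) = - (t * (t * (b - 1))) by ring.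
  by rewrite h; ring.
rewrite -[_ *+ B.+1]mulr_natl; ring.
Qed.

Lemma sqlog_mono B : nondecr (sqlog B).
Proof.
move=> m; rewrite -subr_ge0 sqlog_incr; apply: sumr_ge0 => i _.
by rewrite subr_ge0 rpow_le// -ltnS.
Qed.

Lemma sqlog_0 B : sqlog B 0 = 0.
Proof.
rewrite /sqlog big1 ?add0r; last by move=> i _; rewrite /rpow expr0 subrr mulr0.
by rewrite /rpow expr0 subrr mulr0.
Qed.

Lemma sqlog_le B m : sqlog B m <= B.+1%:R ^+ 2.
Proof.
have : \sum_(i < B.+1) (i.+1%:R * (rpow i m - 1)) <= 0.
  by apply: sumr_le0 => i _; have := rpow_le1 R i m; have := ler0n R i.+1; nra.
have := rpow_ge0 R B m; have := rpow_le1 R B m; have := sqr_ge0 (B.+1%:R : R).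
rewrite /sqlog; set S := \sum_(_ < _) _; nra.
Qed.

Lemma sum_lower b m B : (0 < b)%N -> (b <= m)%N ->
  b%:R * harm R B - b%:R ^+ 2 <= \sum_(i < B) (1 - rpow i.+1 m).
Proof.
move=> b0 hb.
apply: (@le_trans _ _ (\sum_(i < B) (b%:R * i.+2%:R^-1 - b%:R ^+ 2 * (1 / (i.+1%:R * i.+2%:R))))).
  rewrite sumrB -mulr_sumr -/(harm R B) lerD2l lerN2 -mulr_sumr -[leRHS]mulr1.
  by apply: ler_wpM2l; [exact: sqr_ge0|exact: telescope_inv].
apply: ler_sum => i _; apply: le_trans (@rpow_lower R i.+1 m b hb).
have t0 := ler0n R i; have b1 : 1 <= b%:R :> R by rewrite ler1n.
rewrite -[i.+2%:R]natr1 -[i.+1%:R]natr1; set t := i%:R in t0 *; set z := b%:R in b1 *.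
have h1 : 0 < t + 1 by lra.
have h2 : 0 < t + 1 + 1 by lra.
have h3 : 0 < t + 1 + 1 + z by lra.
rewrite -subr_ge0.
have -> : z / (t + 1 + 1 + z) - (z / (t + 1 + 1) - z ^+ 2 * (1 / ((t + 1) * (t + 1 + 1)))) =
   z ^+ 2 * (1 + z) / ((t + 1) * (t + 1 + 1) * (t + 1 + 1 + z)).
  by field; rewrite !gt_eqF.
by rewrite divr_ge0 ?mulr_ge0 ?sqr_ge0//; lra.
Qed.

Lemma telescope_scaled B m : \sum_(i < B) (i.+2%:R * rpow i.+1 m - i.+1%:R * rpow i m) =
  B.+1%:R * rpow B m - rpow 0 m.
Proof.
elim: B => [|B IH]; first by rewrite big_ord0 mul1r subrr.
by rewrite big_ord_recr /= IH; ring.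
Qed.

(** On [a rpow_a] the operator acts by the shift to [a + 1] with multiplier
    [1 - (2 - delta) / (a + 1)] up to smaller terms, so after telescoping the
    drift gains [2 - delta] times the sum of [1 - rpow_a], which is about [b log B]
    on the states [m >= b]. *)
Lemma sqlog_drift B : exists N0, forall N, (N0 <= N)%N -> forall m b, (0 < b)%N -> (b <= m)%N ->
  (M <= m.+1)%N ->
  sqlog B m + ((2 - delta) * (b%:R * harm R B.+1 - b%:R ^+ 2) - (delta - 1) * harm R B.+1
     - 2 * m%:R - (4 ^+ M + 1)) <= K N.+1 (sqlog B) m.
Proof.
have /andP[d1 d2] := hd.
have e0 : 0 < (B.+1%:R ^+ 2)^-1 :> R by rewrite invr_gt0 exprn_gt0.
have [N0 hN0] := K_rpow_le hp M B e0.
exists N0 => N hN m b b0 bm hm.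
have -> : K N.+1 (sqlog B) m = \sum_(i < B.+1) (i.+1%:R * (K N.+1 (rpow i) m - 1)) +
    B.+1%:R ^+ 2 * (1 - K N.+1 (rpow B) m).
  rewrite /chain_op (negbinD hp) (negbinZ hp) (negbinB hp) (negbin_cst hp); congr (_ + _).
  rewrite (negbin_sum hp _ _ _ _ (fun (i : 'I_B.+1) d => i.+1%:R * (rpow i d - 1))).
  by apply: eq_bigr => i _; rewrite (negbinZ hp) (negbinB hp) (negbin_cst hp).
have hT := hN0 N.+1 (leqW hN) m hm.
have m1 : (0 < m)%N by exact: leq_trans bm.
have u00 : rpow 0 m = 0 by rewrite /rpow /ratio mul0r expr0n; case: m m1 {bm hm hT}.
(* The sum enters with positive coefficients, so the lower bound [K_rpow_ge] applies
   to it; the shifted terms telescope. *)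
have hS : \sum_(i < B.+1) (i.+1%:R * (rpow i m - 1)) +
   (B.+2%:R * rpow B.+1 m - \sum_(i < B.+1) ((2 - delta) * rpow i.+1 m + (delta - 1) * i.+2%:R^-1))
   <= \sum_(i < B.+1) (i.+1%:R * (K N.+1 (rpow i) m - 1)).
  have := telescope_scaled B.+1 m; rewrite u00 subr0 => <-.
  rewrite -sumrB -big_split /=; apply: ler_sum => i _.
  have h1 := K_rpow_ge hp N i hm.
  have e1 : i.+1%:R * ((i.+1%:R + delta) / i.+2%:R) = i.+2%:R - (2 - delta) - (delta - 1) * i.+2%:R^-1.
    rewrite -[i.+2%:R]natr1 -[i.+1%:R]natr1; have := ler0n R i; set t := i%:R => ht; field.
    by rewrite !gt_eqF//; lra.
  have := ler_wpM2l (ler0n R i.+1) h1.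
  rewrite mulrCA e1.
  have u1 := rpow_le1 R i.+1 m; have u0 := rpow_ge0 R i.+1 m.
  have z0 := inv_succ_gt0 R i.+1.
  have h2 : rpow i.+1 m * ((delta - 1) * i.+2%:R^-1) <= (delta - 1) * i.+2%:R^-1.
    by apply: ler_piMl => //; rewrite mulr_ge0 ?(ltW z0)//; lra.
  move: h2; move: (i.+1%:R) (i.+2%:R) (i.+2%:R^-1) => b' a z; lra.
(* The last term enters with a negative sign and needs the upper bound [K_rpow_le],
   whose error was chosen to be [1] after multiplication by [A ^ 2]. *)
set A := B.+1%:R : R in e0 hT *.
have A1 : 1 <= A by rewrite ler1n.
have A2 : B.+2%:R = A + 1 by rewrite /A natr1.
rewrite A2 in hS hT.
have uA1 := rpow_le1 R B.+1 m; have uA0 := rpow_ge0 R B.+1 m.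
have hC : 0 <= 4 ^+ M :> R by rewrite exprn_ge0.
have hsg : ratio B.+1 - ratio B = (A * (A + 1))^-1 by rewrite ratio_diff A2 div1r.
have hdiff : A ^+ 2 * (rpow B.+1 m - rpow B m) <= m%:R.
  have h := @expr_sub_le R (ratio B) (ratio B.+1) m.
  have {}h : rpow B.+1 m - rpow B m <= m%:R * (A * (A + 1))^-1.
    by rewrite -hsg; apply: h; rewrite ?ratio_ge0 ?(ltW (ratio_lt1 R _)) ?ratio_le.
  apply: le_trans (ler_wpM2l (sqr_ge0 A) h) _.
  rewrite mulrCA -[leRHS]mulr1; apply: ler_wpM2l => //.
  by rewrite ler_pdivrMr ?mulr_gt0//; nra.
have hdiff2 : A - m%:R <= A * rpow B.+1 m.
  have h := rpow_bern R B.+1 m; rewrite A2 in h.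
  have h2 : m%:R / (A + 1) * A <= m%:R.
    rewrite mulrAC ler_pdivrMr; last lra.
    by apply: ler_wpM2l => //; lra.
  have : A * (1 - m%:R / (A + 1)) <= A * rpow B.+1 m by apply: ler_wpM2l => //; lra.
  move: h2; move: (m%:R / (A + 1)) => z; lra.
have htop : A ^+ 2 * K N.+1 (rpow B) m <= A ^+ 2 * rpow B.+1 m + A * (delta - 1) + 4 ^+ M + 1.
  apply: le_trans (ler_wpM2l (sqr_ge0 A) hT) _.
  rewrite mulrDr divff; last by rewrite gt_eqF// exprn_gt0//; lra.
  rewrite lerD2r.
  have -> : A ^+ 2 * (rpow B.+1 m * ((A + delta + 4 ^+ M / A) / (A + 1))) =
    A ^+ 2 * rpow B.+1 m + rpow B.+1 m * (A ^+ 2 * (delta - 1) / (A + 1)) + rpow B.+1 m * (4 ^+ M * (A / (A + 1))).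
    by field; rewrite !gt_eqF//; lra.
  have k1 : A ^+ 2 * (delta - 1) / (A + 1) <= A * (delta - 1).
    rewrite ler_pdivrMr; last lra.
    by rewrite expr2 -!mulrA; apply: ler_wpM2l; [lra|rewrite [leRHS]mulrC mulrC -subr_ge0; nra].
  have k2 : rpow B.+1 m * (A ^+ 2 * (delta - 1) / (A + 1)) <= A ^+ 2 * (delta - 1) / (A + 1).
    apply: ler_piMl => //; rewrite divr_ge0//; last lra.
    by rewrite mulr_ge0 ?sqr_ge0//; lra.
  have k3 : rpow B.+1 m * (4 ^+ M * (A / (A + 1))) <= 4 ^+ M.
    have k4 : A / (A + 1) <= 1 by rewrite ler_pdivrMr; lra.
    have k5 : 0 <= A / (A + 1) by rewrite divr_ge0; lra.
    apply: (@le_trans _ _ (4 ^+ M * (A / (A + 1)))).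
      by apply: ler_piMl => //; rewrite mulr_ge0.
    by rewrite -[leRHS]mulr1; apply: ler_wpM2l.
  lra.
have hL := sum_lower B.+1 b0 bm.
have eS : \sum_(i < B.+1) ((2 - delta) * rpow i.+1 m + (delta - 1) * i.+2%:R^-1) =
   (2 - delta) * A - (2 - delta) * \sum_(i < B.+1) (1 - rpow i.+1 m) + (delta - 1) * harm R B.+1.
  rewrite big_split /= -!mulr_sumr sumrB sumr_const card_ord /A /harm; ring.
rewrite eS in hS.
have hL2 : (2 - delta) * (b%:R * harm R B.+1 - b%:R ^+ 2) <= (2 - delta) * \sum_(i < B.+1) (1 - rpow i.+1 m).
  by apply: ler_wpM2l => //; lra.
rewrite /sqlog -/A.
have hdd : A * (delta - 1) + (2 - delta) * A = A by ring.
move: hS hL2.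
move: (\sum_(i < B.+1) (1 - _)) (\sum_(i < B.+1) _ * (rpow _ _ - 1)) (\sum_(i < B.+1) _ * (K _ _ _ - 1)) => S1 S2 S3.
lra.
Qed.

(** The run may consist of failures only. *)
Lemma negbin_tail N b c : (b < N)%N -> (1 - p) ^+ b <= U N c 1 (fun m => (b <= m)%N%:R).
Proof.
have -> : U N c 1 (fun m => (b <= m)%N%:R) = geo p N c (fun m => (b <= m)%N%:R).
  by rewrite negbinS; apply: (geo_ext hp) => d; rewrite /= addn0.
elim: N c b => [//|N IH] c [|b] hb.
  by rewrite expr0 -[leLHS](geo_cst p N.+1 c).
rewrite exprS /= mulr0 add0r.
have h := IH c.-1 b hb; have h1p := hp1.
have hw : 1 - p <= 1 - right_bias p c.
  by rewrite lerD2l lerN2; case: c {h} => //=; case/andP: hp.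
apply: ler_pM => //; first by lra.
by rewrite exprn_ge0//; lra.
Qed.

(** Flattening [sqlog] below [b] turns the drift positive there as well: from a state
    below [b] the chain exceeds [b] with positive probability, and then gains
    [sqlog B b.+1 - sqlog B b], of order [log B]. *)
Definition sqlog_from (b B m : nat) : R := sqlog B (maxn m b).

(** Above [b] the gain is [(2 - delta) b - (delta - 1)] times the harmonic sum, so [b]
    is chosen with [delta <= (2 - delta) b]; below [b], see [sqlog_from]. *)
(** Choose [B] so that the harmonic term of [weak_drift0] exceeds [2 |kappa| + C], halve
    the test function, and truncate the loss at an [L] so large that the left-hand side
    is negative beyond it.  Such an inequality for every [kappa] says that the mean of
    the chain is infinite. *)
Lemma weak_drift0 : exists b (C : R), forall B, exists N, forall m,
  sqlog_from b B m + ((1 - p) ^+ b.+1 * harm R B.+1 - C - 2 * m%:R) <= K N (sqlog_from b B) m.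
Proof.
have /andP[d1 d2] := hd.
have [b [b0 [bM hb]]] : exists b : nat, (0 < b)%N /\ (M <= b)%N /\ delta <= (2 - delta) * b%:R.
  exists (Num.truncn (delta / (2 - delta)) + M).+1; split=> //; split; first by rewrite leqW// leq_addl.
  rewrite [leRHS]mulrC -ler_pdivrMr; last lra.
  apply: ltW; apply: lt_le_trans (truncnS_gt _) _; by rewrite ler_nat ltnS leq_addr.
exists b; pose C := (2 - delta) * b%:R ^+ 2 + (4 ^+ M + 1) + b%:R ^+ 2 + b%:R + 1; exists C => B.
have [N0 hN0] := sqlog_drift B.
exists (N0 + b.+2)%N.+1 => m.
have b1 : 1 <= b%:R :> R by rewrite ler1n.
have hC : 0 <= 4 ^+ M :> R by rewrite exprn_ge0.
have p0 : 0 <= 1 - p by have := hp1; lra.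
have pb : (1 - p) ^+ b.+1 <= 1 by rewrite exprn_ile1//; have /andP[] := hp; lra.
have pb0 : 0 <= (1 - p) ^+ b.+1 by rewrite exprn_ge0.
have H0 : 0 <= harm R B.+1 by apply: sumr_ge0 => i _; rewrite invr_ge0.
have bb : 0 <= (2 - delta) * b%:R ^+ 2 by rewrite mulr_ge0 ?sqr_ge0//; lra.
case: (leqP b m) => hm.
  have h1 := hN0 (N0 + b.+2)%N (leq_addr _ _) m b b0 hm.
  have {}h1 := h1 (leq_trans bM (leqW hm)).
  have h2 : K (N0 + b.+2)%N.+1 (sqlog B) m <= K (N0 + b.+2)%N.+1 (sqlog_from b B) m.
    by apply: (negbin_le hp) => d; apply: (nondecr_le (sqlog_mono B)); rewrite leq_maxl.
  rewrite {1}/sqlog_from (maxn_idPl hm).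
  apply: le_trans (le_trans _ h1) h2; rewrite lerD2l /C.
  have : harm R B.+1 <= ((2 - delta) * b%:R - (delta - 1)) * harm R B.+1.
    by rewrite -[leLHS]mul1r; apply: ler_wpM2r => //; lra.
  have : (1 - p) ^+ b.+1 * harm R B.+1 <= harm R B.+1 by apply: ler_piMl.
  have := sqr_ge0 (b%:R : R).
  lra.
have eb : maxn m b = b by apply/maxn_idPr; exact: ltnW.
rewrite {1}/sqlog_from eb.
pose g := sqlog B b.+1 - sqlog B b.
have hg : harm R B.+1 - b%:R ^+ 2 - b%:R <= g.
  rewrite /g sqlog_incr sumrB sumr_const card_ord.
  have h1 := sum_lower B.+1 b0 (leqnn b).
  have h2 : \sum_(i < B.+1) rpow i b <= \sum_(i < B.+1) rpow i.+1 b.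
    by apply: ler_sum => i _; exact: rpow_le.
  have h3 : B.+1%:R - b%:R <= rpow B b *+ B.+1.
    rewrite -[rpow B b *+ _]mulr_natl.
    have := ler_wpM2l (ler0n R B.+1) (rpow_bern R B b).
    by rewrite mulrBr mulr1 mulrCA divff ?pnatr_eq0// mulr1.
  rewrite sumrB sumr_const card_ord in h1.
  have h4 : harm R B.+1 <= b%:R * harm R B.+1 by apply: ler_peMl.
  rewrite -[1 *+ B.+1]/(B.+1%:R) in h1; lra.
have g0 : 0 <= g by rewrite subr_ge0; exact: sqlog_mono.
have h1 : sqlog B b + g * K (N0 + b.+2)%N.+1 (fun m => (b.+1 <= m)%N%:R) m <= K (N0 + b.+2)%N.+1 (sqlog_from b B) m.
  rewrite /chain_op -(negbinZ hp) -{1}(negbin_cst hp (N0 + b.+2)%N.+1 M m.+1 (sqlog B b)) -(negbinD hp).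
  apply: (negbin_le hp) => d; rewrite /sqlog_from; case: (leqP b.+1 d) => hd'.
    by rewrite mulr1 /g addrC subrK; apply: (nondecr_le (sqlog_mono B)); rewrite leq_max hd'.
  by rewrite mulr0 addr0; apply: (nondecr_le (sqlog_mono B)); rewrite leq_maxr.
apply: le_trans h1; rewrite lerD2l.
have h2 : (1 - p) ^+ b.+1 <= K (N0 + b.+2)%N.+1 (fun m => (b.+1 <= m)%N%:R) m.
  apply: le_trans (negbin_tail M (_ : (b.+1 < (N0 + b.+2).+1)%N)) _; first by rewrite ltnS (leq_trans (leqnSn _) (leq_addl _ _)).
  have mt : nondecr (fun m => (b.+1 <= m)%N%:R : R).
    by move=> d; rewrite ler_nat; case: (leqP b.+1 d) => // h; rewrite (leqW h).
  exact: (nondecr_le (nondecr_chain hp M (N0 + b.+2).+1 mt) (leq0n m)).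
have h3 : g * (1 - p) ^+ b.+1 <= g * K (N0 + b.+2)%N.+1 (fun m => (b.+1 <= m)%N%:R) m.
  exact: ler_wpM2l.
apply: le_trans h3.
have : (1 - p) ^+ b.+1 * (harm R B.+1 - b%:R ^+ 2 - b%:R) <= (1 - p) ^+ b.+1 * g by apply: ler_wpM2l.
have : (1 - p) ^+ b.+1 * (b%:R ^+ 2 + b%:R) <= b%:R ^+ 2 + b%:R.
  by apply: ler_piMl => //; have := sqr_ge0 (b%:R : R); lra.
have := ler0n R m; rewrite /C; lra.
Qed.

Lemma weak_drift (kappa : R) : exists N (h : nat -> R) (H : R) (L : nat),
  (forall m, 0 <= h m <= H) /\
  (forall m, h m + (kappa - (minn m L)%:R) <= K N h m).
Proof.
have [b [C hC]] := weak_drift0.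
have p0 : 0 < (1 - p) ^+ b.+1 by rewrite exprn_gt0// subr_gt0 hp1.
have [B hB'] := harm_dvg hp ((2 * `|kappa| + C) / (1 - p) ^+ b.+1).
have hBB : (2 * `|kappa| + C) <= (1 - p) ^+ b.+1 * harm R B.+1.
  rewrite [leRHS]mulrC -ler_pdivrMr//; apply: le_trans hB' _; exact: harm_mono.
have [N hN] := hC B.
have t0 m : 0 <= sqlog_from b B m.
  by rewrite -(sqlog_0 B); apply: (nondecr_le (sqlog_mono B)).
pose H := B.+1%:R ^+ 2 / 2 : R.
have [L hL] : exists L : nat, `|kappa| + H < L%:R by exists (Num.truncn (`|kappa| + H)).+1; exact: truncnS_gt.
exists N, (fun m => 1 / 2 * sqlog_from b B m), H, L.
have bnd m : 0 <= 1 / 2 * sqlog_from b B m <= H.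
  by have := t0 m; have := sqlog_le B (maxn m b); rewrite -/(sqlog_from b B m) /H; lra.
split=> // m.
have hk := ler_norm kappa.
case: (leqP m L) => hm.
  by rewrite /chain_op (negbinZ hp) -/(chain_op p M N (sqlog_from b B) m); have := hN m; lra.
have : 0 <= K N (fun m => 1 / 2 * sqlog_from b B m) m.
  rewrite -[leLHS](negbin_cst hp N M m.+1); apply: (negbin_le hp) => d; by have /andP[] := bnd d.
have /andP[] := bnd m; move: hL hk; lra.
Qed.

End Weak.

(** * Finite-horizon expectations of the walk stopped at a level *)

(** The information that matters for the future and for [T_n]: the position, the
    cookies left, and the number of left jumps made so far from each site. *)
Record walk_state := WalkState { pos : int; cookies : int -> nat; lefts : int -> nat }.

Definition jump (s : walk_state) (y : int) : walk_state :=
  WalkState y (fun z => if z == pos s then (cookies s z).-1 else cookies s z)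
           (fun z => if (z == pos s) && (y == pos s - 1) then (lefts s z).+1 else lefts s z).

Definition start_state (M : nat) : walk_state := WalkState 0 (fun=> M) (fun=> 0%N).

(** The expectation of [F] at the state of the walk after [r] steps, the walk being
    stopped when it reaches [n]. *)
Fixpoint walkE (R : realFieldType) (p : R) (n : int) (r : nat) (s : walk_state) (F : walk_state -> R) : R :=
  if r is r'.+1 then
    if pos s == n then F s else
    right_bias p (cookies s (pos s)) * walkE p n r' (jump s (pos s + 1)) F +
    (1 - right_bias p (cookies s (pos s))) * walkE p n r' (jump s (pos s - 1)) F
  else F s.

(** The expectation of the product of [phi j] at the final number of left jumps from
    [j], over [j < k], given the present state and given that [d] left jumps are still to
    be made from [k].  Site [k.-1] must then be left to the right [d] more times, and
    once more if the walk is at [k.-1] or to its left. *)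
Fixpoint site_value (R : realFieldType) (p : R) (N : nat) (phi : nat -> nat -> R) (s : walk_state) (k d : nat) : R :=
  if k is k'.+1 then
    negbin p N (cookies s k'%:Z) (d + (pos s <= k'%:Z)%R)
      (fun d' => phi k' (lefts s k'%:Z + d')%N * site_value p N phi s k' d')
  else 1.

Section Walk.
Variables (R : realFieldType) (p : R).
Hypothesis hp : 1 / 2 <= p <= 1.
Implicit Types (N n r k d : nat) (s : walk_state) (F G : walk_state -> R) (x : int).
Local Notation U := (negbin p).
Local Notation site_value := (site_value p).

(** The two uses of the walk call for nondecreasing factors (moments) and for
    nonincreasing ones (exponential tails); [b] tells them apart. *)
Definition monotone_dir (b : bool) (f : nat -> R) : Prop :=
  if b then nondecr f else forall d : nat, f d.+1 <= f d.
(** For nondecreasing factors the cap has to drop by one at each step of the walk, see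
    [negbin_step_mono]; for nonincreasing ones it may stay the same. *)
Definition cap_step (b : bool) N N' : Prop := N = (if b then N'.+1 else N') /\ (0 < N)%N.

Lemma negbin_step_dir b N N' c j f : monotone_dir b f -> cap_step b N N' ->
  right_bias p c * U N' c.-1 j f + (1 - right_bias p c) * U N' c.-1 j.+1 (fun d => f d.+1) <= U N c j.+1 f.
Proof.
case: b => /= mf [-> h]; first exact: negbin_step_mono.
by case: N' h => // N' _; exact: negbin_step_anti.
Qed.

Lemma negbin_cap_dir b N N' c j f : monotone_dir b f -> cap_step b N N' -> U N' c j f <= U N c j f.
Proof. by case: b => /= mf [-> h] //; exact: negbin_mono. Qed.

Lemma monotone_dir_negbin b N c j f : monotone_dir b f -> monotone_dir b (fun d => U N c (d + j) f).
Proof.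
case: b => mf d; rewrite -[(d.+1 + j)%N]/((d + j).+1); first exact: negbin_s_mono.
have /(negbin_s_mono hp N c (d + j)) : nondecr (fun d => - f d) by move=> e; rewrite lerN2.
by rewrite !(negbinN hp) lerN2.
Qed.

Lemma monotone_dir_mul b f g : (forall d, 0 <= f d) -> (forall d, 0 <= g d) ->
  monotone_dir b f -> monotone_dir b g -> monotone_dir b (fun d => f d * g d).
Proof. by case: b => /= f0 g0 mf mg d; apply: ler_pM. Qed.

Lemma monotone_dir_shift b f l : monotone_dir b f -> monotone_dir b (fun d => f (l + d)%N).
Proof. by case: b => /= mf d; rewrite addnS. Qed.

Section Val.
Variables (b : bool) (phi : nat -> nat -> R).
Hypothesis phi0 : forall k d, 0 <= phi k d.
Hypothesis phim : forall k, monotone_dir b (phi k).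

Lemma site_value_ge0 N s k d : 0 <= site_value N phi s k d.
Proof.
elim: k d => [|k IH] d //=; rewrite -(negbin_cst hp N (cookies s k%:Z) (d + (pos s <= k%:Z)%R) 0).
by apply: (negbin_le hp) => e; rewrite mulr_ge0.
Qed.

Lemma site_value_monotone N s k : monotone_dir b (site_value N phi s k).
Proof.
elim: k => [|k IH] /=; first by case: (b) => d.
apply: monotone_dir_negbin; apply: monotone_dir_mul => //; first by move=> d; exact: site_value_ge0.
exact: monotone_dir_shift.
Qed.

(** A step of the walk from [x] only changes the state at [x]: it completes one
    of the successes required there, or it is a failure and creates one more success to be
    made at [x - 1].  Sites below [x] see this as an initial condition, the site [x]
    as the first trial of its experiment, and the sites above average over both. *)
Lemma site_value_step N N' s k : cap_step b N N' ->
  ((k%:Z <= pos s)%R ->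
    (forall d, site_value N' phi (jump s (pos s + 1)) k d <= site_value N phi s k d) /\
    (forall d, site_value N' phi (jump s (pos s - 1)) k d <= site_value N phi s k (d + (k%:Z == pos s)))) /\
  ((pos s < k%:Z)%R -> forall d,
    right_bias p (cookies s (pos s)) * site_value N' phi (jump s (pos s + 1)) k d +
    (1 - right_bias p (cookies s (pos s))) * site_value N' phi (jump s (pos s - 1)) k d <= site_value N phi s k d).
Proof.
move=> hN; elim: k => [|k [IH1 IH2]].
  split=> [_|_ d] /=; last by lra.
  by split=> d.
have fm : monotone_dir b (fun d' => phi k (lefts s k%:Z + d')%N * site_value N phi s k d').
  apply: monotone_dir_mul => //; [by move=> d; exact: site_value_ge0|exact: monotone_dir_shift|exact: site_value_monotone].
split=> hk.
  have hkx : (k%:Z < pos s)%R by lia.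
  have [h1 h2] := IH1 (ltW hkx).
  have e0 : (k%:Z == pos s) = false by lia.
  split=> d /=; rewrite e0 /=.
    have -> : (pos s + 1 <= k%:Z)%R = false by lia.
    have -> : (pos s <= k%:Z)%R = false by lia.
    apply: le_trans (negbin_cap_dir _ _ fm hN); apply: (negbin_le hp) => e.
    by apply: ler_wpM2l.
  have -> : (pos s <= k%:Z)%R = false by lia.
  have -> : (pos s - 1 <= k%:Z)%R = (k.+1%:Z == pos s) by lia.
  rewrite addn0; apply: le_trans (negbin_cap_dir _ _ fm hN); apply: (negbin_le hp) => e.
  apply: ler_wpM2l => //; have := h2 e; by rewrite e0 addn0.
have w0 : 0 <= right_bias p (cookies s (pos s)) by have := right_bias_ge hp (cookies s (pos s)); lra.
have w1 : 0 <= 1 - right_bias p (cookies s (pos s)) by have := right_bias_le hp (cookies s (pos s)); lra.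
move=> d; case: (eqVneq k%:Z (pos s)) => hkx.
  have [h1 h2] := IH1 (eq_ind _ (fun z => (k%:Z <= z)%R) (lexx _) _ hkx).
  rewrite /= hkx eqxx /= eqxx /=.
  have -> : (pos s + 1 <= pos s)%R = false by lia.
  have -> : (pos s - 1 <= pos s)%R by lia.
  have -> : (pos s + 1 == pos s - 1) = false by lia.
  rewrite lexx /= addn0 addn1; rewrite hkx in fm.
  apply: le_trans (negbin_step_dir _ _ fm hN); apply: lerD; apply: ler_wpM2l => //.
    by apply: (negbin_le hp) => e; apply: ler_wpM2l.
  apply: (negbin_le hp) => e; rewrite addSn addnS; apply: ler_wpM2l => //.
  by have := h2 e; rewrite hkx eqxx addn1.
have hlt : (pos s < k%:Z)%R by lia.
rewrite /=; have -> : (k%:Z == pos s) = false by lia.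
have -> : (pos s + 1 <= k%:Z)%R by lia.
have -> : (pos s - 1 <= k%:Z)%R by lia.
have -> : (pos s <= k%:Z)%R by lia.
rewrite /= -(negbin_lin hp).
have h3 := IH2 hlt.
apply: (@le_trans _ _ (U N' (cookies s k%:Z) (d + 1) (fun d' => phi k (lefts s k%:Z + d')%N * site_value N phi s k d'))).
  apply: (negbin_le hp) => e.
  by have := ler_wpM2l (phi0 k (lefts s k%:Z + e)) (h3 e); lra.
exact: (negbin_cap_dir _ _ fm hN).
Qed.

Lemma site_value_done N s k : (k%:Z <= pos s)%R -> site_value N phi s k 0 = \prod_(j < k) phi j (lefts s j%:Z).
Proof.
elim: k => [|k IH] hk; first by rewrite big_ord0.
rewrite big_ord_recr -IH; last by lia.
rewrite /=; have -> : (pos s <= k%:Z)%R = false by lia.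
by rewrite /= addn0 mulrC.
Qed.

(** By [site_value_step] the value is superharmonic, and at the time when [n] is
    reached it equals the product. *)
Lemma walkE_prod n r N s : (pos s <= n%:Z)%R -> (if b then (r <= N)%N else (0 < N)%N) ->
  walkE p n r s (fun s => (pos s == n%:Z)%:R * \prod_(k < n) phi k (lefts s k%:Z)) <= site_value N phi s n 0.
Proof.
elim: r N s => [|r IH] N s hs hN.
  rewrite /=; case: eqP => [e|_]; first by rewrite mul1r site_value_done ?e.
  by rewrite mul0r site_value_ge0.
rewrite /=; case: eqP => [e|ne]; first by rewrite mul1r site_value_done ?e.
have hlt : (pos s < n%:Z)%R by lia.
pose N' := if b then N.-1 else N.
have hc : cap_step b N N'.
  rewrite /cap_step /N'; case: (b) hN => hN; split=> //; lia.
have hN' : if b then (r <= N')%N else (0 < N')%N.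
  by rewrite /N'; case: (b) hN => hN //; lia.
have w0 : 0 <= right_bias p (cookies s (pos s)) by have := right_bias_ge hp (cookies s (pos s)); lra.
have w1 : 0 <= 1 - right_bias p (cookies s (pos s)) by have := right_bias_le hp (cookies s (pos s)); lra.
apply: le_trans ((site_value_step s n hc).2 hlt 0%N).
apply: lerD; apply: ler_wpM2l => //; apply: IH => //=; lia.
Qed.

End Val.

Lemma walkE_le n r s F G : (forall s, F s <= G s) -> walkE p n r s F <= walkE p n r s G.
Proof.
move=> FG; elim: r s => [|r IH] s //=; case: ifP => // _.
have w0 : 0 <= right_bias p (cookies s (pos s)) by have := right_bias_ge hp (cookies s (pos s)); lra.
have w1 : 0 <= 1 - right_bias p (cookies s (pos s)) by have := right_bias_le hp (cookies s (pos s)); lra.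
by apply: lerD; apply: ler_wpM2l.
Qed.

Lemma walkE_lin n r s a c F G : walkE p n r s (fun s => a * F s + c * G s) =
  a * walkE p n r s F + c * walkE p n r s G.
Proof. by elim: r s => [|r IH] s //=; case: ifP => // _; rewrite !IH; ring. Qed.

Lemma walkE_cst n r s (a : R) : walkE p n r s (fun=> a) = a.
Proof. by elim: r s => [|r IH] s //=; case: ifP => // _; rewrite !IH; ring. Qed.

Lemma walkE_sum n r s m (F : 'I_m -> walk_state -> R) :
  walkE p n r s (fun s => \sum_(i < m) F i s) = \sum_(i < m) walkE p n r s (F i).
Proof.
elim: r s => [|r IH] s //=; case: ifP => // _.
by rewrite !IH !mulr_sumr -big_split.
Qed.

Lemma site_value_start (M N : nat) phi k d :
  site_value N phi (start_state M) k.+1 d = chain_op p M N (fun d' => phi k d' * site_value N phi (start_state M) k d') d.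
Proof. by rewrite /= /chain_op addn1. Qed.

(** With all factors equal to [1] except at [i], the value at the start is the
    chain operator iterated from [n] down to [i]. *)
Lemma walkE_site (M n r i : nat) (f : nat -> R) : (i < n)%N -> (forall d, 0 <= f d) -> nondecr f ->
  walkE p n r (start_state M) (fun s => (pos s == n%:Z)%:R * f (lefts s i%:Z)) <= iter (n - i) (chain_op p M r) f 0%N.
Proof.
move=> hi f0 mf.
pose phi k := if k == i then f else fun=> 1.
have -> : walkE p n r (start_state M) (fun s => (pos s == n%:Z)%:R * f (lefts s i%:Z)) =
   walkE p n r (start_state M) (fun s => (pos s == n%:Z)%:R * \prod_(k < n) phi k (lefts s k%:Z)).
  have e s : \prod_(k < n) phi k (lefts s k%:Z) = f (lefts s i%:Z).
    rewrite (bigD1 (Ordinal hi)) //= big1 ?mulr1; first by rewrite /phi eqxx.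
    by move=> k hk; rewrite /phi -[_ == i]/(k == Ordinal hi) (negbTE hk).
  by apply/le_anti/andP; split; apply: walkE_le => s; rewrite e.
have h := @walkE_prod true phi _ _ n r r (start_state M) isT (leqnn r).
apply: le_trans (h _ _) _.
- by move=> k d; rewrite /phi; case: eqP.
- by move=> k; rewrite /phi; case: eqP => // _ d.
have h1 k : (k <= i)%N -> forall d, site_value r phi (start_state M) k d = 1.
  elim: k => [//|k IH] hk d; rewrite site_value_start -[RHS](negbin_cst hp r M d.+1); apply: (negbin_ext hp) => e.
  rewrite IH ?(ltnW hk)// /phi; case: eqP => [ek|_]; last by rewrite mulr1.
  by rewrite ek ltnn in hk.
have h2 k d : site_value r phi (start_state M) (k + i.+1) d = iter k.+1 (chain_op p M r) f d.
  elim: k d => [|k IH] d.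
    rewrite add0n site_value_start /=; apply: (negbin_ext hp) => e; rewrite h1// mulr1 /phi eqxx//.
  rewrite addSn site_value_start [iter k.+2 _ _]iterS; apply: (negbin_ext hp) => e; rewrite IH /phi.
  by case: eqP => [ek|_]; [lia|rewrite mul1r].
have -> : n = ((n - i.+1) + i.+1)%N by rewrite subnK.
by rewrite h2; have -> : (n - i.+1 + i.+1 - i = (n - i.+1).+1)%N by lia.
Qed.

(** Let [y] be the distance to the target.  For the fair walk [y / A] is harmonic
    and controls the exit at distance [A]; [(y (2A - y) + t) / r] is harmonic in space-time
    and controls the event that [r] steps do not suffice.  Both increase with [y] on
    [0, A], so a drift to the right decreases them. *)
Definition hit_potential (A r t : nat) (y : int) : R :=
  y%:~R / A%:R + (y%:~R * (2 * A%:R - y%:~R) + t%:R) / r%:R.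

Definition hit_bound (n : nat) (A r t : nat) (s : walk_state) : R :=
  let y := n%:Z - pos s in
  if y == 0 then 0 else
  if (A%:Z <= y)%R then 1 else Num.min 1 (hit_potential A r t y).

(** [hit_bound] is superharmonic for the stopped walk.  The minimum with [1] handles
    distances above [A], where nothing is claimed. *)
Lemma walkE_hit n A r : (0 < A)%N -> (0 < r)%N -> forall t u s, (t + u = r)%N -> (pos s <= n%:Z)%R ->
  walkE p n u s (fun s => (pos s != n%:Z)%:R) <= hit_bound n A r t s.
Proof.
move=> A0 r0 t u; elim: u t => [|u IH] t s htu hs.
  rewrite addn0 in htu; rewrite /= /hit_bound htu; set y := n%:Z - pos s.
  have -> : (pos s == n%:Z) = (y == 0) by rewrite subr_eq0 eq_sym.
  case: eqP => //= ny; case: ifP => // hA.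
  rewrite le_min lexx /= /hit_potential mulrDl divff ?pnatr_eq0 -?lt0n//.
  have y1 : 0 <= y%:~R :> R by rewrite ler0z; lia.
  have y2 : y%:~R <= A%:R :> R by rewrite -[A%:R]/(A%:Z%:~R) ler_int; lia.
  have : 0 <= y%:~R / A%:R :> R by rewrite divr_ge0.
  have : 0 <= (y%:~R * (2 * A%:R - y%:~R)) / r%:R :> R.
    by rewrite divr_ge0// mulr_ge0//; lra.
  lra.
rewrite /= [leRHS]/hit_bound; set y := n%:Z - pos s.
have -> : (pos s == n%:Z) = (y == 0) by rewrite subr_eq0 eq_sym.
set w := right_bias p _.
have w2 : 1 / 2 <= w by exact: right_bias_ge.
have w1 : w <= 1 by exact: right_bias_le.
case: eqP => [y0 //|ny].
have hy : (0 < y)%R by lia.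
have hR := IH t.+1 (jump s (pos s + 1)); have hL := IH t.+1 (jump s (pos s - 1)).
rewrite addSnnS htu /= in hR hL; have {}hR := hR erefl ltac:(clear -hy; lia); have {}hL := hL erefl ltac:(clear -hy; lia).
have g1 s' : hit_bound n A r t.+1 s' <= 1.
  by rewrite /hit_bound; case: ifP => // _; case: ifP => // _; rewrite ge_min lexx.
set a := walkE _ _ _ _ _ in hR *; set c := walkE _ _ _ _ _ in hL *.
have a1 : a <= 1 by exact: le_trans hR (g1 _).
have c1 : c <= 1 by exact: le_trans hL (g1 _).
have le1 : w * a + (1 - w) * c <= 1 by nra.
case: ifP => // hA.
rewrite le_min le1 /=.
have r1 : 0 < r%:R :> R by rewrite ltr0n.
have A1 : 0 < A%:R :> R by rewrite ltr0n.
(* At distances [0] and [A] the potential is at least [0] and [1] respectively, so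
   it dominates [hit_bound] there as well. *)
have th z (z0 : (0 <= z)%R) (zA : (z <= A%:Z)%R) s' : n%:Z - pos s' = z -> hit_bound n A r t.+1 s' <= hit_potential A r t.+1 z.
  move=> e; rewrite /hit_bound e.
  have z0' : 0 <= z%:~R :> R by rewrite ler0z.
  have zA' : z%:~R <= A%:R :> R by rewrite -[A%:R]/(A%:Z%:~R) ler_int.
  have h2 : 0 <= (z%:~R * (2 * A%:R - z%:~R) + t.+1%:R) / r%:R :> R.
    by rewrite divr_ge0// addr_ge0// mulr_ge0//; lra.
  case: ifP => [_|nz].
    by rewrite /hit_potential addr_ge0// divr_ge0.
  case: ifP => [Az|_]; last by rewrite ge_min lexx orbT.
  have -> : z = A%:Z by apply/le_anti; rewrite zA Az.
  rewrite /hit_potential -[_%:~R]/(A%:R : R) divff ?gt_eqF// lerDl.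
  rewrite divr_ge0// addr_ge0// mulr_ge0//; lra.
have yb1 : (0 <= y - 1)%R by clear -hy; lia.
have yb2 : (0 <= y + 1)%R by clear -hy; lia.
have yA1 : (y - 1 <= A%:Z)%R by clear -hA; lia.
have yA2 : (y + 1 <= A%:Z)%R by clear -hA; lia.
have tR : a <= hit_potential A r t.+1 (y - 1).
  by apply: le_trans hR (th _ yb1 yA1 _ _); rewrite /= /y opprD addrA.
have tL : c <= hit_potential A r t.+1 (y + 1).
  by apply: le_trans hL (th _ yb2 yA2 _ _); rewrite /= /y opprB addrA addrAC.
have e1 : hit_potential A r t.+1 (y - 1) = hit_potential A r t y - (1 / A%:R + (2 * A%:R - 2 * y%:~R) / r%:R).
  rewrite /hit_potential intrB -natr1 -[1%:~R]/(1 : R); field; rewrite !gt_eqF//.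
have e2 : hit_potential A r t.+1 (y + 1) = hit_potential A r t y + (1 / A%:R + (2 * A%:R - 2 * y%:~R) / r%:R).
  rewrite /hit_potential intrD -natr1 -[1%:~R]/(1 : R); field; rewrite !gt_eqF//.
rewrite e1 in tR; rewrite e2 in tL.
have y2 : y%:~R <= A%:R :> R by rewrite -[A%:R]/(A%:Z%:~R) ler_int; clear -hA; lia.
have : 0 <= 1 / A%:R + (2 * A%:R - 2 * y%:~R) / r%:R :> R.
  by rewrite addr_ge0 ?divr_ge0//; lra.
move: (1 / _ + _) tR tL => z tR tL z0.
have := ler_wpM2l (ltac:(lra) : 0 <= w) tR.
have := ler_wpM2l (ltac:(lra) : 0 <= 1 - w) tL.
nra.
Qed.

End Walk.

(** * Lower deviations of the number of left jumps *)

Definition total_lefts (n : nat) (s : walk_state) : nat := (\sum_(k < n) lefts s k%:Z)%N.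

Section Lower.
Variables (R : realType) (p : R).
Hypothesis hp : 1 / 2 <= p <= 1.
Variable M : nat.
Local Notation K := (chain_op p M).

Lemma exp_prod (lam : R) n s :
  \prod_(k < n) expR (- lam * (lefts s k%:Z)%:R) = expR (- lam * (total_lefts n s)%:R).
Proof.
rewrite /total_lefts; elim: n => [|n IH]; first by rewrite !big_ord0 mulr0 expR0.
by rewrite !big_ord_recr /= IH -expRD natrD mulrDr.
Qed.

Section Drift.
Variables (N : nat) (h : nat -> R) (H kappa eta : R) (L : nat).
Hypothesis N0 : (0 < N)%N.
Hypothesis hH : forall m, 0 <= h m <= H.
Hypothesis hdrift : forall m, h m + (kappa - (minn m L)%:R) <= K N h m.
Hypothesis eta0 : 0 < eta <= kappa.
Variable lam : R.
Hypothesis lam0 : 0 < lam.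
Hypothesis lamH : lam * H <= 1 / 2.
Hypothesis lamHL : lam * H * L%:R <= eta / 2.

Definition decay : R := kappa - eta / 2.
Definition damped (m : nat) : R := 1 - lam * h m.
Definition tilted (m : nat) : R := damped m * expR (lam * (minn m L)%:R).

Lemma damped_bounds m : 1 / 2 <= damped m <= 1.
Proof.
have /andP[h1 h2] := hH m; have l0 := lam0; rewrite /damped.
have : lam * h m <= lam * H by apply: ler_wpM2l => //; exact: ltW.
have : 0 <= lam * h m by rewrite mulr_ge0// ltW.
by have := lamH; lra.
Qed.

(** Exponentiation of the drift inequality: [lam] is small enough for the second
    order terms to cost at most [eta / 2]. *)
Lemma K_damped m : K N damped m <= expR (- lam * decay) * tilted m.
Proof.
have -> : K N damped m = 1 - lam * K N h m.
  by rewrite /chain_op /damped (negbinB hp) (negbin_cst hp) (negbinZ hp).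
have /andP[u1 u2] := damped_bounds m; have /andP[h1 h2] := hH m.
have l0 := lam0; have /andP[e1 e2] := eta0; have lHL := lamHL.
set f := (minn m L)%:R : R.
have fL : f <= L%:R by rewrite ler_nat geq_minr.
have f0 : 0 <= f by [].
rewrite /tilted mulrCA -expRD -/f.
apply: (@le_trans _ _ (damped m * (1 + lam * (f - decay)))); last first.
  apply: ler_wpM2l; first lra.
  have -> : - lam * decay + lam * f = lam * (f - decay) by ring.
  exact: expR_ge1Dx.
have hd := ler_wpM2l (ltW l0) (hdrift m); rewrite -/f in hd.
have key : f - kappa <= damped m * (f - decay).
  case: (lerP decay f) => hf; last first.
    have : (1 - damped m) * (f - decay) <= 0 by apply: mulr_ge0_le0; lra.
    by rewrite /decay; lra.
  have : (1 - damped m) * (f - decay) <= eta / 2.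
    have k0 : 0 <= decay by rewrite /decay; lra.
    apply: le_trans lHL; apply: ler_pM; rewrite ?subr_ge0//; last lra.
    rewrite /damped opprB addrC subrK; apply: ler_wpM2l => //; exact: ltW.
  by rewrite /decay; lra.
have := ler_wpM2l (ltW l0) key; rewrite /damped in u1 u2 *; lra.
Qed.

Lemma tilted_ge m : 1 / 2 <= tilted m.
Proof.
have /andP[u1 u2] := damped_bounds m.
have e1 : 1 <= expR (lam * (minn m L)%:R).
  by rewrite -[leLHS]expR0 ler_expR mulr_ge0 //; exact: ltW lam0.
apply: (le_trans u1); rewrite /tilted; apply: ler_peMr => //; lra.
Qed.

(** Each site contributes one factor [exp (- lam * decay)], by [K_damped]. *)
Lemma site_value_exp k d : site_value p N (fun _ d => expR (- lam * d%:R)) (start_state M) k d <=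
  2 * expR (- lam * decay) ^+ k * tilted d.
Proof.
elim: k d => [|k IH] d; first by have := tilted_ge d; rewrite expr0 mulr1 /=; lra.
rewrite site_value_start.
apply: (@le_trans _ _ (K N (fun d => 2 * expR (- lam * decay) ^+ k * damped d) d)).
  apply: (negbin_le hp) => e.
  have h1 := ler_wpM2l (expR_ge0 (- lam * e%:R)) (IH e).
  apply: (le_trans h1); rewrite mulrCA; apply: ler_wpM2l.
    by rewrite mulr_ge0 ?exprn_ge0 ?expR_ge0.
  rewrite /tilted mulrCA -expRD; have /andP[u1 u2] := damped_bounds e.
  apply: ler_piMr; first lra.
  rewrite -[leRHS]expR0 ler_expR mulNr -mulrN -mulrDr addrC pmulr_rle0; last exact: lam0.
  by rewrite subr_le0 ler_nat geq_minl.
rewrite /chain_op (negbinZ hp) -/(chain_op p M N damped d) exprSr -!mulrA; apply: ler_wpM2l => //.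
by apply: ler_wpM2l; [rewrite exprn_ge0 ?expR_ge0|exact: K_damped].
Qed.

(** An exponential Markov inequality.  As [u = 1 - lam h] satisfies
    [K u <= exp (- lam (kappa - eta / 2) + lam min(m, L)) u], weighting each left jump by
    [exp (- lam)] multiplies [u] by at most [exp (- lam (kappa - eta / 2))] per site. *)
Lemma lower_tail (n r : nat) :
  walkE p n r (start_state M) (fun s => ((pos s == n%:Z) && ((total_lefts n s)%:R <= (kappa - eta) * n%:R))%:R)
  <= 2 * expR (- (lam * eta / 2 * n%:R)).
Proof.
pose phi := fun (_ d : nat) => expR (- lam * d%:R).
pose C := expR (lam * ((kappa - eta) * n%:R)).
apply: (@le_trans _ _ (walkE p n r (start_state M)
   (fun s => C * ((pos s == n%:Z)%:R * \prod_(k < n) phi k (lefts s k%:Z)) + 0 * 1))).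
  apply: (walkE_le hp) => s; rewrite mul0r addr0; case: eqP => _ /=; last by rewrite mul0r mulr0.
  rewrite mul1r exp_prod /C -expRD; case: (lerP (total_lefts n s)%:R ((kappa - eta) * n%:R)) => hS; last exact: expR_ge0.
  rewrite -[leLHS]expR0 ler_expR mulNr -mulrBr mulr_ge0 ?(ltW lam0)// subr_ge0//.
rewrite walkE_lin mul0r addr0.
have h1 := @walkE_prod R p hp false phi _ _ n r N (start_state M).
have {}h1 : walkE p n r (start_state M) (fun s => (pos s == n%:Z)%:R * \prod_(k < n) phi k (lefts s k%:Z))
    <= site_value p N phi (start_state M) n 0.
  apply: h1 => //; first by move=> k d; exact: expR_ge0.
  move=> k d; rewrite /phi ler_expR !mulNr lerN2; apply: ler_wpM2l; first exact: ltW lam0.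
  by rewrite ler_nat.
have h2 := ler_wpM2l (expR_ge0 (lam * ((kappa - eta) * n%:R))) (le_trans h1 (site_value_exp n 0)).
apply: (le_trans h2); rewrite /tilted min0n mulr0 expR0 mulr1.
have /andP[u1 u2] := damped_bounds 0.
rewrite -expRM_natr.
apply: (@le_trans _ _ (2 * (C * expR (- lam * decay * n%:R)))).
  rewrite -/C; have E0 : 0 <= C * expR (- lam * decay * n%:R) by rewrite mulr_ge0 ?expR_ge0.
  have := ler_wpM2l E0 u2; lra.
apply: ler_wpM2l => //; rewrite /C -expRD ler_expR /decay.
by rewrite le_eqVlt; apply/orP; left; apply/eqP; lra.
Qed.

End Drift.
End Lower.

(** * Events of the random walk that depend on finitely many steps *)

Local Open Scope classical_set_scope.

(** The state after [t] steps of the path [x], frozen at the first visit of [n]. *)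
Fixpoint state_at (M : nat) (n : int) (x : nat -> int) (t : nat) : walk_state :=
  if t is t'.+1 then
    let s := state_at M n x t' in if pos s == n then s else jump s (x t'.+1)
  else WalkState (x 0%N) (fun=> M) (fun=> 0%N).

Lemma state_at_local M n x y t : (forall k, (k <= t)%N -> x k = y k) -> state_at M n x t = state_at M n y t.
Proof.
elim: t => [|t IH] h /=; first by rewrite h.
rewrite IH => [|k hk]; last by apply: h; exact: leqW.
by rewrite (h t.+1).
Qed.

Lemma state_at_stopped M n x t r : pos (state_at M n x t) = n -> state_at M n x (t + r) = state_at M n x t.
Proof.
by move=> h; elim: r => [|r IH]; rewrite ?addn0 // addnS /= IH h eqxx.
Qed.

Lemma state_at_pos M n x t : pos (state_at M n x t) != n -> pos (state_at M n x t) = x t.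
Proof.
case: t => [//|t] /=; case: ifP => [/eqP ->|_]; first by rewrite eqxx.
by [].
Qed.

(** Before [n] is reached, the shifted environment is recovered from the number of
    cookies left. *)
Lemma state_at_env (R : realType) (p : R) M n x t : pos (state_at M n x t) != n ->
  forall z i, (0 < i)%N -> env_at (cookie_env M p) x t z i =
    if (i <= cookies (state_at M n x t) z)%N then p else 1 / 2.
Proof.
elim: t => [|t IH] //=; case: ifP => [/eqP ->|hn _ z i hi]; first by rewrite eqxx.
have hn' : pos (state_at M n x t) != n by rewrite hn.
rewrite /theta /= (state_at_pos hn'); case: ifP => hz; rewrite IH//.
have -> // : (i.+1 <= cookies (state_at M n x t) z)%N = (i <= (cookies (state_at M n x t) z).-1)%N.
by case: (cookies (state_at M n x t) z) => //=; case: i hi.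
Qed.

Lemma state_at_env1 (R : realType) (p : R) M n x t : pos (state_at M n x t) != n ->
  env_at (cookie_env M p) x t (x t) 1 = right_bias p (cookies (state_at M n x t) (pos (state_at M n x t))).
Proof. by move=> h; rewrite (state_at_env _ h)// (state_at_pos h) /right_bias; case: cookies. Qed.

Lemma env_at_bounds (R : realType) (w : env R) x t : is_environment w ->
  forall z i, (0 < i)%N -> 1 / 2 <= env_at w x t z i <= 1.
Proof.
move=> hw; elim: t => [|t IH] z i hi /=; first exact: hw.
by rewrite /theta; case: ifP => _; exact: IH.
Qed.

Definition extend (x : nat -> int) (t : nat) (z : int) : nat -> int :=
  fun k => if (k <= t)%N then x k else z.

Section Prob.
Context d (T : measurableType d) (R : realType) (P : probability T R).
Variables (p : R) (M : nat) (X : nat -> T -> int).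
Hypothesis erw : is_erw P 0 (cookie_env M p) X.

Definition prob (A : set T) : R := fine (P A).

Lemma probE A : measurable A -> P A = (prob A)%:E.
Proof. by move=> mA; rewrite /prob fineK// fin_num_measure. Qed.

Lemma prob_ge0 A : 0 <= prob A. Proof. exact: fine_ge0. Qed.

Lemma prob_le A B : measurable A -> measurable B -> A `<=` B -> prob A <= prob B.
Proof.
by move=> mA mB AB; rewrite -lee_fin -!probE//; apply: le_measure; rewrite ?inE.
Qed.

Lemma prob_union A B : measurable A -> measurable B -> prob (A `|` B) <= prob A + prob B.
Proof.
move=> mA mB; rewrite -lee_fin EFinD -!probE//; last exact: measurableU.
exact: measureU2.
Qed.

Lemma measurable_position n z : measurable (X n @^-1` [set z]).
Proof. exact: (erw_measurable erw). Qed.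

Lemma past_succ x t : past X x t.+1 = past X x t `&` X t.+1 @^-1` [set x t.+1].
Proof.
apply/seteqP; split=> [w h|w [h1 h2] k].
  by split; [move=> k hk; apply: h; exact: leqW|exact: h].
by rewrite leq_eqVlt => /orP[/eqP ->|]; [exact: h2|exact: h1].
Qed.

Lemma measurable_past x t : measurable (past X x t).
Proof.
elim: t => [|t IH]; last by rewrite past_succ; apply: measurableI => //; exact: measurable_position.
have -> : past X x 0 = X 0%N @^-1` [set x 0%N].
  apply/seteqP; split=> [w h|w h k]; first exact: h.
  by rewrite leqn0 => /eqP ->.
exact: measurable_position.
Qed.

Lemma past_extend x t z : past X (extend x t z) t.+1 = past X x t `&` X t.+1 @^-1` [set z].
Proof.
rewrite past_succ /extend ltnn; congr (_ `&` _).
by apply/seteqP; split=> w h k hk; have := h k hk; rewrite /= hk.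
Qed.

(** Written over [nat], countable unions fall under the measure-theoretic lemmas. *)
Lemma bigcup_intE (F : int -> set T) :
  \bigcup_(z in [set: int]) F z = \bigcup_(n in [set: nat]) oapp F set0 (unpickle n).
Proof.
apply/seteqP; split=> [w [z _ h]|w [n _ h]].
  by exists (pickle z) => //; rewrite pickleK.
by move: h; case: unpickle => //= z h; exists z.
Qed.

Lemma measurable_bigcup_int (F : int -> set T) : (forall z, measurable (F z)) ->
  measurable (\bigcup_(z in [set: int]) F z).
Proof.
move=> h; rewrite bigcup_intE; apply: bigcupT_measurable => n.
by case: unpickle => [z|] /=; [exact: h|exact: measurable0].
Qed.

Lemma null_bigcup_int (F : int -> set T) : (forall z, P.-negligible (F z)) ->
  P.-negligible (\bigcup_(z in [set: int]) F z).
Proof.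
move=> h; rewrite bigcup_intE; apply: negligible_bigcup => n.
by case: unpickle => //=; exact: negligible_set0.
Qed.

Lemma past_split x t (B : set T) :
  past X x t `&` B = \bigcup_(z in [set: int]) (past X (extend x t z) t.+1 `&` B).
Proof.
apply/seteqP; split=> [w [h1 h2]|w [z _ []]].
  by exists (X t.+1 w) => //; rewrite past_extend.
by rewrite past_extend => -[h1 _] h2.
Qed.

Lemma all_split (B : set T) : B = \bigcup_(z in [set: int]) (past X (fun=> z) 0 `&` B).
Proof.
apply/seteqP; split=> [w h|w [z _ []] //].
exists (X 0%N w) => //; split=> // k; by rewrite leqn0 => /eqP ->.
Qed.

Definition depends_upto (N : nat) (Q : (nat -> int) -> Prop) :=
  forall x y, (forall k, (k <= N)%N -> x k = y k) -> Q x -> Q y.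

(** Split according to the next position, of which there are countably many,
    until the whole dependence range is fixed. *)
Lemma measurable_past_depends r t x Q : depends_upto (t + r) Q ->
  measurable (past X x t `&` [set w | Q (X ^~ w)]).
Proof.
elim: r t x => [|r IH] t x hQ.
  rewrite addn0 in hQ; have [q|nq] := pselect (Q x).
    have -> : past X x t `&` [set w | Q (X ^~ w)] = past X x t.
      apply/seteqP; split=> [w []//|w h]; split=> //=.
      by apply: hQ q => k hk; rewrite h.
    exact: measurable_past.
  have -> : past X x t `&` [set w | Q (X ^~ w)] = set0; last exact: measurable0.
  apply/seteqP; split=> // w [h1 h2]; apply: nq.
  by apply: hQ h2 => k hk; exact: h1.
rewrite past_split; apply: measurable_bigcup_int => z; apply: IH.
by rewrite addSnnS.
Qed.

Lemma measurable_depends_upto N Q : depends_upto N Q -> measurable [set w | Q (X ^~ w)].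
Proof.
move=> hQ; rewrite (all_split [set w | _]); apply: measurable_bigcup_int => z.
by apply: (@measurable_past_depends N); rewrite add0n.
Qed.

(** Null on each of the countably many atoms of the first [N] steps. *)
Lemma null_by_past N (B : set T) : (forall x, P.-negligible (past X x N `&` B)) -> P.-negligible B.
Proof.
move=> h.
have {}h : forall r x, (r <= N)%N -> P.-negligible (past X x (N - r) `&` B).
  elim=> [|r IH] x hr; first by rewrite subn0.
  rewrite past_split; apply: null_bigcup_int => z.
  by rewrite -subSn// subSS; apply: IH; exact: ltnW.
rewrite (all_split B); apply: null_bigcup_int => z.
by have := h N (fun=> z) (leqnn N); rewrite subnn.
Qed.

End Prob.

(** * From finite-horizon expectations to probabilities *)

Section Prob.
Context d (T : measurableType d) (R : realType) (P : probability T R).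
Variables (p : R) (M : nat) (X : nat -> T -> int).
Hypothesis hp : 1 / 2 <= p <= 1.
Hypothesis erw : is_erw P 0 (cookie_env M p) X.

Local Notation prob := (prob P).

Definition right_weight x t : R := env_at (cookie_env M p) x t (x t) 1.

Lemma prob_right x t : prob (past X (extend x t (x t + 1)) t.+1) = right_weight x t * prob (past X x t).
Proof.
apply/EFin_inj; rewrite -(probE P (measurable_past erw _ _)) past_extend (erw_right erw).
by rewrite (probE P (measurable_past erw _ _)) -EFinM.
Qed.

Lemma prob_left x t : prob (past X (extend x t (x t - 1)) t.+1) = (1 - right_weight x t) * prob (past X x t).
Proof.
apply/EFin_inj; rewrite -(probE P (measurable_past erw _ _)) past_extend (erw_left erw).
by rewrite (probE P (measurable_past erw _ _)) -EFinM.
Qed.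

Lemma prob_disj A B : measurable A -> measurable B -> A `&` B = set0 ->
  prob (A `|` B) = prob A + prob B.
Proof.
move=> mA mB AB; rewrite /prob measureU// fineD// fin_num_measure//.
Qed.

(** The event that the walk follows [x] up to time [t] and then does not jump to a
    neighbour. *)
Definition stray x t : set T :=
  past X x t `\` (past X (extend x t (x t + 1)) t.+1 `|` past X (extend x t (x t - 1)) t.+1).

Lemma measurable_stray x t : measurable (stray x t).
Proof.
apply: measurableD; first exact: measurable_past erw _ _.
by apply: measurableU; exact: measurable_past erw _ _.
Qed.

(** The two transition probabilities add up to one. *)
Lemma prob_stray x t : prob (stray x t) = 0.
Proof.
have mU := measurable_past erw (extend x t (x t + 1)) t.+1.
have mV := measurable_past erw (extend x t (x t - 1)) t.+1.
have mp := measurable_past erw x t.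
set U := past X (extend x t (x t + 1)) t.+1 in mU *; set V := past X (extend x t (x t - 1)) t.+1 in mV *.
have sub : U `|` V `<=` past X x t by rewrite /U /V !past_extend => w [[]|[]].
have e : past X x t = stray x t `|` (U `|` V).
  apply/seteqP; split=> [w h|w [[h _]|h]//]; last exact: sub.
  by have [h2|h2] := pselect ((U `|` V) w); [right|left].
have := prob_right x t; have := prob_left x t; rewrite -/U -/V.
rewrite e !prob_disj//.
- by lra.
- rewrite /U /V !past_extend; apply/seteqP; split=> // w [[_ h1] [_ h2]].
  by move: h1; rewrite /= h2 => /eqP; lia.
- exact: measurable_stray.
- exact: measurableU.
- by apply/seteqP; split=> // w [[_ h1]].
Qed.

Lemma path_ae : {ae P, forall w, X 0%N w = 0 /\
  forall t, X t.+1 w = X t w + 1 \/ X t.+1 w = X t w - 1}.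
Proof.
have h0 : {ae P, forall w, X 0%N w = 0}.
  exists (~` (X 0%N @^-1` [set 0])); split.
  - by apply: measurableC; exact: measurable_position erw _ _.
  - rewrite probability_setC; last exact: measurable_position erw _ _.
    by rewrite (erw_start erw) subee.
  - by move=> w h h'; apply: h.
have h1 : {ae P, forall w t, X t.+1 w = X t w + 1 \/ X t.+1 w = X t w - 1}.
  apply: ae_foralln => t.
  apply: (null_by_past (X := X) (N := t)) => x.
  exists (stray x t); split; first exact: measurable_stray.
    by rewrite (probE P (measurable_stray x t)) prob_stray.
  move=> w [h1 h2]; split=> // hUV; apply: h2 => /=.
  have hx : X t w = x t by exact: h1.
  rewrite hx; case: hUV; rewrite past_extend => -[_ h]; [by left|by right].
exact: filterI h0 h1.
Qed.

(** Induction on the number of remaining steps, splitting along the next jump; only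
    an inequality is needed, so a null event of stray paths is simply added. *)
(** The start of the walk is only almost surely [0], hence the null event added here. *)
Lemma prob_walkE_past n r t x (Q : walk_state -> bool) :
  prob (past X x t `&` [set w | Q (state_at M n (X ^~ w) (t + r))]) <=
  prob (past X x t) * walkE p n r (state_at M n x t) (fun s => (Q s)%:R).
Proof.
have mA r' t' y : measurable (past X y t' `&` [set w | Q (state_at M n (X ^~ w) (t' + r'))]).
  apply: (@measurable_past_depends _ _ _ _ _ _ _ erw r' t' y (fun z => Q (state_at M n z (t' + r')))).
  by move=> y1 y2 hy; rewrite (@state_at_local M n y1 y2).
(* Once the walk is stopped, or no step is left, the past decides the event. *)
have base r' t' y : state_at M n y (t' + r') = state_at M n y t' -> pos (state_at M n y t') = n \/ r' = 0%N ->
  prob (past X y t' `&` [set w | Q (state_at M n (X ^~ w) (t' + r'))]) <=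
  prob (past X y t') * (Q (state_at M n y t'))%:R.
  move=> hst hr.
  have key w : past X y t' w -> state_at M n (X ^~ w) (t' + r') = state_at M n y t'.
    move=> hw; have e : state_at M n (X ^~ w) t' = state_at M n y t' by apply: state_at_local => k; exact: hw.
    case: hr => [hn|->]; last by rewrite addn0.
    by rewrite state_at_stopped ?e.
  case hQ : (Q (state_at M n y t')).
    by rewrite mulr1; apply: prob_le => //; exact: measurable_past erw _ _.
  rewrite mulr0 (_ : _ `&` _ = set0); first by rewrite /prob measure0.
  by apply/seteqP; split=> // w [h1] /=; rewrite key// hQ.
elim: r t x => [|r IH] t x; first by apply: base; [rewrite addn0|right].
rewrite [walkE _ _ _ _ _]/=; case: ifP => [/eqP hn|/negbT hn].
  by apply: base; [exact: state_at_stopped|left].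
set c := right_bias _ _.
have ec : right_weight x t = c by exact: state_at_env1.
have sub : past X x t `&` [set w | Q (state_at M n (X ^~ w) (t + r.+1))] `<=`
   ((past X (extend x t (x t + 1)) t.+1 `&` [set w | Q (state_at M n (X ^~ w) (t.+1 + r))]) `|`
   (past X (extend x t (x t - 1)) t.+1 `&` [set w | Q (state_at M n (X ^~ w) (t.+1 + r))])) `|` stray x t.
  move=> w [h1 h2]; rewrite /= -addSnnS in h2.
  have [hR|hR] := pselect (past X (extend x t (x t + 1)) t.+1 w); first by left; left.
  have [hL|hL] := pselect (past X (extend x t (x t - 1)) t.+1 w); first by left; right.
  by right; split=> // -[].
have sx z : state_at M n (extend x t z) t.+1 = jump (state_at M n x t) z.
  rewrite /= (@state_at_local M n (extend x t z) x t); last by move=> k hk; rewrite /extend hk.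
  by rewrite (negbTE hn) /extend ltnn.
apply: le_trans (prob_le _ (mA r.+1 t x) _ sub) _.
  by apply: measurableU; [apply: measurableU|exact: measurable_stray].
apply: le_trans (prob_union _ _ (measurable_stray x t)) _; first exact: measurableU.
rewrite prob_stray addr0; apply: le_trans (prob_union _ _ _) _ => //.
have hR := IH t.+1 (extend x t (x t + 1)).
have hL := IH t.+1 (extend x t (x t - 1)).
rewrite sx prob_right ec in hR; rewrite sx prob_left ec in hL.
rewrite (state_at_pos hn); lra.
Qed.

Lemma measurable_state n r (Q : walk_state -> bool) : measurable [set w | Q (state_at M n (X ^~ w) r)].
Proof.
apply: (@measurable_depends_upto _ _ _ _ _ _ _ erw r (fun z => Q (state_at M n z r))).
by move=> y1 y2 hy; rewrite (@state_at_local M n y1 y2).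
Qed.

Lemma prob_walkE n r (Q : walk_state -> bool) :
  prob [set w | Q (state_at M n (X ^~ w) r)] <= walkE p n r (start_state M) (fun s => (Q s)%:R).
Proof.
have m0 := measurable_position erw 0 0.
have e0 : past X (fun=> 0) 0 = X 0%N @^-1` [set 0].
  apply/seteqP; split=> [w h|w h k]; first exact: h.
  by rewrite leqn0 => /eqP ->.
have m1 : measurable (past X (fun=> 0) 0 `&` [set w | Q (state_at M n (X ^~ w) r)]).
  by apply: measurableI; [exact: measurable_past erw _ _|exact: measurable_state].
have sub : [set w | Q (state_at M n (X ^~ w) r)] `<=`
   (past X (fun=> 0) 0 `&` [set w | Q (state_at M n (X ^~ w) r)]) `|` ~` (X 0%N @^-1` [set 0]).
  move=> w h; rewrite e0; have [h0|h0] := pselect (X 0%N w = 0); [by left|by right].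
apply: le_trans (prob_le _ (measurable_state n r Q) _ sub) _.
  by apply: measurableU => //; exact: measurableC.
apply: le_trans (prob_union _ m1 (measurableC m0)) _.
have -> : prob (~` (X 0%N @^-1` [set 0])) = 0.
  by rewrite /prob probability_setC// (erw_start erw) subee.
rewrite addr0; have := prob_walkE_past n r 0 (fun=> 0) Q; rewrite add0n => h.
apply: le_trans h _; rewrite e0.
have -> : prob (X 0%N @^-1` [set 0]) = 1 by rewrite /prob (erw_start erw).
by rewrite mul1r.
Qed.

(** The constant [C] over [k.+1 ^ 2] is summable, which is the form in which all
    the tail bounds below come. *)
Lemma borel_cantelli (F : nat -> set T) (C : R) : (forall k, measurable (F k)) ->
  (forall k, prob (F k) <= C / k.+1%:R ^+ 2) ->
  {ae P, forall w, exists k0 : nat, forall k, (k0 <= k)%N -> ~ F k w}.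
Proof.
move=> mF hF.
have C0 : 0 <= C.
  by have := le_trans (prob_ge0 P _) (hF 0%N); rewrite expr1n divr1.
have hs : (\sum_(n <oo) P (F n) < +oo)%E.
  apply: (@le_lt_trans _ _ (C * 2)%:E); last by rewrite ltry.
  apply: lime_le; first by apply: is_cvg_nneseries.
  apply: nearW => n.
  rewrite big_mkord (eq_bigr (fun i : 'I_n => (prob (F i))%:E)); last by move=> i _; exact: probE.
  rewrite sumEFin lee_fin.
  apply: (@le_trans _ _ (\sum_(i < n) (C * (i.+1%:R ^+ 2)^-1))).
    by apply: ler_sum => i _; exact: hF.
  by rewrite -mulr_sumr; apply: ler_wpM2l => //; exact: sum_inv_sq.
have h0 := lim_sup_set_cvg0 mF hs.
exists (lim_sup_set F); split=> //.
  by apply: bigcapT_measurable => n; exact: bigcup_measurable.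
move=> w /= h n _; apply: contrapT => h2; apply: h; exists n => k hk Fk.
by apply: h2; exists k.
Qed.

End Prob.

(** * Counting left jumps along a nearest-neighbour path *)

Definition left_jumps (x : nat -> int) (t : nat) (z : int) : nat :=
  (\sum_(j < t) ((x j == z) && (x j.+1 == z - 1)%R))%N.

Definition first_hit (x : nat -> int) (n : int) (tau : nat) : Prop :=
  x tau = n /\ forall k, (k < tau)%N -> x k <> n.

Lemma left_jumps_succ x t z : left_jumps x t.+1 z = (left_jumps x t z + ((x t == z) && (x t.+1 == z - 1)%R))%N.
Proof. by rewrite /left_jumps big_ord_recr. Qed.

(** The stopped state remembers exactly the left jumps made before the first visit
    of [n]. *)
Lemma state_at_hit M n x r :
  if pos (state_at M n x r) == n then
    exists2 tau, (tau <= r)%N & first_hit x n tau /\ forall z, lefts (state_at M n x r) z = left_jumps x tau z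
  else (forall k, (k <= r)%N -> x k <> n) /\ forall z, lefts (state_at M n x r) z = left_jumps x r z.
Proof.
elim: r => [|r].
  rewrite /=; case: eqP => h.
    by exists 0%N => //; split; [split|move=> z; rewrite /left_jumps big_ord0].
  by split=> [k|z]; [rewrite leqn0 => /eqP ->|rewrite /left_jumps big_ord0].
rewrite /=; case: (eqVneq (pos (state_at M n x r)) n) => [h1|h1 [h2 h3]].
  move=> [tau h2 h3]; rewrite h1 eqxx; exists tau => //; exact: leqW.
have hl z : lefts (jump (state_at M n x r) (x r.+1)) z = left_jumps x r.+1 z.
  rewrite /= left_jumps_succ (state_at_pos h1) h3 eq_sym; case: eqP => [->|_] /=; last by rewrite addn0.
  by case: eqP => _; rewrite ?addn1 ?addn0.
rewrite [pos (jump _ _)]/=; case: (eqVneq (x r.+1) n) => [h4|/eqP h4].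
  exists r.+1 => //; split=> //; split=> // k; rewrite ltnS; exact: h2.
split=> // k; rewrite leq_eqVlt => /orP[/eqP -> //|]; rewrite ltnS; exact: h2.
Qed.

Section Path.
Variable x : nat -> int.
Hypothesis x0 : x 0%N = 0.
Hypothesis xs : forall t, x t.+1 = x t + 1 \/ x t.+1 = x t - 1.

Lemma path_up s k : x (s + k) <= x s + k%:Z.
Proof.
elim: k => [|k IH]; first by rewrite addn0 addr0.
by rewrite addnS; case: (xs (s + k)) => ->; lia.
Qed.

Lemma path_down s k : x s - k%:Z <= x (s + k).
Proof.
elim: k => [|k IH]; first by rewrite addn0 subr0.
by rewrite addnS; case: (xs (s + k)) => ->; lia.
Qed.

Lemma path_le t : x t <= t%:Z.
Proof. by have := path_up 0 t; rewrite x0 add0r add0n. Qed.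

Lemma below_hit (n : nat) t : (forall k, (k <= t)%N -> x k <> n.+1%:Z) -> x t < n.+1%:Z.
Proof.
elim: t => [|t IH] h; first by rewrite x0.
have h1 := IH (fun k hk => h k (leqW hk)); have h2 := h t.+1 (leqnn _).
by case: (xs t) h2 => ->; lia.
Qed.

Lemma first_hit_le n tau s : first_hit x n tau -> x s = n -> (tau <= s)%N.
Proof. by move=> [_ h] hs; rewrite leqNgt; apply/negP => /h. Qed.

Definition all_left_jumps (t : nat) : nat := (\sum_(j < t) (x j.+1 == x j - 1)%R)%N.
Definition negative_visits (t : nat) : nat := (\sum_(j < t) (x j < 0)%R)%N.

(** Right jumps minus left jumps is the position. *)
Lemma path_time t : t%:Z = x t + 2 * (all_left_jumps t)%:Z.
Proof.
elim: t => [|t IH]; first by rewrite /all_left_jumps big_ord0 x0.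
rewrite /all_left_jumps big_ord_recr /= -/(all_left_jumps t).
have -> : (x t.+1 == x t - 1) = ~~ (x t.+1 == x t + 1).
  by case: (xs t) => ->; [have -> : (x t + 1 == x t - 1) = false by lia|
    have -> : (x t - 1 == x t + 1) = false by lia]; rewrite eqxx.
case: eqP => [->|h] /=; first by lia.
have -> : x t.+1 = x t - 1 by case: (xs t).
by lia.
Qed.

(** A left jump is made from one of the sites [0, ..., n-1] or from a negative
    site. *)
Lemma left_jumps_total (n : nat) t : (forall k, (k < t)%N -> x k < n%:Z) ->
  (\sum_(k < n) left_jumps x t k%:Z <= all_left_jumps t)%N /\ (all_left_jumps t <= \sum_(k < n) left_jumps x t k%:Z + negative_visits t)%N.
Proof.
elim: t => [|t IH] h.
  rewrite /all_left_jumps /negative_visits !big_ord0 addn0; split=> //.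
  by rewrite big1// => k _; rewrite /left_jumps big_ord0.
have [h1 h2] := IH (fun k hk => h k (leqW hk)).
rewrite /all_left_jumps /negative_visits !big_ord_recr /= -/(all_left_jumps t) -/(negative_visits t).
rewrite (eq_bigr (fun k : 'I_n => (left_jumps x t k%:Z + ((x t == k%:Z) && (x t.+1 == k%:Z - 1)%R))%N)); last first.
  by move=> k _; exact: left_jumps_succ.
rewrite big_split /=; set S := (\sum_(k < n) left_jumps x t k%:Z)%N in h1 h2 *.
have hx := h t (ltnSn t).
case: (ltP (x t) 0) => hneg.
  rewrite [(\sum_(k < n) nat_of_bool _)%N]big1; last first.
    by move=> k _; have -> : (x t == k%:Z) = false by lia.
  by split; [|case: (_ == _)] => /=; lia.
have hm : (`|x t| < n)%N by lia.
rewrite (bigD1 (Ordinal hm)) //= big1 ?addn0; last first.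
  move=> k hk; have -> // : (x t == k%:Z) = false.
  apply/eqP => e; move/eqP: hk; apply; apply: val_inj => /=; lia.
have -> : (x t == `|x t|%N%:Z) by lia.
have -> : (x t.+1 == `|x t|%N%:Z - 1) = (x t.+1 == x t - 1) by lia.
by case: (_ == _) => /=; lia.
Qed.

(** [path_time] at the first visit of [n], where the position is [n]. *)
Lemma hit_time (n : nat) tau : (0 < n)%N -> first_hit x n%:Z tau ->
  (n + 2 * \sum_(k < n) left_jumps x tau k%:Z <= tau)%N /\
  (tau <= n + 2 * (\sum_(k < n) left_jumps x tau k%:Z + negative_visits tau))%N.
Proof.
case: n => [//|n] _ [h1 h2].
have hb k : (k < tau)%N -> x k < n.+1%:Z.
  move=> hk; apply: below_hit => j hj; apply: h2; exact: leq_ltn_trans hk.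
have [h3 h4] := left_jumps_total hb.
have := path_time tau; rewrite h1; lia.
Qed.

Lemma left_jumps_mono s t z : (s <= t)%N -> (left_jumps x s z <= left_jumps x t z)%N.
Proof.
move=> /subnKC <-; elim: (t - s)%N => [|k IH]; rewrite ?addn0 // addnS left_jumps_succ.
exact: leq_trans IH (leq_addr _ _).
Qed.

(** A bounded nondecreasing sequence of integers is eventually constant. *)
Lemma last_left_jump z K : (forall t, left_jumps x t z <= K)%N ->
  exists t0, forall t, (t0 <= t)%N -> ~~ ((x t == z) && (x t.+1 == z - 1)).
Proof.
elim: K => [|K IH] hK.
  exists 0%N => t _; have := hK t.+1; rewrite left_jumps_succ leqn0 addn_eq0 => /andP[_].
  by case: (_ && _).
have [[t0 ht0]|h] := pselect (exists t0, left_jumps x t0 z = K.+1).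
  exists t0 => t ht; have := hK t.+1; rewrite left_jumps_succ.
  have := left_jumps_mono z ht; rewrite ht0; case: (_ && _) => //; lia.
apply: IH => t; have := hK t; rewrite leq_eqVlt => /orP[/eqP e|//].
by case: h; exists t.
Qed.

Hypothesis unb : forall n : nat, exists t, x t = n.+1%:Z.
Hypothesis fin : forall i : nat, exists K, forall t, (left_jumps x t i%:Z <= K)%N.

(** After the last left jump from [i.+1], a visit to a higher level cannot be
    followed by a return to [i]. *)
Lemma eventually_above (i : nat) : exists t1, forall t, (t1 <= t)%N -> i%:Z < x t.
Proof.
have [K hK] := fin i.+1; have [t0 ht0] := last_left_jump hK.
have [s hs] := unb (t0 + i).
have ts : (t0 <= s)%N by have := path_le s; rewrite hs; lia.
exists s => t /subnKC <-; elim: (t - s)%N => [|k IH]; first by rewrite addn0 hs; lia.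
rewrite addnS; have := ht0 (s + k)%N (leq_trans ts (leq_addr _ _)).
by case: (xs (s + k)) => ->; [lia|]; lia.
Qed.

(** No site is visited after the path has risen above it for good. *)
Lemma path_transient z : finite_set [set n | x n = z].
Proof.
have [t1 h] := eventually_above `|z|%N.
apply: (@sub_finite_set _ _ `I_t1); last exact: finite_II.
move=> t /= ht; rewrite ltnNge; apply/negP => /h; rewrite ht; lia.
Qed.

Lemma negative_visits_bounded : exists K, forall t, (negative_visits t <= K)%N.
Proof.
have [t1 h] := eventually_above 0.
exists t1 => t; have [ht|ht] := leqP t t1.
  apply: leq_trans ht; rewrite -[leqRHS]card_ord -sum1_card; apply: leq_sum => j _.
  by case: (_ < _).
rewrite -(subnKC (ltnW ht)) /negative_visits big_split_ord /= [X in (_ + X)%N]big1 ?addn0; last first.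
  by move=> j _; have := h (t1 + j)%N (leq_addr _ _); case: ltP => //; lia.
rewrite -[leqRHS]card_ord -sum1_card; apply: leq_sum => j _; by case: (_ < _).
Qed.

End Path.

(** * From hitting times of sparse levels to the speed *)

(** The exponent is dictated by [low_tail_mean]: with [eta = 1 / k.+1 ^ 2] its bound is a
    constant times [k.+1 ^ 10 / level k], which has to be summable.  Polynomial growth
    keeps the ratio of successive levels close to [1]. *)
Definition level (k : nat) : nat := (k.+1 ^ 12)%N.

Lemma level_gt k : (k < level k)%N.
Proof. by apply: leq_trans (_ : k.+1 ^ 1 <= _)%N; [rewrite expn1|rewrite leq_pexp2l]. Qed.

Lemma level_gt0 k : (0 < level k)%N.
Proof. exact: leq_ltn_trans (leq0n k) (level_gt k). Qed.

Lemma level_ratio (R : realType) (e : R) : 0 < e ->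
  exists k0, forall k, (k0 <= k)%N -> (level k.+1)%:R <= (1 + e) * (level k)%:R.
Proof.
move=> e0; pose C : R := 12 + 4 ^+ 12.
have C0 : 0 < C by rewrite addr_gt0// exprn_gt0.
exists (Num.truncn (C / e)).+1 => k hk.
have k0 : 0 < k.+1%:R :> R by rewrite ltr0n.
have hC : C / k.+1%:R <= e.
  rewrite ler_pdivrMr// mulrC -ler_pdivrMr//; apply: ltW; apply: lt_le_trans (truncnS_gt _) _.
  by rewrite ler_nat; exact: leqW.
pose y : R := (k.+1%:R)^-1.
have y0 : 0 <= y by rewrite invr_ge0.
have y1 : y <= 1 by rewrite invf_le1// ler1n.
have hy : 0 <= y <= 1 by rewrite y0 y1.
have hb := binom_le 12 hy.
have -> : (level k.+1)%:R = (1 + y) ^+ 12 * (level k)%:R :> R.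
  rewrite /y /level !natrX -exprMn; congr (_ ^+ _).
  by rewrite mulrDl mul1r mulVf ?gt_eqF// natr1.
have y2 : y ^+ 2 <= y by rewrite expr2; apply: ler_piMr.
have G0 : 0 <= 4 ^+ 12 :> R by exact: exprn_ge0.
rewrite -/y in hC.
apply: ler_wpM2r => //; apply: (le_trans hb); move: G0 hC; rewrite /C.
move: (4 ^+ 12) => G G0 hC; have := ler_wpM2l G0 y2; lra.
Qed.

Section Speed.
Variables (R : realType) (x : nat -> int).
Hypothesis x0 : x 0%N = 0.
Hypothesis xs : forall t, x t.+1 = x t + 1 \/ x t.+1 = x t - 1.

Lemma level_at k0 t : (exists2 s, (s <= t)%N & x s = (level k0)%:Z) -> exists2 k, (k0 <= k)%N &
  (exists2 s, (s <= t)%N & x s = (level k)%:Z) /\ (forall s, (s <= t)%N -> x s <> (level k.+1)%:Z).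
Proof.
move=> h0; apply: contrapT => hno.
have h k : exists2 s, (s <= t)%N & x s = (level (k0 + k))%:Z.
  elim: k => [|k IH]; first by rewrite addn0.
  rewrite addnS; apply: contrapT => h; apply: hno; exists (k0 + k)%N; first exact: leq_addr.
  by split=> // s hs e; apply: h; exists s.
have [s hs e] := h t; have := path_le x0 xs s; have := level_gt (k0 + t); lia.
Qed.

(** Between the first visits of two successive levels the position is at most
    the upper level, and it is at least the lower level minus the time elapsed. *)
Lemma level_bounds k0 t : (exists2 s, (s <= t)%N & x s = (level k0)%:Z) ->
  (forall k, (k0 <= k)%N -> exists tau, first_hit x (level k)%:Z tau) ->
  exists k t1 t2, [/\ (k0 <= k)%N, first_hit x (level k)%:Z t1, first_hit x (level k.+1)%:Z t2,
     (t1 <= t)%N & (t <= t2)%N] /\ (x t <= (level k.+1)%:Z /\ (level k)%:Z - (t - t1)%N%:Z <= x t).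
Proof.
move=> h0 hh; have [k hk [[s hs e] h2]] := level_at h0.
have [t1 h1] := hh k hk; have [t2 h3] := hh k.+1 (leqW hk).
exists k, t1, t2.
have l1 : (t1 <= t)%N by apply: leq_trans hs; exact: first_hit_le h1 e.
have l2 : (t <= t2)%N.
  by rewrite leqNgt; apply/negP => /ltnW h; case: h3 => h3 _; exact: (h2 t2 h h3).
do 2 split=> //.
  have := level_gt0 k.+1; move: h2; case: (level k.+1) => // n h2 _.
  by apply: ltW; apply: below_hit.
by have := path_down x0 xs t1 (t - t1); rewrite subnKC//; case: h1 => ->.
Qed.

(** Up to the first visit of the level [k.+1] the position is at most twice [level k],
    whereas the time exceeds [C * level k]. *)
Lemma speed_zero : (forall C : R, exists k0, forall k, (k0 <= k)%N ->
    exists2 tau, first_hit x (level k)%:Z tau & C * (level k)%:R <= tau%:R) ->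
  (exists t1, forall t, (t1 <= t)%N -> 0 < x t) ->
  ((x n)%:~R / n%:R : R) @[n --> \oo] --> (0 : R).
Proof.
move=> hC [t1 ht1]; apply/cvgrPdist_le => e e0.
have [k1 hk1] := @level_ratio R 1 ltr01.
pose C := 2 / e.
have C0 : 0 < C by rewrite divr_gt0.
have [k2 hk2] := hC C.
pose k0 := (k1 + k2)%N.
have [t0 h0 _] := hk2 k0 (leq_addl _ _).
exists (t0 + t1).+1 => //= t; rewrite /= => ht.
have hh k : (k0 <= k)%N -> exists tau, first_hit x (level k)%:Z tau.
  by move=> hk; have [tau h _] := hk2 k (leq_trans (leq_addl _ _) hk); exists tau.
have [|k [s1 [s2 [[hk f1 f2 l1 l2] [b1 b2]]]]] := @level_bounds k0 t _ hh.
  by exists t0; [clear -ht; lia|case: h0].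
have [tau f3 hC1] := hk2 k (leq_trans (leq_addl _ _) hk).
have e3 : (tau <= s1)%N by apply: first_hit_le f3 _; case: f1.
have hr := hk1 k (leq_trans (leq_addr _ _) hk).
have xt0 : 0 < x t by apply: ht1; clear -ht; lia.
have tt : 0 < t%:R :> R by rewrite ltr0n; clear -ht; lia.
have xt1 : 0 <= (x t)%:~R :> R by rewrite ler0z ltW.
rewrite sub0r normrN ger0_norm; last by rewrite divr_ge0.
rewrite ler_pdivrMr//.
have h1 : (x t)%:~R <= (level k.+1)%:R :> R by rewrite -[(level k.+1)%:R]/((level k.+1)%:Z%:~R) ler_int.
have h2 : tau%:R <= t%:R :> R by rewrite ler_nat (leq_trans e3).
have h3 : e * (C * (level k)%:R) <= e * t%:R.
  by apply: ler_wpM2l; [exact: ltW|exact: le_trans h2].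
have e4 : e * (C * (level k)%:R) = 2 * (level k)%:R.
  by rewrite /C mulrA mulrCA divff ?mulr1// gt_eqF.
rewrite e4 in h3; lra.
Qed.

(** Both the position and the time lie between their values at two successive
    levels, up to a fraction [e'] of [level k]. *)
Lemma speed_pos (c : R) : 1 <= c ->
  (forall e : R, 0 < e -> exists k0, forall k, (k0 <= k)%N ->
    exists2 tau, first_hit x (level k)%:Z tau &
      (c - e) * (level k)%:R <= tau%:R <= (c + e) * (level k)%:R) ->
  ((x n)%:~R / n%:R : R) @[n --> \oo] --> (c^-1 : R).
Proof.
move=> c1 hc; apply/cvgrPdist_le => e e0.
pose e' := Num.min (e / 14) (1 / 2).
have e'0 : 0 < e' by rewrite lt_min !divr_gt0.
have e'1 : e' <= 1 / 2 by rewrite ge_min lexx orbT.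
have e'2 : e' * 14 <= e by rewrite -ler_pdivlMr// ge_min lexx.
have [k1 hk1] := @level_ratio R e' e'0.
have [k2 hk2] := hc e' e'0.
pose k0 := (k1 + k2)%N.
have [t0 h0 _] := hk2 k0 (leq_addl _ _).
exists t0.+1 => //= t; rewrite /= => ht.
have hh k : (k0 <= k)%N -> exists tau, first_hit x (level k)%:Z tau.
  by move=> hk; have [tau h _] := hk2 k (leq_trans (leq_addl _ _) hk); exists tau.
have [|k [s1 [s2 [[hk f1 f2 l1 l2] [b1 b2]]]]] := @level_bounds k0 t _ hh.
  by exists t0; [clear -ht; lia|case: h0].
have uniq n a b : first_hit x n a -> first_hit x n b -> a = b.
  move=> fa fb; apply/eqP; rewrite eqn_leq.
  by rewrite (first_hit_le fa) ?(first_hit_le fb)//; [case: fa|case: fb].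
have [tau f3 /andP[a1 a2]] := hk2 k (leq_trans (leq_addl _ _) hk).
have [tau' f4 /andP[a3 a4]] := hk2 k.+1 (leqW (leq_trans (leq_addl _ _) hk)).
rewrite (uniq _ _ _ f3 f1) {f3} in a1 a2; rewrite (uniq _ _ _ f4 f2) {f4} in a3 a4.
have hr := hk1 k (leq_trans (leq_addr _ _) hk).
have tt : 0 < t%:R :> R by rewrite ltr0n; clear -ht; lia.
have q1 : s1%:R <= t%:R :> R by rewrite ler_nat.
have q2 : t%:R <= s2%:R :> R by rewrite ler_nat.
have q3 : (x t)%:~R <= (level k.+1)%:R :> R by rewrite -[(level k.+1)%:R]/((level k.+1)%:Z%:~R) ler_int.
have q4 : (level k)%:R - (t%:R - s1%:R) <= (x t)%:~R :> R.
  by rewrite -natrB// -[(level k)%:R]/((level k)%:Z%:~R) -[(t - s1)%N%:R]/((t - s1)%N%:Z%:~R) -intrB ler_int.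
have c0 : 0 < c by lra.
have N0 : 0 < (level k)%:R :> R by rewrite ltr0n level_gt0.
rewrite distrC.
have -> : (x t)%:~R / t%:R - c^-1 = (c * (x t)%:~R - t%:R) / (c * t%:R).
  by field; rewrite !gt_eqF.
have ct : 0 < c * t%:R by rewrite mulr_gt0.
rewrite normrM [X in _ * X]gtr0_norm ?invr_gt0// ler_pdivrMr//.
move: (level k)%:R (level k.+1)%:R (x t)%:~R t%:R s1%:R s2%:R tt q1 q2 q3 q4 a1 a2 a3 a4 hr N0 ct.
move=> n n' y u v w tt q1 q2 q3 q4 a1 a2 a3 a4 hr N0 ct.
have cc : c <= c ^+ 2 by rewrite expr2; apply: ler_peMl => //; exact: ltW.
have w1 : w <= (c + e') * ((1 + e') * n) by apply: (le_trans a4); apply: ler_wpM2l => //; lra.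
have lowt : c / 2 * n <= u.
  apply: le_trans q1; apply: le_trans a1; apply: ler_wpM2r; [exact: ltW|lra].
(* The deviation of [c * y] from [u] will be at most [7 * c ^+ 2 * e' * n]. *)
have main : 7 * c ^+ 2 * e' * n <= e * (c * u).
  have k1' : e * (c * (c / 2 * n)) <= e * (c * u).
    by apply: ler_wpM2l; [exact: ltW|apply: ler_wpM2l => //; exact: ltW].
  apply: le_trans k1'.
  have : c ^+ 2 * n * (e' * 14) <= c ^+ 2 * n * e.
    by apply: ler_wpM2l => //; rewrite mulr_ge0 ?sqr_ge0// ltW.
  lra.
have en : 0 <= e' * n by rewrite mulr_ge0// ltW.
have cen : c * (e' * n) <= c ^+ 2 * (e' * n) by apply: ler_wpM2r.
have oen : e' * n <= c ^+ 2 * (e' * n) by rewrite -[leLHS]mul1r; apply: ler_wpM2r => //; lra.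
have een : e' * (e' * n) <= 1 / 2 * (e' * n) by apply: ler_wpM2r.
have ceen : c * (e' * (e' * n)) <= c * (1 / 2 * (e' * n)) by apply: ler_wpM2l => //; exact: ltW.
rewrite ler_norml; apply/andP; split.
  apply: (@le_trans _ _ (- (7 * c ^+ 2 * e' * n))); first by rewrite lerN2.
  have l3 : n - ((c + e') * ((1 + e') * n) - (c - e') * n) <= y by lra.
  have l4 := ler_wpM2l (ltW c0) l3.
  have l5 : u <= (c + e') * ((1 + e') * n) by lra.
  lra.
apply: le_trans main.
have l3 : c * y <= c * ((1 + e') * n) by apply: ler_wpM2l; [exact: ltW|lra].
lra.
Qed.

End Speed.

(** * Transience, and zero speed when M(2p-1) lies between 1 and 2 *)

(** Take [A] large compared with [n / e], then [r] large compared with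
    [n A / e], in [walkE_hit]. *)
Lemma walkE_miss_small (R : realType) (p : R) (M n : nat) (e : R) : 1 / 2 <= p <= 1 -> 0 < e ->
  exists r, walkE p n%:Z r (start_state M) (fun s => (pos s != n%:Z)%:R) <= e.
Proof.
move=> hp e0.
have [A hA] : exists A : nat, 2 * n%:R / e + n%:R < A%:R.
  by exists (Num.truncn (2 * n%:R / e + n%:R)).+1; exact: truncnS_gt.
have n0 := ler0n R n.
have A0 : 0 < A%:R :> R by apply: le_lt_trans hA; rewrite addr_ge0// divr_ge0 ?mulr_ge0// ltW.
have [r hr] : exists r : nat, 4 * n%:R * A%:R / e < r%:R.
  by exists (Num.truncn (4 * n%:R * A%:R / e)).+1; exact: truncnS_gt.
have r0 : 0 < r%:R :> R by apply: le_lt_trans hr; rewrite divr_ge0 ?mulr_ge0// ltW.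
exists r.
apply: le_trans (@walkE_hit R p hp n A r _ _ 0 r (start_state M) _ _) _ => //.
- by rewrite -(ltr0n R).
- by rewrite -(ltr0n R).
rewrite /hit_bound /= subr0; case: eqP => [_|_]; first exact: ltW.
have nA : n%:R < A%:R :> R.
  by apply: le_lt_trans hA; rewrite lerDr divr_ge0 ?mulr_ge0// ltW.
have -> : (A%:Z <= n%:Z) = false by apply/negbTE; rewrite -ltNge ltz_nat -(ltr_nat R).
rewrite ge_min; apply/orP; right; rewrite /hit_potential -[n%:Z%:~R]/(n%:R : R) addr0.
have h1 : n%:R / A%:R <= e / 2.
  rewrite ler_pdivrMr// -ler_pdivrMl ?divr_gt0//.
  rewrite invf_div [leLHS](_ : _ = 2 * n%:R / e); last by ring.
  by apply: ltW; apply: le_lt_trans hA; rewrite lerDl.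
have h2 : n%:R * (2 * A%:R - n%:R) / r%:R <= e / 2.
  rewrite ler_pdivrMr//.
  have h3 : 4 * n%:R * A%:R <= r%:R * e by rewrite -ler_pdivrMr// ltW.
  have : 0 <= n%:R * n%:R :> R by rewrite mulr_ge0.
  lra.
lra.
Qed.

Lemma expR_inv_bound (R : realType) (y : R) : 0 < y -> expR (- y) <= 1 / y.
Proof.
move=> y0; rewrite expRN div1r lef_pV2 ?posrE ?expR_gt0//.
by have := expR_ge1Dx y; lra.
Qed.

Lemma walkE_bool_union (R : realType) (p : R) (n : nat) r s (Q1 Q2 : walk_state -> bool) : 1 / 2 <= p <= 1 ->
  walkE p n%:Z r s (fun s => (Q1 s || Q2 s)%:R) <=
  walkE p n%:Z r s (fun s => (Q1 s)%:R) + walkE p n%:Z r s (fun s => (Q2 s)%:R).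
Proof.
move=> hp; have := walkE_lin p n r s 1 1 (fun s => (Q1 s)%:R) (fun s => (Q2 s)%:R).
rewrite !mul1r => <-; apply: (walkE_le hp) => s'; case: (Q1 s'); case: (Q2 s') => /=; lra.
Qed.

Section Final.
Context d (T : measurableType d) (R : realType) (P : probability T R).
Variables (p : R) (M : nat) (X : nat -> T -> int).
Hypothesis hp : 1 / 2 <= p <= 1.
Hypothesis erw : is_erw P 0 (cookie_env M p) X.
Local Notation prob := (prob P).
Local Notation walkEn n r F := (walkE p (n%N)%:Z r (start_state M) F).

Lemma null_small A : measurable A -> (forall e, 0 < e -> prob A <= e) -> P A = 0%E.
Proof.
move=> mA h; rewrite (probE P mA); congr (_%:E); apply/eqP; rewrite eq_le (prob_ge0 P) andbT.
by apply/ler_addgt0Pl => e e0; rewrite addr0; exact: h.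
Qed.

(** Missing a level up to every horizon has arbitrarily small probability. *)
Lemma hits_ae : {ae P, forall w, forall n : nat, exists t, X t w = n.+1%:Z}.
Proof.
apply: ae_foralln => n.
pose A r := [set w | (fun s => pos s != n.+1%:Z) (state_at M n.+1%:Z (X ^~ w) r)].
have mA r : measurable (A r) by exact: (measurable_state erw n.+1%:Z r (fun s => pos s != n.+1%:Z)).
have mI : measurable (\bigcap_r A r) by exact: bigcapT_measurable.
exists (\bigcap_r A r); split=> //.
  apply: null_small => // e e0.
  have [r hr] := walkE_miss_small M n.+1 hp e0.
  apply: le_trans hr; apply: le_trans (prob_walkE hp erw n.+1%:Z r (fun s => pos s != n.+1%:Z)).
  by apply: (prob_le P mI (mA r)) => w /(_ r I).
move=> w /= h r _; rewrite /A /=; apply/negP => hr.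
have := state_at_hit M n.+1%:Z (X ^~ w) r; rewrite hr => -[tau _ [[h1 _] _]].
by apply: h; exists tau.
Qed.

Lemma left_jumps_depends t i K : depends_upto t (fun x => (K <= left_jumps x t i)%N).
Proof.
move=> x y h; rewrite /left_jumps (eq_bigr (fun j : 'I_t => nat_of_bool ((y j == i) && (y j.+1 == i - 1)))) //.
by move=> j _; rewrite !h//; exact: ltnW.
Qed.

(** The left jumps from [i] before time [t] are among those made before the first
    visit of a level beyond [t] and [i], to which tightness of the chain applies; that
    level is reached within some horizon up to probability [e / 2]. *)
Lemma left_jumps_tail (e : R) : 1 < M%:R * (2 * p - 1) -> 0 < e -> exists K, forall (i : nat) t,
  prob [set w | (K <= left_jumps (X ^~ w) t i%:Z)%N] <= e.
Proof.
move=> hd e0.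
have e20 : 0 < e / 2 by rewrite divr_gt0.
have [K hK] := chain_tight hp hd e20.
exists K => i t.
have [N0 [mN0 PN0 hN0]] := path_ae hp erw.
pose n := (maxn t i).+1.
have [r hr] := walkE_miss_small M n hp e20.
pose Q1 s := pos s != n%:Z.
pose Q2 s := (pos s == n%:Z) && (K <= lefts s i%:Z)%N.
have m1 : measurable [set w | (Q1 (state_at M n%:Z (X ^~ w) r) || Q2 (state_at M n%:Z (X ^~ w) r))].
  exact: (measurable_state erw n%:Z r (fun s => Q1 s || Q2 s)).
have mL : measurable [set w | (K <= left_jumps (X ^~ w) t i%:Z)%N].
  exact: (measurable_depends_upto erw (@left_jumps_depends t i%:Z K)).
have sub : [set w | (K <= left_jumps (X ^~ w) t i%:Z)%N] `<=`
   [set w | (Q1 (state_at M n%:Z (X ^~ w) r) || Q2 (state_at M n%:Z (X ^~ w) r))] `|` N0.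
  move=> w /= hw.
  have [[x0 xs]|hn] := pselect (X 0%N w = 0 /\ forall t, X t.+1 w = X t w + 1 \/ X t.+1 w = X t w - 1);
    last by right; apply: hN0.
  left; rewrite /Q1 /Q2; have := state_at_hit M n%:Z (X ^~ w) r.
  case: eqP => //= _ [tau htau [[h1 h2] h3]].
  rewrite h3; apply: (leq_trans hw); apply: left_jumps_mono.
  have := path_le x0 xs tau; rewrite h1 /n => h4.
  have h5 : (n <= tau)%N by rewrite -lez_nat.
  apply: leq_trans h5; rewrite /n; apply: leqW; exact: leq_maxl.
have PN : prob N0 = 0 by rewrite /prob PN0.
apply: le_trans (prob_le _ mL _ sub) _; first exact: measurableU.
apply: le_trans (prob_union _ m1 mN0) _; rewrite PN addr0.
apply: le_trans (prob_walkE hp erw n%:Z r (fun s => Q1 s || Q2 s)) _.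
apply: le_trans (walkE_bool_union _ _ _ _ _ hp) _.
have h2 : walkEn n r (fun s => (Q2 s)%:R) <= e / 2.
  have hi : (i < n)%N by rewrite ltnS leq_maxr.
  have h3 := @walkE_site R p hp M n r i (fun m => (K <= m)%N%:R) hi.
  apply: le_trans (le_trans _ (h3 _ _)) (hK r (n - i)%N).
  - apply: (walkE_le hp) => s; rewrite /Q2; case: eqP => _ /=; lra.
  - by move=> m.
  - by move=> m; rewrite ler_nat; case: (leqP K m) => // h; rewrite (leqW h).
by rewrite /Q1 in hr *; lra.
Qed.

(** The bound of [left_jumps_tail] does not depend on the time, so it passes to the
    increasing union over all times. *)
Lemma left_jumps_bounded_ae : 1 < M%:R * (2 * p - 1) ->
  {ae P, forall w, forall i : nat, exists K, forall t, (left_jumps (X ^~ w) t i%:Z <= K)%N}.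
Proof.
move=> hd; apply: ae_foralln => i.
have [N0 [mN0 PN0 hN0]] := path_ae hp erw.
pose A K t := [set w | (K <= left_jumps (X ^~ w) t i%:Z)%N].
have mA K t : measurable (A K t) by exact: (measurable_depends_upto erw (@left_jumps_depends t i%:Z K)).
have mU K : measurable (\bigcup_t A K t) by exact: bigcupT_measurable.
have mI : measurable (\bigcap_K \bigcup_t A K t) by exact: bigcapT_measurable.
exists (\bigcap_K \bigcup_t A K t); split=> //.
  apply: null_small => // e e0.
  have [K hK] := left_jumps_tail hd e0.
  apply: (@le_trans _ _ (prob (\bigcup_t A K t))).
    by apply: (prob_le P mI (mU K)) => w /(_ K I).
  have nd : {homo (A K) : n m / (n <= m)%N >-> (n <= m)%O}.
    move=> a b ab; apply/subsetPset => w /= h; apply: (leq_trans h); exact: left_jumps_mono.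
  have c := @nondecreasing_cvg_mu _ _ _ P _ (mA K) (mU K) nd.
  rewrite -lee_fin -(probE P (mU K)) -(cvg_lim _ c)//.
  apply: lime_le; first by apply: cvgP c.
  by apply: nearW => t /=; rewrite (probE P (mA K t)) lee_fin; exact: hK.
move=> w /= h K _; apply: contrapT => h2; apply: h; exists K => t.
by rewrite leqNgt; apply/negP => h3; apply: h2; exists t => //=; exact: ltnW.
Qed.

Lemma transient_erw : 1 < M%:R * (2 * p - 1) -> transient P X.
Proof.
move=> hd; rewrite /transient.
have h1 := path_ae hp erw; have h2 := hits_ae; have h3 := left_jumps_bounded_ae hd.
apply: filterS3 h1 h2 h3 => w [x0 xs] h2 h3 z.
exact: (path_transient x0 xs h2 h3).
Qed.

(** For each constant [B], apply [lower_tail] to the test function of [weak_drift]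
    with [kappa = B + 1] and [eta = 1]: along the levels the number of left jumps
    eventually exceeds [B] times the level. *)
Lemma zero_speed : 1 < M%:R * (2 * p - 1) < 2 -> has_speed P X 0.
Proof.
move=> hd; have /andP[d1 d2] := hd.
(* For [p = 1] the product [M (2p - 1)] is an integer. *)
have p1 : p < 1.
  have /andP[_] := hp; rewrite le_eqVlt => /orP[/eqP e|//].
  move: d1 d2; rewrite e (_ : 2 * 1 - 1 = 1) ?mulr1; last by ring.
  by rewrite ltr1n ltr_nat; case: (M) => [|[|]].
have key : {ae P, forall w, forall B : nat, exists k0 : nat, forall k, (k0 <= k)%N ->
    exists2 tau, first_hit (X ^~ w) (level k)%:Z tau & B%:R * (level k)%:R <= tau%:R :> R}.
  apply: ae_foralln => B.
  have [N [h [H [L [hH hdr]]]]] := @weak_drift R p hp M p1 hd (B%:R + 1).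
  have N0 : (0 < N)%N.
    case: N hdr => // hdr; have := hdr 0%N; rewrite min0n /chain_op /= .
    by have := ler0n R B; lra.
  have H0 : 0 <= H by have /andP[a b] := hH 0%N; exact: le_trans b.
  (* Small enough for both conditions of [lower_tail] with [eta = 1]. *)
  pose lam : R := 1 / (2 * (H + 1) * (L%:R + 1)).
  have L0 := ler0n R L; have B0 := ler0n R B.
  have lam0 : 0 < lam by rewrite divr_gt0// !mulr_gt0//; lra.
  have lamE : lam * ((H + 1) * (L%:R + 1)) = 1 / 2.
    by rewrite /lam; field; rewrite !gt_eqF//; lra.
  have lamHL : lam * H * L%:R <= 1 / 2.
    rewrite -lamE -mulrA; apply: ler_wpM2l; first exact: ltW.
    by apply: ler_pM; lra.
  have lamH : lam * H <= 1 / 2.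
    rewrite -lamE; apply: ler_wpM2l; first exact: ltW.
    by rewrite -[leLHS]mulr1; apply: ler_pM; lra.
  have eta0 : 0 < (1 : R) <= B%:R + 1 by apply/andP; split; [exact: ltr01|lra].
  have low n r := @lower_tail R p hp M N h H (B%:R + 1) 1 L N0 hH hdr eta0 lam lam0 lamH lamHL n r.
  have hr k : exists r, walkEn (level k) r (fun s => (pos s != (level k)%:Z)%:R) <= 1 / k.+1%:R ^+ 2.
    by apply: walkE_miss_small => //; rewrite divr_gt0// exprn_gt0.
  pose r k := projT1 (cid (hr k)).
  have hrk k := projT2 (cid (hr k)); rewrite -/(r _) in hrk.
  pose Q1 k s := pos s != (level k)%:Z.
  pose Q2 k s := (pos s == (level k)%:Z) && ((total_lefts (level k) s)%:R <= B%:R * (level k)%:R :> R).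
  pose F k := [set w | (fun s => Q1 k s || Q2 k s) (state_at M (level k)%:Z (X ^~ w) (r k))].
  have mF k : measurable (F k) by exact: (measurable_state erw _ _ (fun s => Q1 k s || Q2 k s)).
  have hF k : prob (F k) <= (1 + 4 / lam) / k.+1%:R ^+ 2.
    apply: le_trans (prob_walkE hp erw _ _ (fun s => Q1 k s || Q2 k s)) _.
    apply: le_trans (walkE_bool_union _ _ _ _ _ hp) _.
    have h1 := hrk k; have h2 := low (level k) (r k); rewrite addrK in h2.
    have n0 : 0 < (level k)%:R :> R by rewrite ltr0n level_gt0.
    have h3 : expR (- (lam * 1 / 2 * (level k)%:R)) <= 1 / (lam * 1 / 2 * (level k)%:R).
      by apply: expR_inv_bound; rewrite mulr1 mulr_gt0// divr_gt0.
    have h4 : 1 / (lam * 1 / 2 * (level k)%:R) <= 2 / lam / k.+1%:R ^+ 2.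
      rewrite (_ : 1 / _ = 2 / lam / (level k)%:R); last by field; rewrite !gt_eqF.
      apply: ler_wpM2l; first by rewrite divr_ge0// ltW.
      rewrite lef_pV2 ?posrE ?exprn_gt0// -natrX ler_nat /level leq_pexp2l//.
    rewrite mulrDl; rewrite /Q1 /Q2; apply: lerD => //.
    apply: (le_trans h2); have := le_trans h3 h4.
    by move: (expR _) ((k.+1%:R ^+ 2)^-1) => a b; lra.
  have := borel_cantelli mF hF; have hpath := path_ae hp erw.
  apply: filterS2 hpath => w [x0 xs] [k0 hk0]; exists k0 => k hk.
  have := hk0 k hk; rewrite /F /= /Q1 /Q2 => /negP; rewrite negb_or negbK negb_and => /andP[h1].
  rewrite h1 /= -ltNge => h2.
  have := state_at_hit M (level k)%:Z (X ^~ w) (r k); rewrite h1 => -[tau _ [h3 h4]].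
  exists tau => //.
  have [h5 _] := hit_time x0 xs (level_gt0 k) h3.
  have e : total_lefts (level k) (state_at M (level k)%:Z (X ^~ w) (r k)) = (\sum_(j < level k) left_jumps (X ^~ w) tau j%:Z)%N.
    by apply: eq_bigr => j _; exact: h4.
  rewrite e in h2; apply: le_trans (ltW h2) _; rewrite ler_nat.
  by apply: leq_trans h5; rewrite mul2n -addnn addnA leq_addl.
have h1 := path_ae hp erw; have h2 := hits_ae; have h3 := left_jumps_bounded_ae d1.
rewrite /has_speed.
have h4 : {ae P, forall w, (forall n : nat, exists t, X t w = n.+1%:Z) /\
   (forall i : nat, exists K, forall t, (left_jumps (X ^~ w) t i%:Z <= K)%N)}.
  exact: filterI h2 h3.
apply: filterS3 h1 h4 key => w [x0 xs] [h2' h3'] hk.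
apply: (@speed_zero R (X ^~ w) x0 xs).
  move=> C; have [k0 hk0] := hk (Num.truncn C).+1; exists k0 => k /hk0 [tau a b].
  exists tau => //; apply: le_trans b; apply: ler_wpM2r => //; exact: ltW (truncnS_gt C).
have [t1 ht1] := eventually_above x0 xs h2' h3' 0.
by exists t1.
Qed.

End Final.

(** * Positive speed for many cookies *)

Section Mean.
Variables (R : realType) (p : R).
Hypothesis hp : 1 / 2 <= p <= 1.
Variables (M s1 : nat).
Hypothesis hs1 : 4 <= (2 * p - 1) * s1%:R.
Hypothesis hM : (4 * s1 <= M)%N.
Local Notation K := (chain_op p M).
Local Notation id1 := (fun m : nat => m%:R : R).
Local Notation walkEn n r F := (walkE p (n%N)%:Z r (start_state M) F).

Definition chain_means : set R := [set y | exists N j, y = iter j (K N) id1 0%N].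
(** The limit of the mean of the chain, as the time and the cap tend to infinity; by
    monotonicity it is a supremum. *)
Definition mean_lefts : R := sup chain_means.

Lemma chain_means_has_sup : has_sup chain_means.
Proof.
split; first by exists (iter 0 (K 0) id1 0%N), 0%N, 0%N.
by exists (2 * s1%:R) => y [N [j ->]]; exact: (iterK_id_le hp hs1 hM).
Qed.

Lemma iterK_id_le_mean_lefts N j : iter j (K N) id1 0%N <= mean_lefts.
Proof. by apply: sup_upper_bound; [exact: chain_means_has_sup|exists N, j]. Qed.

Lemma mean_lefts_ge0 : 0 <= mean_lefts.
Proof. exact: (iterK_id_le_mean_lefts 0 0). Qed.

Lemma mean_lefts_approx (e : R) : 0 < e -> exists N j, mean_lefts - e < iter j (K N) id1 0%N.
Proof.
move=> e0; have [y [N [j ->]] h] := sup_adherent e0 chain_means_has_sup.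
by exists N, j.
Qed.

Definition second_moment_cst : R := (24 * s1%:R + 13) * (2 * s1%:R + 1).
Definition rate_loss_cst : R := second_moment_cst + rate_cst p s1.

Lemma second_moment_cst_ge0 : 0 <= second_moment_cst.
Proof. by rewrite /second_moment_cst mulr_ge0// addr_ge0// mulr_ge0. Qed.

Lemma rate_cst_ge0 : 0 <= rate_cst p s1.
Proof.
rewrite /rate_cst -/second_moment_cst; have h := q_gt0 hp hs1.
by rewrite !addr_ge0 ?second_moment_cst_ge0// divr_ge0 ?mulr_ge0// ltW.
Qed.

Lemma iterK_incr_le N i j : iter j (K N) id1 0%N <= iter (i + j) (K N) id1 0%N.
Proof.
elim: i => [//|i IH]; apply: le_trans IH _; rewrite addSn.
by apply: (iterK_incr hp); exact: nondecr_id.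
Qed.

(** Truncation at [J.+1] costs at most the second moment over [J.+1], and the mean
    at time [J] differs from the limit by [rate_cst] over [J.+1]. *)
Lemma capped_mean (J : nat) (e : R) : 0 < e -> exists2 N, (0 < N)%N &
  mean_lefts - e - rate_loss_cst / J.+1%:R <= iter J (K N) (fun m => (minn m J.+1)%:R) 0%N.
Proof.
move=> e0; have [N1 [j h1]] := mean_lefts_approx e0.
exists N1.+1 => //.
set N := N1.+1.
have h2 : mean_lefts - e < iter j (K N) id1 0%N.
  by apply: lt_le_trans h1 _; apply: (iterK_capmono hp) => //; exact: nondecr_id.
have J0 : 0 < J.+1%:R :> R by rewrite ltr0n.
have h3 := iterK_id_cauchy hp hs1 hM N j J.
have h4 : iter j (K N) id1 0%N <= iter (j + J) (K N) id1 0%N.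
  by rewrite addnC; exact: iterK_incr_le.
have h5 : iter (j + J) (K N) id1 0%N - iter J (K N) id1 0%N <= rate_cst p s1 / J.+1%:R.
  by rewrite ler_pdivlMr// mulrC.
have h6 : iter J (K N) id1 0%N - (J.+1%:R)^-1 * iter J (K N) (fun m => m%:R ^+ 2) 0%N <=
   iter J (K N) (fun m => (minn m J.+1)%:R) 0%N.
  rewrite -(iterKZ hp) -(iterKB hp); apply: (iterK_le hp) => m.
  have m0 := ler0n R m.
  case: (leqP m J.+1) => hm; first by rewrite gerBl mulr_ge0 ?invr_ge0// sqr_ge0.
  have hm' : J.+1%:R <= m%:R :> R by rewrite ler_nat ltnW.
  have : m%:R <= (J.+1%:R)^-1 * m%:R ^+ 2 :> R.
    by rewrite ler_pdivlMl// expr2; apply: ler_wpM2r.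
  move: (_^-1 * _) => z; lra.
have h7 : (J.+1%:R)^-1 * iter J (K N) (fun m => m%:R ^+ 2) 0%N <= second_moment_cst / J.+1%:R.
  rewrite mulrC; apply: ler_wpM2r; first by rewrite invr_ge0 ltW.
  have := iterK_sq_le hp hs1 hM N J; rewrite -/second_moment_cst; have := second_moment_cst_ge0; lra.
rewrite /rate_loss_cst mulrDl.
move: (second_moment_cst / _) (rate_cst p s1 / _) (_^-1 * _) h5 h6 h7 => a b c; lra.
Qed.

Definition low_tail_cst : R := 32 * (4 * rate_loss_cst + 3) ^+ 3.

(** The test function is [h = f + K f + ... + K^(J-1) f], where [f m] is [min(m, J+1)].
    The difference [K h - h] is [K^J f - f], and [K^J f] is at least [mu - eta / 2] at [0],
    hence everywhere, when [J] is of order [1 / eta].  Since [h] is at most [(J+1)^2], the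
    parameter [lam] of [lower_tail] is of order [eta^4], and [exp (- x) <= 1 / x] yields a
    bound of order [1 / (eta^5 n)]. *)
Lemma low_tail_mean (eta : R) (n r : nat) : 0 < eta <= 1 -> (0 < n)%N ->
  walkEn n r (fun s => ((pos s == n%:Z) && ((total_lefts n s)%:R <= (mean_lefts - eta) * n%:R))%:R)
  <= low_tail_cst / (eta ^+ 5 * n%:R).
Proof.
move=> /andP[e0 e1] n0.
have n0' : 0 < n%:R :> R by rewrite ltr0n.
have C40 : 0 <= rate_loss_cst by rewrite addr_ge0 ?second_moment_cst_ge0 ?rate_cst_ge0.
have RHS0 : 0 <= low_tail_cst / (eta ^+ 5 * n%:R).
  rewrite divr_ge0//; last by rewrite mulr_ge0 ?exprn_ge0// ltW.
  rewrite mulr_ge0// exprn_ge0//; lra.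
(* When [eta] exceeds [mean_lefts] the event is empty. *)
case: (ltP mean_lefts eta) => hmu.
  rewrite (_ : walkE _ _ _ _ _ = 0)// -[RHS](walkE_cst p n r (start_state M)).
  apply/le_anti/andP; split; apply: (walkE_le hp) => s; last by [].
  case: eqP => //= _; case: (lerP (total_lefts n s)%:R ((mean_lefts - eta) * n%:R)) => // h; exfalso.
  have : (mean_lefts - eta) * n%:R < 0 by rewrite nmulr_rlt0// subr_lt0.
  by have := ler0n R (total_lefts n s); lra.
have [J [hJ hJ2]] : exists J : nat, 4 * rate_loss_cst / eta < J.+1%:R /\ J.+1%:R <= (4 * rate_loss_cst + 3) / eta.
  exists (Num.truncn (4 * rate_loss_cst / eta)); split; first exact: truncnS_gt.
  have hT : (Num.truncn (4 * rate_loss_cst / eta))%:R <= 4 * rate_loss_cst / eta.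
    by rewrite truncn_le; apply: divr_ge0; [rewrite mulr_ge0|exact: ltW].
  have h1 : 1 <= 1 / eta by rewrite ler_pdivlMr// mul1r.
  move: hT h1; move: (Num.truncn (4 * rate_loss_cst / eta)) => u; rewrite -[u.+1%:R]natr1.
  by move: (eta^-1) => z; lra.
have J0 : 0 < J.+1%:R :> R by rewrite ltr0n.
have eta4 : 0 < eta / 4 by rewrite divr_gt0.
have [N N0 hN] := capped_mean J eta4.
have hCJ : rate_loss_cst / J.+1%:R <= eta / 4.
  rewrite ler_pdivrMr// -ler_pdivrMl// invf_div; apply: ltW; apply: le_lt_trans hJ.
  by rewrite mulrAC.
set decay := mean_lefts - eta / 2.
have hk : decay <= iter J (K N) (fun m => (minn m J.+1)%:R) 0%N.
  by apply: le_trans hN; rewrite /decay; move: hCJ; move: (rate_loss_cst / _) => z; lra.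
pose f m : R := (minn m J.+1)%:R.
have mf : nondecr f.
  by move=> m; rewrite ler_nat leq_min geq_minr andbT (leq_trans (geq_minl _ _)).
pose h m : R := \sum_(j < J) iter j (K N) f m.
pose H : R := J.+1%:R ^+ 2.
have hH m : 0 <= h m <= H.
  have b j : 0 <= iter j (K N) f m <= J.+1%:R.
    rewrite -{1}(iterK_cst hp M N j 0 m) -(iterK_cst hp M N j J.+1%:R m).
    by apply/andP; split; apply: (iterK_le hp) => k; rewrite /f ?ler_nat ?geq_minr.
  apply/andP; split; first by apply: sumr_ge0 => j _; have /andP[] := b j.
  apply: (@le_trans _ _ (\sum_(j < J) J.+1%:R)).
    by apply: ler_sum => j _; have /andP[] := b j.
  rewrite sumr_const card_ord -[_ *+ J]mulr_natl /H expr2; apply: ler_wpM2r; first exact: ltW.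
  by rewrite ler_nat.
have hdr m : h m + (decay - (minn m J.+1)%:R) <= K N h m.
  have -> : K N h m = h m + iter J (K N) f m - f m.
    rewrite /h /chain_op (negbin_sum hp _ _ _ _ (fun (j : 'I_J) => iter j (chain_op p M N) f)).
    rewrite -/(chain_op p M N) (eq_bigr (fun j : 'I_J => iter j.+1 (K N) f m)) //.
    elim: (J) => [|J' IH]; first by rewrite !big_ord0 /=; ring.
    by rewrite !big_ord_recr /= IH /=; ring.
  have := nondecr_le (nondecr_iterK hp M N J mf) (leq0n m); rewrite -/f in hk *; rewrite /f; lra.
have heta : 0 < eta / 2 <= decay by rewrite /decay; apply/andP; split; lra.
pose lam := eta / (4 * J.+1%:R ^+ 3).
have J1 : 1 <= J.+1%:R :> R by rewrite ler1n.
have J3 : 0 < J.+1%:R ^+ 3 :> R by rewrite exprn_gt0.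
have lam0 : 0 < lam by rewrite divr_gt0// mulr_gt0.
have lamHL : lam * H * J.+1%:R <= eta / 2 / 2.
  rewrite (_ : lam * H * J.+1%:R = eta / 4); last by rewrite /lam /H; field; rewrite gt_eqF.
  lra.
have lamH : lam * H <= 1 / 2.
  apply: (@le_trans _ _ (lam * H * J.+1%:R)); last by lra.
  by apply: ler_peMr => //; rewrite mulr_ge0 ?ltW// exprn_gt0.
have := @lower_tail R p hp M N h H decay (eta / 2) J.+1 N0 hH hdr heta lam lam0 lamH lamHL n r.
rewrite (_ : decay - eta / 2 = mean_lefts - eta); last by rewrite /decay; lra.
move=> low; apply: (le_trans low).
have y0 : 0 < lam * (eta / 2) / 2 * n%:R by rewrite !mulr_gt0 ?invr_gt0.
apply: (@le_trans _ _ (2 * (1 / (lam * (eta / 2) / 2 * n%:R)))).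
  by apply: ler_wpM2l => //; exact: expR_inv_bound.
have -> : 2 * (1 / (lam * (eta / 2) / 2 * n%:R)) = 32 * J.+1%:R ^+ 3 / (eta ^+ 2 * n%:R).
  by rewrite /lam; field; rewrite !gt_eqF.
have hJ3 : J.+1%:R ^+ 3 <= ((4 * rate_loss_cst + 3) / eta) ^+ 3.
  by rewrite lerXn2r ?nnegrE ?(ltW J0)// divr_ge0//; lra.
have -> : low_tail_cst / (eta ^+ 5 * n%:R) = 32 * ((4 * rate_loss_cst + 3) / eta) ^+ 3 / (eta ^+ 2 * n%:R).
  by rewrite /low_tail_cst; field; rewrite !gt_eqF.
apply: ler_wpM2r; first by rewrite invr_ge0 mulr_ge0 ?exprn_ge0// ltW.
by apply: ler_wpM2l.
Qed.

(** By [walkE_site], the left jumps from each site have mean at most the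
    mean of the chain at some time. *)
Lemma mean_total (n r : nat) :
  walkEn n r (fun s => (pos s == n%:Z)%:R * (total_lefts n s)%:R) <= n%:R * mean_lefts.
Proof.
have -> : walkEn n r (fun s => (pos s == n%:Z)%:R * (total_lefts n s)%:R) =
  walkEn n r (fun s => \sum_(i < n) (pos s == n%:Z)%:R * (lefts s i%:Z)%:R).
  by apply/le_anti/andP; split; apply: (walkE_le hp) => s; rewrite /total_lefts natr_sum mulr_sumr.
rewrite walkE_sum; apply: (@le_trans _ _ (\sum_(i < n) mean_lefts)); last first.
  by rewrite sumr_const card_ord mulr_natl.
apply: ler_sum => i _.
apply: le_trans (@walkE_site R p hp M n r i id1 (ltn_ord i) _ _) _ => //; first exact: nondecr_id.
exact: iterK_id_le_mean_lefts.
Qed.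

(** Markov inequality for [L_n - (mu - eta) n], which is negative only on the unlikely
    events that [L_n] is small or that [n] is not reached in time.  Its mean is at
    most [eta n]. *)
Lemma up_tail (eta eps d1 d2 : R) (n r : nat) : 0 < eta -> 0 < eps -> (0 < n)%N ->
  walkEn n r (fun s => (pos s != n%:Z)%:R) <= d2 ->
  walkEn n r (fun s => ((pos s == n%:Z) && ((total_lefts n s)%:R <= (mean_lefts - eta) * n%:R))%:R) <= d1 ->
  walkEn n r (fun s => ((pos s == n%:Z) && ((mean_lefts + eps) * n%:R <= (total_lefts n s)%:R))%:R)
  <= (eta + mean_lefts * d1 + mean_lefts * d2) / eps.
Proof.
move=> eta0 eps0 n0 h2 h1.
have n0' : 0 < n%:R :> R by rewrite ltr0n.
have m0 := mean_lefts_ge0.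
rewrite ler_pdivlMr//.
set Q1 := (fun s => (_ && _)%:R) in h1; set Q2 := (fun s => (pos s != _)%:R) in h2.
set Q3 := (fun s => (_ && _)%:R).
have key : walkEn n r (fun s => (eps * n%:R) * Q3 s + 0 * 1) <=
  walkEn n r (fun s => 1 * (1 * ((pos s == n%:Z)%:R * (total_lefts n s)%:R) + (mean_lefts * n%:R) * Q1 s) +
     1 * ((mean_lefts * n%:R) * Q2 s + (- ((mean_lefts - eta) * n%:R)) * 1)).
  apply: (walkE_le hp) => s; rewrite /Q1 /Q2 /Q3.
  have S0 := ler0n R (total_lefts n s).
  have mn : 0 <= mean_lefts * n%:R by rewrite mulr_ge0// ltW.
  have en : 0 < eta * n%:R by rewrite mulr_gt0.
  have en' : 0 < eps * n%:R by rewrite mulr_gt0.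
  case: eqP => _ /=; last by lra.
  case: (lerP (total_lefts n s)%:R ((mean_lefts - eta) * n%:R)) => a; case: (lerP ((mean_lefts + eps) * n%:R) (total_lefts n s)%:R) => b /=; lra.
rewrite !walkE_lin !walkE_cst in key.
have := mean_total n r.
have k1 := ler_wpM2l (mulr_ge0 m0 (ltW n0')) h1.
have k2 := ler_wpM2l (mulr_ge0 m0 (ltW n0')) h2.
set E := walkE _ _ _ _ Q3 in key *; set S := walkE _ _ _ _ (fun s => _ * _) in key * => k3.
set E1 := walkE _ _ _ _ Q1 in key k1; set E2 := walkE _ _ _ _ Q2 in key k2.
have : n%:R * (E * eps) <= n%:R * (eta + mean_lefts * d1 + mean_lefts * d2) by lra.
by rewrite ler_pM2l.
Qed.

End Mean.

Section Positive.
Context d (T : measurableType d) (R : realType) (P : probability T R).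
Variables (p : R) (M s1 : nat) (X : nat -> T -> int).
Hypothesis hp : 1 / 2 <= p <= 1.
Hypothesis hs1 : 4 <= (2 * p - 1) * s1%:R.
Hypothesis hM : (4 * s1 <= M)%N.
Hypothesis hd : 1 < M%:R * (2 * p - 1).
Hypothesis erw : is_erw P 0 (cookie_env M p) X.
Local Notation prob := (prob P).
Local Notation mean_lefts := (mean_lefts p M).
Local Notation walkEn n r F := (walkE p (n%N)%:Z r (start_state M) F).

(** Apply [low_tail_mean] and [up_tail] along the levels with
    [eta = 1 / k.+1 ^ 2] and a fixed [eps = 1 / l.+1]: almost surely the left jumps per
    site tend to [mean_lefts], and by [hit_time] the hitting times divided by the levels
    tend to [1 + 2 * mean_lefts].  Transience bounds the time spent at negative sites. *)
Lemma positive_speed : has_speed P X (1 + 2 * mean_lefts)^-1.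
Proof.
have m0 : 0 <= mean_lefts := mean_lefts_ge0 hp hs1 hM.
have key : {ae P, forall w, forall l : nat, exists k0 : nat, forall k, (k0 <= k)%N ->
    exists2 tau, first_hit (X ^~ w) (level k)%:Z tau &
     (mean_lefts - 1 / l.+1%:R) * (level k)%:R <= (\sum_(j < level k) left_jumps (X ^~ w) tau j%:Z)%N%:R <=
     (mean_lefts + 1 / l.+1%:R) * (level k)%:R}.
  apply: ae_foralln => l.
  pose eps : R := 1 / l.+1%:R.
  have eps0 : 0 < eps by rewrite divr_gt0.
  pose eta k : R := 1 / k.+1%:R ^+ 2.
  have eta0 k : 0 < eta k by rewrite divr_gt0// exprn_gt0.
  have eta1 k : eta k <= 1 by rewrite ler_pdivrMr ?exprn_gt0// mul1r exprn_ege1// ler1n.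
  have hr k : exists r, walkEn (level k) r (fun s => (pos s != (level k)%:Z)%:R) <= eta k.
    by apply: walkE_miss_small.
  pose r k := projT1 (cid (hr k)).
  have hrk k := projT2 (cid (hr k)); rewrite -/(r _) in hrk.
  pose Q1 k s := pos s != (level k)%:Z.
  pose Q2 k s := (pos s == (level k)%:Z) && ((total_lefts (level k) s)%:R <= (mean_lefts - eta k) * (level k)%:R).
  pose Q3 k s := (pos s == (level k)%:Z) && ((mean_lefts + eps) * (level k)%:R <= (total_lefts (level k) s)%:R).
  pose F k := [set w | (fun s => Q1 k s || (Q2 k s || Q3 k s)) (state_at M (level k)%:Z (X ^~ w) (r k))].
  have mF k : measurable (F k) by exact: (measurable_state erw _ _ (fun s => Q1 k s || (Q2 k s || Q3 k s))).
  pose LC := low_tail_cst p s1.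
  pose C : R := 1 + LC + (1 + mean_lefts * LC + mean_lefts) / eps.
  have hF k : prob (F k) <= C / k.+1%:R ^+ 2.
    apply: le_trans (prob_walkE hp erw _ _ (fun s => Q1 k s || (Q2 k s || Q3 k s))) _.
    apply: le_trans (walkE_bool_union _ _ _ _ _ hp) _.
    have h1 := hrk k.
    have h2 : walkEn (level k) (r k) (fun s => (Q2 k s)%:R) <= LC * eta k.
      apply: le_trans (low_tail_mean hp hs1 hM (r k) _ (level_gt0 k)) _; first by rewrite eta0 eta1.
      rewrite /LC /eta /level natrX le_eqVlt; apply/orP; left; apply/eqP.
      have u0 : (k.+1%:R : R) != 0 by rewrite pnatr_eq0.
      by move: u0; move: (k.+1%:R : R) => u u0; field.
    have h3 := up_tail hp hs1 hM (eta0 k) eps0 (level_gt0 k) h1 h2.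
    have h4 := walkE_bool_union (level k) (r k) (start_state M) (Q2 k) (Q3 k) hp.
    have -> : C / k.+1%:R ^+ 2 = eta k + (LC * eta k + (eta k + mean_lefts * (LC * eta k) + mean_lefts * eta k) / eps).
      have u0 : (k.+1%:R : R) != 0 by rewrite pnatr_eq0.
      have v0 : (l.+1%:R : R) != 0 by rewrite pnatr_eq0.
      rewrite /C /eta /eps; move: u0 v0; move: (k.+1%:R : R) (l.+1%:R : R) => u v u0 v0.
      by field; rewrite u0 v0.
    rewrite /Q1 in h1 *; apply: lerD => //; apply: le_trans h4 _; apply: lerD => //.
  have := borel_cantelli mF hF; have hpath := path_ae hp erw.
  apply: filterS2 hpath => w [x0 xs] [k0 hk0]; exists (k0 + l)%N => k hk.
  have := hk0 k (leq_trans (leq_addr _ _) hk).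
  rewrite /F /= /Q1 /Q2 /Q3 => /negP; rewrite !negb_or negbK !negb_and => /andP[h1].
  rewrite h1 /= -!ltNge => /andP[h2 h2'].
  have := state_at_hit M (level k)%:Z (X ^~ w) (r k); rewrite h1 => -[tau _ [h3 h4]].
  exists tau => //.
  have e : total_lefts (level k) (state_at M (level k)%:Z (X ^~ w) (r k)) = (\sum_(j < level k) left_jumps (X ^~ w) tau j%:Z)%N.
    by apply: eq_bigr => j _; exact: h4.
  rewrite e in h2 h2'; apply/andP; split; last exact: ltW.
  apply: le_trans (ltW h2); apply: ler_wpM2r => //; rewrite lerD2l lerN2.
  rewrite /eta !div1r lef_pV2 ?posrE ?exprn_gt0// -natrX ler_nat.
  apply: leq_trans (_ : k.+1 ^ 1 <= _)%N; first by rewrite expn1 ltnS (leq_trans (leq_addl _ _) hk).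
  by rewrite leq_pexp2l.
rewrite /has_speed.
have h1 := path_ae hp erw.
have h4 : {ae P, forall w, (forall n : nat, exists t, X t w = n.+1%:Z) /\
   (forall i : nat, exists K, forall t, (left_jumps (X ^~ w) t i%:Z <= K)%N)}.
  exact: filterI (hits_ae hp erw) (left_jumps_bounded_ae hp erw hd).
apply: filterS3 h1 h4 key => w [x0 xs] [h2' h3'] hk.
apply: (@speed_pos R (X ^~ w) x0 xs); first by lra.
move=> e e0.
have [K hK] := negative_visits_bounded x0 xs h2' h3'.
pose l := Num.truncn (3 / e).
have hl : 1 / l.+1%:R <= e / 3.
  rewrite -[e / 3]invf_div div1r lef_pV2 ?posrE ?divr_gt0//.
  exact: ltW (truncnS_gt _).
have [k0 hk0] := hk l.
(* From this level on, the [K] visits to negative sites are negligible. *)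
pose k1 := Num.truncn (6 * K%:R / e).
exists (k0 + k1)%N => k hkk.
have [tau f /andP[a b]] := hk0 k (leq_trans (leq_addr _ _) hkk).
exists tau => //.
have [t1 t2] := hit_time x0 xs (level_gt0 k) f.
set S := (\sum_(j < level k) _)%N in a b t1 t2.
have u1 : (level k)%:R + 2 * S%:R <= tau%:R :> R by rewrite -natrM -natrD ler_nat.
have u2 : tau%:R <= (level k)%:R + 2 * (S%:R + K%:R) :> R.
  rewrite -natrD -natrM -natrD ler_nat; apply: (leq_trans t2).
  by rewrite leq_add2l leq_pmul2l// leq_add2l.
have n0 : 0 < (level k)%:R :> R by rewrite ltr0n level_gt0.
have u3 : 2 * K%:R <= e / 3 * (level k)%:R.
  have : 6 * K%:R / e <= (level k)%:R.
    apply: ltW; apply: lt_le_trans (truncnS_gt _) _; rewrite ler_nat -/k1.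
    by apply: leq_trans (level_gt k); rewrite ltnS (leq_trans (leq_addl _ _) hkk).
  by rewrite ler_pdivrMr//; lra.
have hln := ler_wpM2r (ltW n0) hl.
move: a b hln; move: (1 / l.+1%:R) => z a b hln.
apply/andP; split; lra.
Qed.

End Positive.

Theorem theorem1p1 (R : realType) :
  (forall p : R, 1 / 2 < p < 1 ->
     exists M0 : nat, forall M : nat, (M0 < M)%N ->
       forall (d : measure_display) (T : measurableType d)
              (P : probability T R) (X : nat -> T -> int),
         is_erw P 0 (cookie_env M p) X ->
         exists v : R, has_speed P X v /\ 0 < v)
  /\
  (forall (p : R) (M : nat), 1 / 2 < p <= 1 -> (0 < M)%N ->
     1 < M%:R * (2 * p - 1) < 2 ->
       forall (d : measure_display) (T : measurableType d)
              (P : probability T R) (X : nat -> T -> int),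
         is_erw P 0 (cookie_env M p) X ->
         transient P X /\ has_speed P X 0).
Proof.
split=> [p /andP[p1 p2]|p M /andP[p1 p2] M0 hd d T P X erw].
  have q0 : 0 < 2 * p - 1 by lra.
  (* From the size [s1] on the failures fall short of the successes by [4] in the
     mean, and [s1] successes need at most a quarter of the cookies. *)
  pose s1 := (Num.truncn (4 / (2 * p - 1))).+1.
  exists (4 * s1)%N => M hM d T P X erw.
  have hp : 1 / 2 <= p <= 1 by apply/andP; split; lra.
  have hs1 : 4 <= (2 * p - 1) * s1%:R.
    by rewrite mulrC -ler_pdivrMr//; apply: ltW; exact: truncnS_gt.
  have hd : 1 < M%:R * (2 * p - 1).
    have h1 : s1%:R <= M%:R :> R by rewrite ler_nat; lia.
    have := ler_wpM2r (ltW q0) h1; lra.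
  exists (1 + 2 * mean_lefts p M)^-1; split.
    exact: (positive_speed hp hs1 (ltnW hM) hd erw).
  rewrite invr_gt0; have := mean_lefts_ge0 hp hs1 (ltnW hM); lra.
have hp : 1 / 2 <= p <= 1 by apply/andP; split; lra.
by split; [apply: (transient_erw hp erw); case/andP: hd|exact: (zero_speed hp erw hd)].
Qed.
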